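(* Consider an $n\times n$ input-queued switch under uniform traffic, with mean arrival rate matrix $\boldsymbol\lambda=\frac{1-\epsilon}n\mathbf 1$, $\epsilon\in(0,1)$. Then power-of-$d$ scheduling ($d\ge2$) and random $d$-flip scheduling ($d\ge1$) each achieve state-space collapse (SSC), and so their heavy traffic behaviour is MaxWeight-like, i.e. under each of these algorithms $$\lim_{\epsilon\downarrow0}\epsilon\,\mathbb E\Big[\sum_{i,j}\bar q_{ij}\Big]=\Big(1-\frac1{2n}\Big)\|\tilde{\boldsymbol\sigma}\|^2 .$$
   Context: Switch model. Fix $n$ (with $n\ge2$ for random $d$-flip); time slots are $t=0,1,2,\dots$. $\mathbf q(t)\in\mathbb Z_{\ge0}^{n\times n}$ is the queue length matrix, $\mathbf a(t)\in\mathbb Z_{\ge0}^{n\times n}$ the arrival matrix, and the schedule $\mathbf s(t)$ is an element of the set $\mathcal X$ of $n\times n$ permutation matrices. The evolution is $q_{ij}(t+1)=\max\{0,\,q_{ij}(t)+a_{ij}(t)-s_{ij}(t)\}$. $\langle\cdot,\cdot\rangle$ and $\|\cdot\|$ are the Frobenius inner product and norm; $\mathbf 1$ is the all-ones matrix. Let $\tilde{\mathcal H}_t=\{\mathbf q(0),\mathbf s(0),\dots,\mathbf s(t-1),\mathbf q(t),\mathbf s(t)\}$. Arrivals. (i) For each $(i,j)$, $a_{ij}(t)$ is i.i.d. in $t$; (ii) the arrival processes are independent across pairs $(i,j)$; (iii) $a_{ij}(t)\le a_{\max}<\infty$ for all $i,j,t$, with $a_{\max}$ not depending on $\epsilon$;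 (iv) $\mathbb P(\mathbf a(t)=\mathbf 0)>0$. $\mathbf a(t)$ is independent of $\tilde{\mathcal H}_t$. $\mathbb E[\mathbf a(t)]=\boldsymbol\lambda$, $\sigma_{ij}^2=\mathrm{Var}(a_{ij}(t))$. One considers a family of systems indexed by $\epsilon$ ($n$ fixed); the entrywise variances $\boldsymbol\sigma^2$ converge to $\tilde{\boldsymbol\sigma}^2$ as $\epsilon\downarrow0$. Uniform traffic means all $\lambda_{ij}$ are equal (variances may differ). Power-of-$d$: in slot $t$, sample $\mathbf s_1(t),\dots,\mathbf s_d(t)$ independently and uniformly at random (with replacement) from $\mathcal X$, independently of the past, and let $\mathbf s(t)$ be the one with the largest weight $\langle\mathbf q(t),\mathbf s_k(t)\rangle$. Flip step on a schedule $\mathbf s_1$ given $\mathbf q$: sample two distinct index pairs $(i,j),(k,l)$ uniformly at random among those with $s_{1,ij}=s_{1,kl}=1$; let $\mathbf s_2$ be obtained from $\mathbf s_1$ by setting $s_{2,ij}=s_{2,kl}=0$, $s_{2,il}=s_{2,kj}=1$; output whichever of $\mathbf s_1,\mathbf s_2$ has the larger weight $\langle\mathbf q,\cdot\rangle$. Random $d$-flip: in slot $t$, sample a schedule uniformly at random from $\mathcal X$ independently of the past, then apply the flip step (with $\mathbf q=\mathbf q(t)$) $d$ times consecutively with fresh randomness; the result is $\mathbf s(t)$. Cone. $\mathcal S=\{\mathbf x\in\mathbb R^{n\times n}: x_{ij}=w_i+\tilde w_j \text{ for some } w,\tilde w\in\mathbb R^n\}$, $\mathcal K=\mathcal S\cap\mathbb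 R_{\ge0}^{n\times n}$; $\mathbf x_{\|\mathcal K}$ is the Euclidean (Frobenius) projection of $\mathbf x$ onto $\mathcal K$, $\mathbf x_{\perp\mathcal K}=\mathbf x-\mathbf x_{\|\mathcal K}$. Markov chain and SSC. An algorithm achieves SSC if there is a process $X(t)$ associated with the switch that is a Markov chain on a countable state space such that: (A.1) $X(t)$ is $\sigma(\tilde{\mathcal H}_t)$-measurable, irreducible and aperiodic; (A.2) there is a function $g$ with $\mathbf q(t)=g(X(t))$ and $g^{-1}(\mathcal A)$ finite for every finite $\mathcal A\subset\mathbb Z^{n\times n}$; $X(t)$ is positive recurrent (the switch is stable); and there is $\epsilon_0>0$ such that for all $0<\epsilon\le\epsilon_0$ the steady-state queue length $\bar{\mathbf q}$ (limit in distribution of $\mathbf q(t)$) satisfies $\mathbb E[\|\bar{\mathbf q}_{\perp\mathcal K}\|^r]\le C_r$ for all $r\in\{1,2,\dots\}$, with $C_r$ independent of $\epsilon$. Here the chain is $X(t)=\mathbf q(t)$ with state space taken to be the set of states reachable from $\mathbf 0$. *)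

(* Defs.v *)
From HB Require Import structures.
From mathcomp Require Import all_boot all_order all_fingroup all_algebra.
From mathcomp Require Import all_classical all_reals all_analysis.

Set Implicit Arguments.
Unset Strict Implicit.
Unset Printing Implicit Defensive.

Import Order.TTheory GRing.Theory Num.Theory.
Import numFieldNormedType.Exports.

Local Open Scope classical_set_scope.
Local Open Scope ring_scope.

Section Frobenius_and_cone.
Context {R : realType} {n : nat}.
Implicit Types x y : 'M[R]_n.

Definition frob x : R := Num.sqrt (\sum_i \sum_j x i j ^+ 2).

Definition spaceS : set 'M[R]_n :=
  [set x | exists w w' : 'I_n -> R, forall i j, x i j = w i + w' j].

Definition coneK : set 'M[R]_n :=
  spaceS `&` [set x | forall i j, 0 <= x i j].

Definition is_projK x y : Prop :=
  coneK y /\ forall z, coneK z -> frob (x - y) <= frob (x - z).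

(* [coneK] is closed, convex and nonempty, so the nearest point exists and is
   unique; the default value of [xget] is never used. *)
Definition projK x : 'M[R]_n := xget 0 [set y | is_projK x y].

Definition perpK x : 'M[R]_n := x - projK x.

End Frobenius_and_cone.

Section Independence.
Context {R : realType} {d : measure_display} {Om : measurableType d}.

Definition discrete_rv (T : Type) (X : Om -> T) : Prop :=
  forall B : set T, measurable (X @^-1` B).

(* sigma-algebra generated by a family of discrete random elements *)
Definition sigma_of (K T : Type) (X : K -> Om -> T) : set (set Om) :=
  <<s [set A | exists (k : K) (B : set T), A = X k @^-1` B] >>.

Definition mutually_independent (P : probability Om R) (I : eqType)
    (F : I -> set (set Om)) : Prop :=
  forall (J : seq I) (A : I -> set Om), uniq J ->
    (forall i, i \in J -> F i (A i)) ->
    P (\big[setI/setT]_(i <- J) A i) = (\prod_(i <- J) P (A i))%E.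

End Independence.

Section Markov_chain.
Context {R : realType} {T : countType}.
Variables (S : set T) (p : T -> T -> R).
Local Open Scope ereal_scope.

(* [X] is a time-homogeneous chain with state space [S] and transition
   matrix [p]; values of [p] outside [S] are irrelevant. *)
Definition markov_chain (d : measure_display) (Om : measurableType d)
    (P : probability Om R) (X : nat -> Om -> T) : Prop :=
  [/\ forall t, P (X t @^-1` S) = 1,
      forall x y, S x -> S y -> (0 <= p x y)%R,
      forall x, S x -> \esum_(y in S) (p x y)%:E = 1 &
      forall (t : nat) (x : nat -> T), (forall k, S (x k)) ->
        P (\bigcap_(k in `I_t.+2) (X k @^-1` [set x k])) =
        P (\bigcap_(k in `I_t.+1) (X k @^-1` [set x k]))
          * (p (x t) (x t.+1))%:E].

Fixpoint step_prob (k : nat) (x y : T) : \bar R :=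
  if k is k'.+1 then \esum_(z in S) ((p x z)%:E * step_prob k' z y)
  else (x == y)%:R%:E.

Definition irreducible_chain : Prop :=
  forall x y, S x -> S y -> exists k, 0 < step_prob k x y.

(* the gcd of the possible return times is 1 *)
Definition aperiodic_chain : Prop :=
  forall x, S x -> forall m : nat,
    (forall k : nat, (0 < k)%N -> 0 < step_prob k x x -> (m %| k)%N) ->
    m = 1%N.

(* probability, starting from [x], that the first visit to [y] at a positive
   time happens at time [k.+1] *)
Fixpoint first_passage (k : nat) (x y : T) : \bar R :=
  if k is k'.+1 then
    \esum_(z in S `\ y) ((p x z)%:E * first_passage k' z y)
  else (p x y)%:E.

(* the return time to every state is almost surely finite and has a finite
   mean *)
Definition positive_recurrent : Prop :=
  forall x, S x ->
    \sum_(0 <= k <oo) first_passage k x x = 1 /\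
    \sum_(0 <= k <oo) (k.+1%:R%:E * first_passage k x x) < +oo.

End Markov_chain.

(* One switch: a sample space with its queue length, arrival and schedule
   processes. The schedule is stored as a permutation [sg], which stands for
   the permutation matrix [perm_mx sg], with a 1 at [(i, sg i)]. *)
Record switch (R : realType) (n : nat) := Switch {
  sw_disp : measure_display;
  sw_Om : measurableType sw_disp;
  sw_P : probability sw_Om R;
  sw_q : nat -> sw_Om -> 'M[nat]_n;
  sw_a : nat -> sw_Om -> 'M[nat]_n;
  sw_s : nat -> sw_Om -> 'S_n }.

Definition weight (n : nat) (q : 'M[nat]_n) (sg : 'S_n) : nat :=
  (\sum_i \sum_j q i j * (perm_mx sg : 'M[nat]_n) i j)%N.

(* Subtraction on [nat] is truncated, hence the maximum with 0. *)
Definition next_queue (n : nat) (q a : 'M[nat]_n) (sg : 'S_n) : 'M[nat]_n :=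
  \matrix_(i, j) (q i j + a i j - (perm_mx sg : 'M[nat]_n) i j)%N.

(* Probability mass function of a schedule, given the queue lengths. *)
Definition schedule_law (R : realType) (n : nat) := 'M[nat]_n -> 'S_n -> R.

Section Scheduling_algorithms.
Context {R : realType} {n : nat}.

Definition unif (T : finType) (A : {set T}) (x : T) : R :=
  (x \in A)%:R / #|A|%:R.

(* [rule q c] is the law of the schedule kept among the candidates [c]. It
   charges only candidates of largest weight, and is otherwise arbitrary: any
   (possibly randomized) way of breaking ties by means of [q] and [c] is
   allowed. *)
Definition selection_rule (rule : 'M[nat]_n -> seq 'S_n -> 'S_n -> R) : Prop :=
  forall (q : 'M[nat]_n) (c : seq 'S_n), c != [::] ->
    [/\ forall sg, 0 <= rule q c sg,
        \sum_sg rule q c sg = 1 &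
        forall sg, 0 < rule q c sg ->
          sg \in c /\ forall sg', sg' \in c -> (weight q sg' <= weight q sg)%N].

Variable rule : 'M[nat]_n -> seq 'S_n -> 'S_n -> R.

Definition power_of_d (d : nat) : schedule_law R n := fun q sg =>
  \sum_(ss : {ffun 'I_d -> 'S_n})
     (\prod_(k < d) unif [set: 'S_n] (ss k)) * rule q (codom ss) sg.

(* Ordered pairs of distinct positions of 1s in the matrix of [s1]. The result
   of a flip does not depend on the order. *)
Definition flip_pairs (s1 : 'S_n) : {set ('I_n * 'I_n) * ('I_n * 'I_n)} :=
  [set u | [&& u.1 != u.2, (perm_mx s1 : 'M[nat]_n) u.1.1 u.1.2 == 1%N
             & (perm_mx s1 : 'M[nat]_n) u.2.1 u.2.2 == 1%N]].

(* For [u = ((i, j), (k, l))] in [flip_pairs s1], the permutation that maps i to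
   l, k to j, and agrees with [s1] elsewhere. *)
Definition flip (s1 : 'S_n) (u : ('I_n * 'I_n) * ('I_n * 'I_n)) : 'S_n :=
  (tperm u.1.1 u.2.1 * s1)%g.

Definition flip_step (q : 'M[nat]_n) (s1 sg : 'S_n) : R :=
  \sum_u unif (flip_pairs s1) u * rule q [:: s1; flip s1 u] sg.

Definition random_flip (d : nat) : schedule_law R n := fun q =>
  iter d (fun (mu : 'S_n -> R) sg => \sum_s1 mu s1 * flip_step q s1 sg)
    (unif [set: 'S_n]).

End Scheduling_algorithms.

Section Switch_model.
Context {R : realType} {n : nat}.
Variable W : switch R n.
Local Notation P := (sw_P W).
Local Notation q := (@sw_q _ _ W).
Local Notation a := (@sw_a _ _ W).
Local Notation s := (@sw_s _ _ W).

(* sigma-algebra of q(0), s(0), ..., s(t-1), q(t) *)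
Definition history (t : nat) : set (set (sw_Om W)) :=
  <<s [set A | exists k : nat,
        ((k <= t)%N /\ exists B, A = q k @^-1` B) \/
        ((k < t)%N /\ exists B, A = s k @^-1` B)] >>.

(* sigma-algebra of q(0), s(0), ..., s(t-1), q(t), s(t) *)
Definition history_tilde (t : nat) : set (set (sw_Om W)) :=
  <<s [set A | exists k : nat, (k <= t)%N /\
        ((exists B, A = q k @^-1` B) \/ (exists B, A = s k @^-1` B))] >>.

Definition arrival (ij : 'I_n * 'I_n) (t : nat) (w : sw_Om W) : nat :=
  a t w ij.1 ij.2.

Definition arrivalR (i j : 'I_n) (t : nat) (w : sw_Om W) : R :=
  (a t w i j)%:R.

Record switch_arrivals (amax : nat) : Prop := {
  arr_meas : forall t, discrete_rv (a t);
  arr_ident : forall ij t B,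
    P (arrival ij t @^-1` B) = P (arrival ij 0%N @^-1` B);
  arr_indep_time : forall ij, mutually_independent P
    (fun t : nat => sigma_of (fun _ : unit => arrival ij t));
  arr_indep_pairs : mutually_independent P
    (fun ij : 'I_n * 'I_n => sigma_of (arrival ij));
  arr_bounded : forall t w i j, (a t w i j <= amax)%N;
  arr_zero : forall t, (0 < P (a t @^-1` [set \matrix_(i, j) 0%N]))%E;
  arr_indep_history : forall t A B, history_tilde t A ->
    P (A `&` (a t @^-1` B)) = (P A * P (a t @^-1` B))%E }.

Definition switch_dynamics : Prop :=
  [/\ forall t, discrete_rv (q t), forall t, discrete_rv (s t) &
      forall t w, q t.+1 w = next_queue (q t w) (a t w) (s t w)].

(* Given the past, s(t) is drawn from the law [mu (q t)]. *)
Definition scheduled_by (mu : schedule_law R n) : Prop :=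
  forall (t : nat) (A : set (sw_Om W)) (x : 'M[nat]_n) (sg : 'S_n),
    history t A ->
    P (A `&` (q t @^-1` [set x]) `&` (s t @^-1` [set sg])) =
    (P (A `&` (q t @^-1` [set x])) * (mu x sg)%:E)%E.

(* Queue length matrices reachable from the empty switch. *)
Inductive reachable (mu : schedule_law R n) : 'M[nat]_n -> Prop :=
| reachable0 : reachable mu (\matrix_(i, j) 0%N)
| reachableS x b sg : reachable mu x -> 0 < mu x sg ->
    (0 < P (a 0%N @^-1` [set b]))%E -> reachable mu (next_queue x b sg).

End Switch_model.

Record random_queue (R : realType) (n : nat) := RandomQueue {
  rq_disp : measure_display;
  rq_Om : measurableType rq_disp;
  rq_P : probability rq_Om R;
  rq_q : rq_Om -> 'M[nat]_n;
  rq_meas : discrete_rv rq_q }.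

(* q(t) converges in distribution to [Y]; on integer matrices every bounded
   function is a continuous test function. *)
Definition steady_state (R : realType) (n : nat) (W : switch R n)
    (Y : random_queue R n) : Prop :=
  forall f : 'M[nat]_n -> R, (exists M : R, forall x, `|f x| <= M) ->
    ('E_(sw_P W)[fun w => f (sw_q t w)])%E @[t --> \oo] -->
    ('E_(rq_P Y)[fun w => f (rq_q w)])%E.

Definition mean_total (R : realType) (n : nat) (Y : random_queue R n) : \bar R :=
  ('E_(rq_P Y)[fun w => (\sum_i \sum_j (rq_q w i j)%:R)%R])%E.

Definition perp_moment (R : realType) (n : nat) (r : nat)
    (Y : random_queue R n) : \bar R :=
  ('E_(rq_P Y)[fun w =>
     (frob (perpK (map_mx (fun m : nat => m%:R : R) (rq_q w))) ^+ r)%R])%E.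

Section State_space_collapse.
Context {R : realType} {n : nat}.
Variable F : R -> switch R n.

(* State space collapse of the family [F e], [0 < e < 1], the Markov chain
   associated with [F e] being [X e], with state space [S e]. *)
Definition SSC_via (T : R -> countType) (S : forall e, set (T e))
    (X : forall e, nat -> sw_Om (F e) -> T e)
    (g : forall e, T e -> 'M[nat]_n) : Prop :=
  [/\ forall e : R, 0 < e < 1 ->
        (exists p : T e -> T e -> R,
           [/\ markov_chain (S e) p (sw_P (F e)) (X e),
               irreducible_chain (S e) p,
               aperiodic_chain (S e) p &
               positive_recurrent (S e) p]) /\
        (forall t B, @history_tilde _ _ (F e) t (X e t @^-1` B)),
      forall e : R, 0 < e < 1 ->
        (forall t w, sw_q t w = g e (X e t w)) /\
        (forall A, finite_set A -> finite_set (S e `&` (g e @^-1` A))),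
      forall e : R, 0 < e < 1 -> exists Y, steady_state (F e) Y &
      exists e0 : R, 0 < e0 /\
      exists C : nat -> R, forall e : R, 0 < e < 1 -> e <= e0 ->
        forall Y, steady_state (F e) Y ->
        forall r : nat, (1 <= r)%N -> (perp_moment r Y <= (C r)%:E)%E].

Definition SSC : Prop :=
  exists (T : R -> countType) (S : forall e, set (T e))
    (X : forall e, nat -> sw_Om (F e) -> T e)
    (g : forall e, T e -> 'M[nat]_n), SSC_via S X g.

(* State space collapse with the chain X(t) = q(t). *)
Definition SSC_queue (mu : schedule_law R n) : Prop :=
  @SSC_via (fun=> 'M[nat]_n : countType) (fun e => [set x | reachable (F e) mu x])
    (fun e => @sw_q _ _ (F e)) (fun=> id).

Lemma SSC_queueW (mu : schedule_law R n) : SSC_queue mu -> SSC.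
Proof. by move=> h; do 4 eexists; exact: h. Qed.

(* A family of switches with n x n ports, uniform traffic of rate (1 - e) / n
   and limiting standard deviations [sigma], run under the algorithm [mu]. The
   initial queue lengths lie in the state space of the chain. *)
Record uniform_family (amax : nat) (sigma : 'M[R]_n) (mu : schedule_law R n) :
    Prop := {
  uf_arrivals : forall e : R, 0 < e < 1 -> switch_arrivals (F e) amax;
  uf_dynamics : forall e : R, 0 < e < 1 -> switch_dynamics (F e);
  uf_scheduled : forall e : R, 0 < e < 1 -> scheduled_by (F e) mu;
  uf_initial : forall e : R, 0 < e < 1 ->
    sw_P (F e) (sw_q 0%N @^-1` [set x | reachable (F e) mu x]) = 1%E;
  uf_mean : forall e : R, 0 < e < 1 -> forall t i j,
    ('E_(sw_P (F e))[arrivalR i j t] = ((1 - e) / n%:R)%:E)%E;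
  uf_variance : forall i j,
    ('V_(sw_P (F e))[arrivalR i j 0%N])%E @[e --> 0^'+] -->
    (sigma i j ^+ 2)%:E }.

Definition heavy_traffic_limit (sigma : 'M[R]_n) : Prop :=
  forall Y : R -> random_queue R n,
    (forall e : R, 0 < e < 1 -> steady_state (F e) (Y e)) ->
    (e%:E * mean_total (Y e))%E @[e --> 0^'+] -->
    ((1 - 1 / (2 * n)%:R) * frob sigma ^+ 2)%:E.

End State_space_collapse.

(* Main.v *)
Require Import Defs.
From HB Require Import structures.
From mathcomp Require Import all_boot all_order all_fingroup all_algebra.
From mathcomp Require Import all_classical all_reals all_analysis.
From mathcomp Require Import measurable_realfun ring lra.

(** The scheduling law enters through a single property, [maxweight_like]:
    given the queue [q], the mean weight of the schedule exceeds the mean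
    weight [total q / n] of a uniform schedule by at least a constant times
    each second difference [q i j + q k l - q i l - q k j]. For every second
    difference there are two permutations that differ by a transposition and
    whose weights differ by exactly this amount. With positive probability both
    of them are candidates of power-of-[d], respectively the two sides of a
    flip, and then the better one wins; in all other cases the selection does
    no worse than the first candidate, which is uniform
    ([power_of_d_maxweight_like], [random_flip_maxweight_like]).

    The second differences control the distance of [q] to the cone
    ([perpK_le_second_diff]). Hence the squared distance to a point of the cone
    has, up to a constant and a term of order [e], a negative drift
    proportional to the distance to the cone ([sqdist_drift]). Taking for this
    point the projection of [q] gives a drift of [perp_norm] that does not
    degenerate as [e] tends to [0] ([perp_norm_drift]); taking the point [0]
    gives a drift of the norm of [q] of order [e] ([frob_drift]). Increments
    are bounded, so each drift makes an exponential moment contract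
    ([exp_drift]). The exponential moment of the distance to the cone bounds
    all of its moments uniformly in [e] ([stationary_perp]), which is state
    space collapse.

    For fixed [e] the exponential of the norm of [q] is a Lyapunov function,
    and the empty queue is reached from every bounded set with a probability
    bounded below ([reach_empty]). Harris' contraction ([harris_contraction])
    then makes the [t]-step averages of every function [f] dominated by this
    one converge to a limit [stationary f]. One step averages over finitely
    many transitions, so that identities in the stationary regime are linear
    identities between the values of the functional [stationary]. It is the
    expectation of a random queue by tightness ([limit_law_exists]), and
    applied to the survival functions of a return time it yields positive
    recurrence by Kac's argument ([kernel_positive_recurrent]).

    The heavy traffic limit comes from the stationarity of [sqproj], the
    squared norm of the linear projection of [q] onto the matrices [w i + w'
    j]. In one step it changes in mean by [- 2 * (e / n) * total q], plus a
    constant made of the arrival variances, plus a term due to unused service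
    ([sqproj_step]). Service is unused only where the next queue is empty, and
    there the projected queue is as small as the distance to the cone; the mean
    unused service is [n * e] ([stationary_unused]). With state space collapse
    the last term is therefore of order [Num.sqrt e], and [e * total = (n / 2)
    * (2 / n - 1 / n ^ 2) * \sum var = (1 - 1 / (2 * n)) * \sum var] in the
    limit ([family_heavy_traffic]). *)

Set Implicit Arguments.
Unset Strict Implicit.
Unset Printing Implicit Defensive.

Import Order.TTheory GRing.Theory Num.Theory.
Import numFieldNormedType.Exports.

Local Open Scope classical_set_scope.
Local Open Scope ring_scope.

(** * Finitely branching Markov kernels *)

Section Kernel_average.
Context {R : realType} {T : Type} {J : finType}.
Variables (wt : T -> J -> R) (nxt : T -> J -> T).

Definition avg (f : T -> R) (x : T) : R := \sum_j wt x j * f (nxt x j).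

Hypothesis wt_ge0 : forall x j, 0 <= wt x j.
Hypothesis wt_sum1 : forall x, \sum_j wt x j = 1.

Lemma avg_le_at (f g : T -> R) x :
  (forall j, 0 < wt x j -> f (nxt x j) <= g (nxt x j)) -> avg f x <= avg g x.
Proof.
move=> fg; apply: ler_sum => j _.
have := wt_ge0 x j; rewrite le_eqVlt => /orP[/eqP <-|w0]; first by rewrite !mul0r.
by rewrite ler_wpM2l ?(ltW w0) ?fg.
Qed.

Lemma avg_le (f g : T -> R) : (forall x, f x <= g x) -> forall x, avg f x <= avg g x.
Proof. by move=> fg x; apply: avg_le_at. Qed.

Lemma avgD (f g : T -> R) x : avg (fun y => f y + g y) x = avg f x + avg g x.
Proof. by rewrite /avg -big_split /=; apply: eq_bigr => j _; rewrite mulrDr. Qed.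

Lemma avgZ (c : R) (f : T -> R) x : avg (fun y => c * f y) x = c * avg f x.
Proof. by rewrite /avg big_distrr /=; apply: eq_bigr => j _; rewrite mulrCA. Qed.

Lemma avg_cst (c : R) x : avg (fun=> c) x = c.
Proof. by rewrite /avg -big_distrl /= wt_sum1 mul1r. Qed.

Lemma eq_avg (f g : T -> R) : f =1 g -> avg f =1 avg g.
Proof. by move=> fg x; apply: eq_bigr => j _; rewrite fg. Qed.

Local Notation Pt t f := (iter t avg f).

Lemma avgn_le t (f g : T -> R) :
  (forall x, f x <= g x) -> forall x, Pt t f x <= Pt t g x.
Proof. by move=> fg; elim: t => [//|t IH] x; rewrite !iterS; exact: avg_le. Qed.

Lemma eq_avgn t (f g : T -> R) : f =1 g -> Pt t f =1 Pt t g.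
Proof. by move=> /funext ->. Qed.

Lemma avgnD t (f g : T -> R) x : Pt t (fun y => f y + g y) x = Pt t f x + Pt t g x.
Proof.
by elim: t x => [//|t IH] x; rewrite !iterS -avgD; apply: eq_avg => y; exact: IH.
Qed.

Lemma avgnZ t (c : R) (f : T -> R) x : Pt t (fun y => c * f y) x = c * Pt t f x.
Proof.
by elim: t x => [//|t IH] x; rewrite !iterS -avgZ; apply: eq_avg => y; exact: IH.
Qed.

Lemma avgn_cst t (c : R) x : Pt t (fun=> c) x = c.
Proof.
by elim: t x => [//|t IH] x; rewrite iterS -[RHS](avg_cst c x); apply: eq_avg.
Qed.

Lemma avgnDr t (f : T -> R) c x : Pt t (fun y => f y + c) x = Pt t f x + c.
Proof. by rewrite avgnD avgn_cst. Qed.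

Lemma avgnBl t (f : T -> R) c x : Pt t (fun y => c - f y) x = c - Pt t f x.
Proof.
rewrite -[c in RHS](avgn_cst t c x) -mulN1r -avgnZ -avgnD.
by apply: eq_avgn => y; rewrite mulN1r.
Qed.

Lemma avgn_norm t (f : T -> R) x : `|Pt t f x| <= Pt t (fun y => `|f y|) x.
Proof.
rewrite ler_norml; apply/andP; split; last by apply: avgn_le => y; exact: ler_norm.
rewrite -mulN1r -avgnZ; apply: avgn_le => y; rewrite mulN1r lerNl.
by rewrite -normrN ler_norm.
Qed.

Lemma avgn_ge0 t (f : T -> R) : (forall x, 0 <= f x) -> forall x, 0 <= Pt t f x.
Proof. by move=> f0 x; rewrite -(avgn_cst t 0 x); exact: avgn_le. Qed.

(** The geometric series of the errors [K] stays below [K / (1 - ga)]. *)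
Lemma avgn_drift (V : T -> R) (ga K : R) : 0 <= ga < 1 -> 0 <= K ->
    (forall x, 0 <= V x) -> (forall x, avg V x <= ga * V x + K) ->
  forall t x, Pt t.+1 V x <= ga * V x + K / (1 - ga).
Proof.
move=> /andP[g0 g1] K0 V0 dr.
have g1' : 0 < 1 - ga by rewrite subr_gt0.
have KE : K / (1 - ga) = ga * (K / (1 - ga)) + K by field; rewrite gt_eqF.
have Kp : 0 <= K / (1 - ga) by rewrite divr_ge0 // ltW.
have step t x : Pt t V x <= V x + K / (1 - ga) ->
    Pt t.+1 V x <= ga * V x + K / (1 - ga).
  move=> le; rewrite iterSr; apply: (le_trans (avgn_le t dr x)).
  by rewrite avgnDr avgnZ KE addrA lerD2r -mulrDr ler_wpM2l.
elim=> [|t IH] x; apply: step; first by rewrite lerDl.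
by apply: (le_trans (IH x)); rewrite lerD2r ler_piMl // ltW.
Qed.

End Kernel_average.

(** * Geometric ergodicity of a Markov kernel *)

Section Harris.
Context {R : realType} {T : countType} {J : finType}.
Variables (wt : T -> J -> R) (nxt : T -> J -> T).
Hypothesis wt_ge0 : forall x j, 0 <= wt x j.
Hypothesis wt_sum1 : forall x, \sum_j wt x j = 1.
Local Notation P := (avg wt nxt).
Local Notation Pt t f := (iter t (avg wt nxt) f).

Definition ind (A : set T) (x : T) : R := (`[< A x >])%:R.

Lemma ind_ge0 A x : 0 <= ind A x. Proof. exact: ler0n. Qed.

Lemma ind_le1 A x : ind A x <= 1. Proof. by rewrite /ind lern1 leq_b1. Qed.

(** Two independent copies of the chain disagree about [f] by at most the
    right-hand side: on the event that both sit at [x0] the difference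
    [f u - f v] vanishes, which saves [2] there. *)
Lemma coupling_le t (V f : T -> R) (b : R) (x0 : T) :
    0 <= b -> (forall x, 0 <= V x) ->
    (forall x y, f x - f y <= 2 + b * V x + b * V y) ->
  forall x y, Pt t f x - Pt t f y <=
    2 + b * Pt t V x + b * Pt t V y
    - 2 * (Pt t (ind [set x0]) x * Pt t (ind [set x0]) y).
Proof.
move=> b0 V0 fV x y; set i0 := ind [set x0].
have h u v : f u - f v <= 2 + b * V u + b * V v - 2 * (i0 u * i0 v).
  rewrite /i0 /ind; have bu := mulr_ge0 b0 (V0 u); have bv := mulr_ge0 b0 (V0 v).
  case: asboolP => [->|_]; last by rewrite mul0r mulr0 subr0 fV.
  case: asboolP => [->|_]; last by rewrite !mulr0 subr0 fV.
  by rewrite subrr !mulr1; have bx := mulr_ge0 b0 (V0 x0); lra.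
have hv u : f u - Pt t f y <=
    (2 + b * V u) + (b * Pt t V y - 2 * (i0 u * Pt t i0 y)).
  rewrite -avgnBl // -(avgnZ _ _ t b) mulrA -mulNr -avgnZ -avgnD addrC -avgnDr //.
  by apply: avgn_le => // v; have := h u v; lra.
rewrite -[X in X <= _](avgnDr nxt wt_sum1 t f (- Pt t f y)).
have -> : 2 + b * Pt t V x + b * Pt t V y - 2 * (Pt t i0 x * Pt t i0 y)
   = Pt t (fun u => b * V u + (- (2 * Pt t i0 y)) * i0 u) x + (2 + b * Pt t V y).
  by rewrite avgnD !avgnZ; ring.
rewrite -avgnDr //; apply: avgn_le => // u; have := hv u; lra.
Qed.

Variables (V : T -> R) (ga K : R) (x0 : T).
Hypothesis V_ge1 : forall x, 1 <= V x.
Hypothesis ga01 : 0 <= ga < 1.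
Hypothesis K_ge0 : 0 <= K.
Hypothesis V_drift : forall x, P V x <= ga * V x + K.
Hypothesis reach_x0 : forall r : R, exists (N : nat) (al : R),
  0 < al /\ forall x, V x <= r -> al <= Pt N.+1 (ind [set x0]) x.

Let V_ge0 x : 0 <= V x. Proof. exact: le_trans ler01 (V_ge1 x). Qed.

(** The contraction argument of Harris' theorem in the metric
    [2 + b * V x + b * V y]: far from [x0] the drift of [V] contracts; close to
    [x0] the two copies meet at [x0] with a probability bounded below, and [b]
    is taken so small that the growth of [V] does not spoil this. *)
Lemma harris_contraction : exists (b rho : R) (N : nat),
  [/\ 0 < b, 0 < rho < 1 &
   forall (f : T -> R) (M : R), 0 < M ->
    (forall x y, f x - f y <= M * (2 + b * V x + b * V y)) ->
    forall x y, Pt N.+1 f x - Pt N.+1 f y <= rho * M * (2 + b * V x + b * V y)].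
Proof.
have /andP[g0 g1] := ga01; have g1' : 0 < 1 - ga by rewrite subr_gt0.
pose K1 := K / (1 - ga) + 1.
have K1_gt0 : 0 < K1 by rewrite ltr_wpDl // divr_ge0 // ltW.
pose r := 4 * K1 / (1 - ga).
have r_gt0 : 0 < r by rewrite divr_gt0 // mulr_gt0.
have [N [al [al_gt0 hal]]] := reach_x0 r.
have dr x : Pt N.+1 V x <= ga * V x + K1.
  by apply: (le_trans (avgn_drift wt_ge0 wt_sum1 ga01 K_ge0 V_ge0 V_drift N x));
     rewrite lerD2l lerDl.
have al1 x : Pt N.+1 (ind [set x0]) x <= 1.
  by rewrite -(avgn_cst nxt wt_sum1 N.+1 1 x); apply: avgn_le => // z; exact: ind_le1.
pose al' := Num.min al 1.
have al'_gt0 : 0 < al' by rewrite lt_min al_gt0 ltr01.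
have al'_le1 : al' <= 1 by rewrite ge_min lexx orbT.
have al'2 : 0 < al' ^+ 2 <= 1 by rewrite exprn_gt0 //= expr_le1 // ltW.
pose b := al' ^+ 2 / (2 * K1).
have b_gt0 : 0 < b by case/andP: al'2 => ? _; rewrite divr_gt0 // mulr_gt0.
have bK : b * K1 = al' ^+ 2 / 2 by rewrite /b; field; rewrite gt_eqF.
pose g' := (1 + ga) / 2.
pose de := b * (1 - g') * r / (2 + b * r).
have br_gt0 : 0 < b * r by exact: mulr_gt0.
have g'1 : 0 < 1 - g' by rewrite /g'; lra.
have de_gt0 : 0 < de by rewrite /de divr_gt0 //; [rewrite mulr_gt0 // mulr_gt0|lra].
have de_le : de < 1.
  by rewrite /de ltr_pdivrMr ?mul1r; [rewrite mulrAC; have := br_gt0; rewrite /g'; nra|lra].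
pose rho := Num.max (1 - de) (Num.max ga (1 - al' ^+ 2 / 2)).
exists b, rho, N; split=> //.
  rewrite /rho !lt_max subr_gt0 de_le /= !gt_max g1 /= ltrBlDr ltrDl de_gt0 /=.
  by case/andP: al'2 => ? _; lra.
move=> f M Mp fM x y.
pose D := 2 + b * V x + b * V y.
have key (h : T -> R) : (forall u v, h u - h v <= 2 + b * V u + b * V v) ->
    Pt N.+1 h x - Pt N.+1 h y <= rho * D.
  move=> hV; apply: (le_trans (coupling_le N.+1 x0 (ltW b_gt0) V_ge0 hV x y)).
  have dx : b * Pt N.+1 V x <= b * (ga * V x + K1) by rewrite ler_pM2l.
  have dy : b * Pt N.+1 V y <= b * (ga * V y + K1) by rewrite ler_pM2l.
  set px := Pt N.+1 (ind [set x0]) x; set py := Pt N.+1 (ind [set x0]) y.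
  have px0 : 0 <= px by apply: avgn_ge0 => // z; exact: ind_ge0.
  have py0 : 0 <= py by apply: avgn_ge0 => // z; exact: ind_ge0.
  have Vx0 := V_ge0 x; have Vy0 := V_ge0 y.
  have D0 : 0 <= D by rewrite /D !addr_ge0 // mulr_ge0 // ltW.
  pose s := V x + V y; have DE : D = 2 + b * s by rewrite /D /s; ring.
  have [rs|sr] := leP r s.
    apply: (@le_trans _ _ ((1 - de) * D)); last first.
      by rewrite ler_wpM2r // /rho le_max lexx.
    have pp : 0 <= px * py by exact: mulr_ge0.
    have h1 : 2 * K1 <= (1 - ga) / 2 * s.
      have : (1 - ga) / 2 * r <= (1 - ga) / 2 * s by rewrite ler_wpM2l //; lra.
      by have -> : (1 - ga) / 2 * r = 2 * K1 by rewrite /r; field; rewrite gt_eqF.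
    have h2 : de * (2 + b * s) <= b * (1 - g') * s.
      rewrite /de mulrAC ler_pdivrMr; last by lra.
      have : 0 <= (s - r) * (b * (1 - g')) by rewrite mulr_ge0 ?subr_ge0 // ltW // mulr_gt0.
      lra.
    have h3 : b * (2 * K1) <= b * ((1 - ga) / 2 * s) by rewrite ler_pM2l.
    have e4 : b * (1 - g') * s = b * s - b * ga * s - b * ((1 - ga) / 2 * s).
      by rewrite /g'; field.
    rewrite mulrBl mul1r DE; rewrite /s in h2 e4 h3 *; lra.
  have ax : al' <= px.
    have := hal x _; rewrite -/px => hx; rewrite ge_min hx //.
    by apply: le_trans (ltW sr); rewrite /s lerDl.
  have ay : al' <= py.
    have := hal y _; rewrite -/py => hy; rewrite ge_min hy //.
    by apply: le_trans (ltW sr); rewrite /s lerDr.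
  have pp : al' ^+ 2 <= px * py by rewrite expr2 ler_pM // ltW.
  have r1 : ga <= rho by rewrite /rho !le_max lexx !orbT.
  have r2 : 1 - al' ^+ 2 / 2 <= rho by rewrite /rho !le_max lexx !orbT.
  have : ga * (b * s) <= rho * (b * s).
    by rewrite ler_wpM2r // mulr_ge0 ?(ltW b_gt0) // /s addr_ge0.
  rewrite DE mulrDr /s; lra.
have := key (fun z => M^-1 * f z) _.
rewrite !avgnZ -mulrBr mulrC ler_pdivrMr // -/D (mulrAC rho) => -> //.
by move=> u v; rewrite -mulrBr mulrC ler_pdivrMr // mulrC.
Qed.
End Harris.

Section Limit_functional.
Context {R : realType} {T : countType} {J : finType}.
Variables (wt : T -> J -> R) (nxt : T -> J -> T).
Hypothesis wt_ge0 : forall x j, 0 <= wt x j.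
Hypothesis wt_sum1 : forall x, \sum_j wt x j = 1.
Local Notation P := (avg wt nxt).
Local Notation Pt t f := (iter t (avg wt nxt) f).
Variables (V : T -> R) (ga K : R) (x0 : T).
Hypothesis V_ge1 : forall x, 1 <= V x.
Hypothesis ga01 : 0 <= ga < 1.
Hypothesis K_ge0 : 0 <= K.
Hypothesis V_drift : forall x, P V x <= ga * V x + K.
Hypothesis reach_x0 : forall r : R, exists (N : nat) (al : R),
  0 < al /\ forall x, V x <= r -> al <= Pt N.+1 (ind [set x0]) x.

Let V_ge0 x : 0 <= V x. Proof. exact: le_trans ler01 (V_ge1 x). Qed.

(** The functions for which the averages converge; they need not be bounded. *)
Definition dominated (f : T -> R) := exists C, forall x, `|f x| <= C * V x.

Lemma avgn_V_le t x : Pt t V x <= V x + K / (1 - ga).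
Proof.
have /andP[g0 g1] := ga01; have g1' : 0 < 1 - ga by rewrite subr_gt0.
case: t => [|t] /=; first by rewrite lerDl divr_ge0 // ltW.
apply: (le_trans (avgn_drift wt_ge0 wt_sum1 ga01 K_ge0 V_ge0 V_drift t x)).
by rewrite lerD2r ler_piMl // ltW.
Qed.

Lemma dominated_cst c : dominated (fun=> c).
Proof. by exists `|c| => x; rewrite ler_peMr. Qed.

Lemma dominatedV : dominated V.
Proof. by exists 1 => x; rewrite mul1r ger0_norm. Qed.

Lemma dominatedD f g : dominated f -> dominated g -> dominated (fun x => f x + g x).
Proof.
move=> [C fC] [D gD]; exists (C + D) => x.
by rewrite mulrDl (le_trans (ler_normD _ _)) // lerD.
Qed.

Lemma dominatedZ c f : dominated f -> dominated (fun x => c * f x).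
Proof.
by move=> [C fC]; exists (`|c| * C) => x; rewrite normrM -mulrA ler_wpM2l.
Qed.

Lemma dominatedB f g : dominated f -> dominated g -> dominated (fun x => f x - g x).
Proof.
move=> df dg; have := dominatedD df (dominatedZ (-1) dg).
by move=> [C h]; exists C => x; have := h x; rewrite mulN1r.
Qed.

Lemma dominated_le f g : (forall x, `|f x| <= g x) -> dominated g -> dominated f.
Proof.
move=> fg [C gC]; exists C => x; apply: (le_trans (fg x)).
exact: le_trans (ler_norm _) (gC x).
Qed.

Lemma bounded_dominated f M : (forall x, `|f x| <= M) -> dominated f.
Proof. by move=> fM; apply: dominated_le fM (dominated_cst M). Qed.

Lemma dominated_avgn t f : dominated f -> dominated (Pt t f).
Proof.
move=> [C fC]; have C0 : 0 <= C.
  by have := le_trans (normr_ge0 _) (fC x0); rewrite pmulr_lge0 // (lt_le_trans ltr01).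
apply: (@dominated_le _ (fun x => C * (V x + K / (1 - ga)))); last first.
  by apply: dominatedZ; apply: dominatedD; [exact: dominatedV|exact: dominated_cst].
move=> x; apply: (le_trans (avgn_norm nxt wt_ge0 t f x)).
apply: (le_trans (avgn_le nxt wt_ge0 t fC x)); rewrite avgnZ.
by rewrite ler_wpM2l // avgn_V_le.
Qed.

Lemma dominated_avg f : dominated f -> dominated (P f).
Proof. exact: (@dominated_avgn 1). Qed.

(** The times are split as [k * N.+1 + s]: domination bounds the oscillation
    after [s] steps uniformly in [s], and each further block of [N.+1] steps
    contracts it by the factor [rho]. *)
Lemma avg_oscillation f : dominated f -> forall (y : T) (eps : R), 0 < eps ->
  exists t0, forall t, (t0 <= t)%N -> forall u, `|Pt t f u - Pt t f y| <=
    eps * (1 + V u + V y).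
Proof.
move=> [C0 fC0] y eps eps0.
have [b [rho [N [b0 /andP[rho_gt0 rho1] contr]]]] :=
  harris_contraction wt_ge0 wt_sum1 V_ge1 ga01 K_ge0 V_drift reach_x0.
have rho0 := ltW rho_gt0.
pose D u v := 2 + b * V u + b * V v.
have bV u : 0 <= b * V u by rewrite mulr_ge0 // ltW.
have D0 u v : 0 <= D u v by rewrite /D !addr_ge0.
pose C := `|C0| + 1.
have C_gt0 : 0 < C by rewrite /C ltr_wpDl.
have fC u : `|f u| <= C * V u.
  by apply: (le_trans (fC0 u)); rewrite ler_wpM2r // /C (le_trans (ler_norm _)) // lerDl.
have /andP[g0 g1] := ga01.
pose K1 := K / (1 - ga); have K10 : 0 <= K1 by rewrite divr_ge0 // subr_ge0 ltW.
pose M := C / b * (1 + b * K1).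
have M0 : 0 < M by rewrite /M mulr_gt0 ?divr_gt0 // ltr_pwDl // mulr_ge0 // ltW.
have one s u v : Pt s f u - Pt s f v <= M * D u v.
  have nb w : `|Pt s f w| <= C * (V w + K1).
    apply: (le_trans (avgn_norm nxt wt_ge0 s f w)).
    by apply: (le_trans (avgn_le nxt wt_ge0 s fC w)); rewrite avgnZ ler_wpM2l ?avgn_V_le // ltW.
  apply: (@le_trans _ _ (C * (V u + K1) + C * (V v + K1))).
    rewrite lerD // ; first exact: le_trans (ler_norm _) (nb u).
    by apply: le_trans (nb v); rewrite -normrN ler_norm.
  have -> : M * D u v = C * (V u + K1 + (V v + K1)) + C / b * 2 + C * K1 * (b * V u + b * V v).
    by rewrite /M /D; field; rewrite gt_eqF.
  rewrite -mulrDr -[leRHS]addrA lerDl addr_ge0 //; last by rewrite mulr_ge0 ?addr_ge0 // mulr_ge0 // ltW.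
  by rewrite mulr_ge0 // ltW // divr_gt0.
have many k s u v : Pt (k * N.+1 + s) f u - Pt (k * N.+1 + s) f v <= (rho ^+ k * M) * D u v.
  elim: k u v => [|k IH] u v; first by rewrite mul0n add0n expr0 mul1r one.
  rewrite mulSn -addnA iterD exprS -(mulrA rho); apply: contr; first by rewrite mulr_gt0 // exprn_gt0.
  exact: IH.
have B0 : 0 < M * (2 + b) by rewrite mulr_gt0 // addr_gt0.
have [k hk] : exists k, rho ^+ k * (M * (2 + b)) <= eps.
  have : (fun k => rho ^+ k) @ \oo --> (0 : R) by apply: cvg_expr; rewrite ger0_norm.
  move=> /cvgrPdist_le /(_ (eps / (M * (2 + b)))) h.
  have [k _ hk] := h (divr_gt0 eps0 B0); exists k.
  have := hk k (leqnn k); rewrite /= sub0r normrN ger0_norm ?exprn_ge0 //.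
  by rewrite ler_pdivlMr.
exists (k * N.+1)%N => t /subnKC <- u.
have Dle a c : D a c <= (2 + b) * (1 + V a + V c).
  by rewrite /D; have := V_ge0 a; have := V_ge0 c; have := ltW b0; nra.
have fin a c : Pt (k * N.+1 + (t - k * N.+1)) f a - Pt (k * N.+1 + (t - k * N.+1)) f c <= eps * (1 + V a + V c).
  apply: (le_trans (many k (t - k * N.+1)%N a c)).
  apply: (@le_trans _ _ (rho ^+ k * M * ((2 + b) * (1 + V a + V c)))).
    by rewrite ler_wpM2l // mulr_ge0 ?exprn_ge0 // ltW.
  rewrite mulrA -(mulrA _ M); rewrite ler_wpM2r //.
  by rewrite !addr_ge0.
rewrite ler_norml fin andbT lerNl opprB.
by rewrite (addrAC 1) fin.
Qed.

(** The sequence at [x0] is Cauchy: its values at the times [t0 + s] and [t0]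
    differ by an average of oscillations at time [t0] against the law at time
    [s], under which [V] has a bounded mean. Other initial states differ from
    [x0] by a vanishing oscillation. *)
Lemma avgn_cvg_ex f : dominated f ->
  exists l : R, forall x, Pt t f x @[t --> \oo] --> l.
Proof.
move=> df; have c0 : cauchy ((fun t => Pt t f x0) @ \oo).
  apply: cauchy_exP => e e0.
  pose B := 1 + V x0 + K / (1 - ga) + V x0.
  have B0 : 0 < B.
    have /andP[g0 g1] := ga01.
    by rewrite /B -!addrA ltr_pwDl // !addr_ge0 // divr_ge0 // subr_ge0 ltW.
  have [t0 ht] := avg_oscillation df x0 (divr_gt0 e0 (addr_gt0 B0 ltr01)).
  exists (Pt t0 f x0); exists t0 => // t /= /subnK <-.
  rewrite /ball /= distrC iterD -(avgnDr nxt wt_sum1).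
  apply: (le_lt_trans (avgn_norm nxt wt_ge0 _ _ _)).
  apply: (le_lt_trans (avgn_le nxt wt_ge0 _ (ht t0 (leqnn _)) _)).
  rewrite avgnZ avgnDr // avgnD avgn_cst //; set A := 1 + _ + _.
  have AB : A < B + 1.
    by have := avgn_V_le (t - t0) x0; rewrite /A /B => h; lra.
  have B1 : 0 < B + 1 by exact: addr_gt0.
  by rewrite -mulrA gtr_pMr // mulrC ltr_pdivrMr // mul1r.
have cc : cvg ((fun t => Pt t f x0) @ \oo) by apply/cauchy_cvgP.
exists (lim ((fun t => Pt t f x0) @ \oo)) => x.
have -> : (fun t => Pt t f x) = (fun t => (Pt t f x - Pt t f x0) + Pt t f x0).
  by apply/funext => t; rewrite subrK.
rewrite -[X in _ --> X]add0r; apply: cvgD => //.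
apply/cvgrPdist_le => e e0.
have B0 : 0 < 1 + V x + V x0 by rewrite -addrA ltr_pwDl // addr_ge0.
have [t0 ht] := avg_oscillation df x0 (divr_gt0 e0 B0).
exists t0 => // t /= tt0; rewrite sub0r normrN (le_trans (ht t tt0 x)) //.
by rewrite divfK // gt_eqF.
Qed.

(** The expectation under the stationary law, available for every function
    dominated by [V] without constructing the law itself. *)
Definition stat (f : T -> R) : R := lim (Pt t f x0 @[t --> \oo]).

Lemma avgn_cvg f x : dominated f -> Pt t f x @[t --> \oo] --> stat f.
Proof.
move=> df; have [l hl] := avgn_cvg_ex df.
by rewrite /stat (cvg_lim _ (hl x0)) //; exact: hl.
Qed.

Lemma statD f g : dominated f -> dominated g ->
  stat (fun x => f x + g x) = stat f + stat g.
Proof.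
move=> df dg; apply: cvg_lim => //.
rewrite (_ : (fun t => _) = (fun t => Pt t f x0 + Pt t g x0)); last first.
  by apply/funext => t; rewrite avgnD.
by apply: cvgD; exact: avgn_cvg.
Qed.

Lemma statZ c f : dominated f -> stat (fun x => c * f x) = c * stat f.
Proof.
move=> df; apply: cvg_lim => //.
rewrite (_ : (fun t => _) = (fun t => c * Pt t f x0)); last first.
  by apply/funext => t; rewrite avgnZ.
by apply: cvgM; [exact: cvg_cst|exact: avgn_cvg].
Qed.

Lemma statB f g : dominated f -> dominated g ->
  stat (fun x => f x - g x) = stat f - stat g.
Proof.
move=> df dg; rewrite (_ : (fun x => _) = (fun x => f x + (-1) * g x)).
  by rewrite statD ?statZ ?mulN1r //; exact: dominatedZ.
by apply/funext => x; rewrite mulN1r.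
Qed.

Lemma stat_cst c : stat (fun=> c) = c.
Proof.
apply: cvg_lim => //; rewrite (_ : (fun t => _) = (fun=> c)); first exact: cvg_cst.
by apply/funext => t; rewrite avgn_cst.
Qed.

Lemma stat_le_of f C : dominated f -> (forall t, Pt t f x0 <= C) -> stat f <= C.
Proof.
move=> df fC; rewrite /stat; apply: limr_le.
  by apply/cvg_ex; exists (stat f); exact: avgn_cvg.
by near=> t; exact: fC.
Unshelve. all: by end_near. Qed.

Lemma stat_ge_of f C : dominated f -> (forall t, C <= Pt t f x0) -> C <= stat f.
Proof.
move=> df fC; rewrite /stat; apply: limr_ge.
  by apply/cvg_ex; exists (stat f); exact: avgn_cvg.
by near=> t; exact: fC.
Unshelve. all: by end_near. Qed.

Lemma stat_ge0 f : dominated f -> (forall x, 0 <= f x) -> 0 <= stat f.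
Proof. by move=> df f0; apply: stat_ge_of => // t; exact: avgn_ge0. Qed.

Lemma stat_le f g : dominated f -> dominated g -> (forall x, f x <= g x) ->
  stat f <= stat g.
Proof.
move=> df dg fg; rewrite -subr_ge0 -statB //; apply: stat_ge0.
  exact: dominatedB.
by move=> x; rewrite subr_ge0.
Qed.

Lemma stat_norm_le f g : dominated g -> (forall x, `|f x| <= g x) ->
  `|stat f| <= stat g.
Proof.
move=> dg fg; have df := dominated_le fg dg.
have le1 x : f x <= g x by exact: le_trans (ler_norm _) (fg x).
have le2 x : (-1) * f x <= g x.
  by rewrite mulN1r (le_trans _ (fg x)) // -normrN ler_norm.
rewrite ler_norml lerNl -mulN1r -statZ // !stat_le //; exact: dominatedZ.
Qed.

Lemma stat_avg f : dominated f -> stat (P f) = stat f.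
Proof.
move=> df; apply: cvg_lim => //.
rewrite (_ : (fun t => _) = (fun t => Pt t.+1 f x0)); last first.
  by apply/funext => t; rewrite iterSr.
by rewrite (cvg_shiftS (fun t => Pt t f x0)); exact: avgn_cvg.
Qed.

End Limit_functional.

(** * Exponential moments from a quadratic drift *)

Section Exponential_drift.
Context {R : realType} {T : Type} {J : finType}.
Variables (wt : T -> J -> R) (nxt : T -> J -> T).
Hypothesis wt_ge0 : forall x j, 0 <= wt x j.
Hypothesis wt_sum1 : forall x, \sum_j wt x j = 1.
Local Notation P := (avg wt nxt).

Lemma expR_le_quadratic (y : R) : y <= 1 / 2 -> expR y <= 1 + y + 2 * y ^+ 2.
Proof.
move=> y2; have y1 : 0 < 1 - y by lra.
have h : 1 - y <= expR (- y) by have := expR_ge1Dx (- y).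
have : expR y <= (1 - y)^-1.
  by rewrite -[leLHS]invrK -expRN lef_pV2 // posrE // expR_gt0.
move=> /le_trans; apply; rewrite -[leLHS]mul1r ler_pdivrMr //.
have : 0 <= y ^+ 2 * (1 - 2 * y) by rewrite mulr_ge0 ?sqr_ge0 //; lra.
by move=> h0; rewrite [leRHS](_ : _ = 1 + y ^+ 2 * (1 - 2 * y)); [lra|ring].
Qed.

(** Where [v] is large, the drift of [v ^+ 2] forces a drift at most [- c / 2]
    of [v] itself; since the jumps are bounded, the quadratic term in the
    expansion of [expR (th * (v' - v))] is then dominated by the linear one. *)
Lemma exp_drift (v : T -> R) (c B D th : R) :
    0 < c -> 0 <= B -> 0 <= D -> 0 < th ->
    th * D <= 1 / 2 -> 8 * th * D ^+ 2 <= c ->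
    (forall x, 0 <= v x) -> (forall x j, `|v (nxt x j) - v x| <= D) ->
    (forall x, P (fun y => v y ^+ 2) x <= v x ^+ 2 - 2 * c * v x + B) ->
  forall x, P (fun y => expR (th * v y)) x <=
    (1 - th * c / 4) * expR (th * v x)
    + (1 + th * c / 4) * expR (th * (B / c + D)).
Proof.
move=> c0 B0 D0 th0 thD thD2 v0 vD dr x.
have Bc0 : 0 <= B / c by rewrite divr_ge0 // ltW.
have tc0 : 0 < th * c / 4 by rewrite divr_gt0 // mulr_gt0.
have [vle|vgt] := leP (v x) (B / c).
  have h1 : P (fun y => expR (th * v y)) x <= expR (th * (B / c + D)).
    rewrite -[leRHS](avg_cst nxt wt_sum1 _ x); apply: avg_le_at => // j _.
    rewrite ler_expR ler_pM2l //.
    have := ler_normlW (vD x j); lra.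
  have h2 : expR (th * v x) <= expR (th * (B / c + D)).
    by rewrite ler_expR ler_pM2l // (le_trans vle) // lerDl.
  have h3 := expR_gt0 (th * v x).
  move: h1 h2 h3; set a := P _ _; set b := expR _; set d := expR _ => h1 h2 h3.
  have : 0 <= th * c / 4 * (b - d) by rewrite mulr_ge0 ?subr_ge0 // ltW.
  lra.
have vx0 : 0 < v x by exact: le_lt_trans Bc0 vgt.
have dv : P (fun y => v y - v x) x <= - c / 2.
  have h : P (fun y => 2 * v x * (v y - v x)) x <= P (fun y => v y ^+ 2 + - v x ^+ 2) x.
    apply: avg_le => // y; rewrite -subr_ge0.
    have -> : v y ^+ 2 + - v x ^+ 2 - 2 * v x * (v y - v x) = (v y - v x) ^+ 2 by ring.
    exact: sqr_ge0.
  move: h; rewrite avgZ (avgD _ _ (fun y => v y ^+ 2)) avg_cst // => h.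
  have h2 : B <= c * v x by rewrite mulrC -ler_pdivrMr // ltW.
  have : 2 * v x * P (fun y => v y - v x) x <= 2 * v x * (- c / 2).
    have := dr x; lra.
  by rewrite ler_pM2l // mulr_gt0.
have -> : P (fun y => expR (th * v y)) x
    = expR (th * v x) * P (fun y => expR (th * (v y - v x))) x.
  by rewrite -avgZ; apply: eq_avg => y; rewrite -expRD; congr expR; ring.
have le1 : P (fun y => expR (th * (v y - v x))) x <= 1 - th * c / 4.
  apply: (@le_trans _ _ (P (fun y => th * (v y - v x) + (1 + 2 * th ^+ 2 * D ^+ 2)) x)).
    apply: avg_le_at => // j _; have jD := vD x j.
    have le2 : th * (v (nxt x j) - v x) <= 1 / 2.
      by apply: le_trans thD; rewrite ler_pM2l // ler_normlW.
    apply: (le_trans (expR_le_quadratic le2)).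
    have : (v (nxt x j) - v x) ^+ 2 <= D ^+ 2.
      by rewrite -real_normK ?num_real // lerXn2r ?nnegrE.
    rewrite exprMn => h.
    have := ler_wpM2l (sqr_ge0 th) h; lra.
  rewrite avgD avgZ avg_cst //.
  have h1 : th * P (fun y => v y - v x) x <= th * (- c / 2) by rewrite ler_pM2l.
  have h2 : th * (8 * th * D ^+ 2) <= th * c by rewrite ler_pM2l.
  lra.
rewrite mulrC -[leLHS]addr0 lerD //.
  by rewrite ler_pM2r // expR_gt0.
by rewrite mulr_ge0 ?expR_ge0 // addr_ge0 // ltW.
Qed.

End Exponential_drift.

(** The constant is explicit so that moment bounds derived from it depend on
    [th] only. *)
Lemma pow_le_expR {R : realType} (th x : R) (r : nat) : 0 < th -> 0 <= x ->
  x ^+ r <= (r.+1%:R / th) ^+ r * expR (th * x).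
Proof.
move=> th0 x0; pose k : R := r.+1%:R / th.
have k0 : 0 < k by rewrite divr_gt0.
rewrite -/k; pose y := x / k.
have y0 : 0 <= y by rewrite divr_ge0 // ltW.
have xE : x = k * y by rewrite /y mulrC divfK // gt_eqF.
have le1 : y <= expR y by apply: (le_trans _ (expR_ge1Dx y)); rewrite lerDr.
rewrite {1}xE exprMn ler_wpM2l ?exprn_ge0 ?(ltW k0) //.
apply: (@le_trans _ _ (expR y ^+ r)); first by rewrite lerXn2r ?nnegrE ?expR_ge0.
rewrite -expRM_natl ler_expR xE /k mulrA (mulrCA th) mulfV ?gt_eqF // mulr1.
by rewrite ler_wpM2r // ler_nat.
Qed.

Section Drift_rate.
Context {R : realType}.
Variables (c B D : R).

(** An exponent admissible in [exp_drift]: [c] is the drift, [D] the bound on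
    the jumps. The last term of the minimum keeps [drift_factor] nonnegative. *)
Definition drift_rate : R := Num.min (1 / (2 * D)) (Num.min (c / (8 * D ^+ 2)) (1 / c)).
Definition drift_factor : R := 1 - drift_rate * c / 4.
Definition drift_const : R := (1 + drift_rate * c / 4) * expR (drift_rate * (B / c + D)).

Hypotheses (c_gt0 : 0 < c) (D_gt0 : 0 < D).

Lemma drift_rate_gt0 : 0 < drift_rate.
Proof. by rewrite !lt_min !divr_gt0 // ?mulr_gt0 ?exprn_gt0. Qed.

Lemma drift_rate_le : [/\ drift_rate * D <= 1 / 2, 8 * drift_rate * D ^+ 2 <= c
  & drift_rate * c <= 1].
Proof.
have D2 : 0 < D ^+ 2 by rewrite exprn_gt0.
split.
- rewrite -ler_pdivlMr //; have -> : 1 / 2 / D = 1 / (2 * D) by field; rewrite gt_eqF.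
  by rewrite ge_min lexx.
- rewrite -ler_pdivlMr // mulrC -ler_pdivlMr //.
  have -> : c / D ^+ 2 / 8 = c / (8 * D ^+ 2) by field; rewrite gt_eqF.
  by rewrite !ge_min lexx orbT.
- by rewrite -ler_pdivlMr // !ge_min lexx !orbT.
Qed.

Lemma drift_factor01 : 0 <= drift_factor < 1.
Proof.
have [_ _ h] := drift_rate_le; have h0 := mulr_gt0 drift_rate_gt0 c_gt0.
by rewrite /drift_factor; apply/andP; split; lra.
Qed.

Lemma drift_const_ge0 : 0 <= drift_const.
Proof.
have h0 := mulr_gt0 drift_rate_gt0 c_gt0.
by rewrite mulr_ge0 ?expR_ge0 // addr_ge0 // divr_ge0 // ltW.
Qed.

Lemma exp_drift_rate (T : Type) (J : finType) (wt : T -> J -> R) (nxt : T -> J -> T)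
    (v : T -> R) :
    (forall x j, 0 <= wt x j) -> (forall x, \sum_j wt x j = 1) -> 0 <= B ->
    (forall x, 0 <= v x) -> (forall x j, `|v (nxt x j) - v x| <= D) ->
    (forall x, avg wt nxt (fun y => v y ^+ 2) x <= v x ^+ 2 - 2 * c * v x + B) ->
  forall x, avg wt nxt (fun y => expR (drift_rate * v y)) x <=
    drift_factor * expR (drift_rate * v x) + drift_const.
Proof.
move=> wt0 wt1 B0 v0 vD dr x; have [h1 h2 _] := drift_rate_le.
exact: (exp_drift wt0 wt1 c_gt0 B0 (ltW D_gt0) drift_rate_gt0 h1 h2 v0 vD dr).
Qed.

End Drift_rate.

(** * Irreducibility, aperiodicity and positive recurrence *)

Section Chain_of_a_kernel.
Context {R : realType} {T : countType} {J : finType}.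
Variables (wt : T -> J -> R) (nxt : T -> J -> T) (S : set T).
Hypothesis wt_ge0 : forall x j, 0 <= wt x j.
Hypothesis wt_sum1 : forall x, \sum_j wt x j = 1.
Hypothesis S_closed : forall x j, S x -> 0 < wt x j -> S (nxt x j).
Local Notation P := (avg wt nxt).
Local Notation Pt t f := (iter t (avg wt nxt) f).

Definition kernel_mx (x y : T) : R := P (ind [set y]) x.

Lemma kernel_mx_ge0 x y : 0 <= kernel_mx x y.
Proof. by apply: sumr_ge0 => j _; rewrite mulr_ge0 // ind_ge0. Qed.

(** A state has finitely many successors, so that sums over the state space
    against the transition matrix are finite averages. *)
Lemma esum_kernel_mx (A : set T) (g : T -> R) x : (forall z, 0 <= g z) ->
  (\esum_(z in A) ((kernel_mx x z)%:E * (g z)%:E))%E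
  = (P (fun z => ind A z * g z) x)%:E.
Proof.
move=> g0; rewrite (eq_esum (b := fun z =>
  (\sum_(j : J) (wt x j * ind [set z] (nxt x j) * g z)%:E)%E)); last first.
  by move=> z _; rewrite -EFinM /kernel_mx /avg big_distrl /= sumEFin.
rewrite esum_sum; last first.
  by move=> z j _ _; rewrite lee_fin !mulr_ge0 // ind_ge0.
rewrite /avg -sumEFin; apply: eq_bigr => j _.
rewrite esum_mkcond (esumID [set nxt x j]); last first.
  by move=> z _; case: ifP => // _; rewrite lee_fin !mulr_ge0 // ind_ge0.
rewrite setTI esum_set1; last first.
  by case: ifP => // _; rewrite lee_fin !mulr_ge0 // ind_ge0.
rewrite esum1 ?adde0; last first.
  move=> z [_ /= zn]; case: ifP => // _.
  by rewrite /ind asboolF ?mulr0 ?mul0r // => /= e; apply: zn; rewrite e.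
rewrite {1}/ind asboolT // mulr1 /ind.
case: ifPn => [/set_mem h|/negP h]; first by rewrite asboolT // mul1r.
by rewrite asboolF ?mul0r ?mulr0 // => h'; apply: h; exact: mem_set.
Qed.

Lemma esum_kernel_mx_closed (g : T -> R) x : S x -> (forall z, 0 <= g z) ->
  (\esum_(z in S) ((kernel_mx x z)%:E * (g z)%:E))%E = (P g x)%:E.
Proof.
move=> Sx g0; rewrite esum_kernel_mx //; congr EFin.
by apply/eqP; rewrite eq_le !avg_le_at // => j wj;
  rewrite /ind asboolT ?mul1r //; exact: S_closed.
Qed.

Lemma kernel_mx_sum x : S x -> (\esum_(y in S) (kernel_mx x y)%:E)%E = 1%E.
Proof.
move=> Sx; rewrite -(avg_cst nxt wt_sum1 1 x) -esum_kernel_mx_closed //.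
by apply: eq_esum => y _; rewrite mule1.
Qed.

Lemma step_probE k x y : S x -> step_prob S kernel_mx k x y = (Pt k (ind [set y]) x)%:E.
Proof.
elim: k x => [|k IH] x Sx /=; first by rewrite /ind /=; case: asboolP => [->|/eqP/negbTE ->]; rewrite ?eqxx.
rewrite -esum_kernel_mx_closed //; last by apply: avgn_ge0 => // z; exact: ind_ge0.
by apply: eq_esum => z Sz; rewrite IH.
Qed.

(** Chapman-Kolmogorov, keeping only the paths that are at [y] at time [k]. *)
Lemma avgn_ind_split k m x y z :
  Pt k (ind [set y]) x * Pt m (ind [set z]) y <= Pt (k + m) (ind [set z]) x.
Proof.
rewrite iterD mulrC -avgnZ; apply: avgn_le => // u; rewrite /ind.
case: asboolP => [->|_]; first by rewrite mulr1.
by rewrite mulr0; apply: avgn_ge0 => // v; exact: ind_ge0.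
Qed.

Variable x0 : T.
Hypothesis x0_loop : 0 < P (ind [set x0]) x0.
Hypothesis to_x0 : forall x, S x -> exists k, 0 < Pt k (ind [set x0]) x.
Hypothesis from_x0 : forall y, S y -> exists k, 0 < Pt k (ind [set y]) x0.

Lemma kernel_irreducible : irreducible_chain S kernel_mx.
Proof.
move=> x y Sx Sy; have [k hk] := to_x0 Sx; have [m hm] := from_x0 Sy.
exists (k + m)%N; rewrite step_probE // lte_fin.
by apply: lt_le_trans (avgn_ind_split k m x x0 y); exact: mulr_gt0.
Qed.

(** A path through [x0] may use the loop at [x0] or not, so that two
    consecutive integers are return times. *)
Lemma kernel_aperiodic : aperiodic_chain S kernel_mx.
Proof.
move=> x Sx m hm; have [k hk] := to_x0 Sx; have [l hl] := from_x0 Sx.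
have h1 : 0 < Pt (k + 1 + l) (ind [set x]) x.
  apply: lt_le_trans (avgn_ind_split _ _ _ x0 _); rewrite mulr_gt0 //.
  by apply: lt_le_trans (avgn_ind_split _ _ _ x0 _); exact: mulr_gt0.
have h2 : 0 < Pt (k + 1 + 1 + l) (ind [set x]) x.
  apply: lt_le_trans (avgn_ind_split _ _ _ x0 _); rewrite mulr_gt0 //.
  apply: lt_le_trans (avgn_ind_split _ _ _ x0 _); rewrite mulr_gt0 //.
  by apply: lt_le_trans (avgn_ind_split _ _ _ x0 _); exact: mulr_gt0.
have d1 : (m %| k + 1 + l)%N.
  by apply: hm; rewrite ?step_probE ?lte_fin // addn1 addSn.
have d2 : (m %| k + 1 + 1 + l)%N.
  by apply: hm; rewrite ?step_probE ?lte_fin // addn1 addSn.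
by move: d2; rewrite -(addnA (k + 1)) (addnC 1) addnA dvdn_addr // dvdn1 => /eqP.
Qed.

(** Survival functions of the return time: [surv y k x] is the probability
    that the chain started at [x] avoids [y] at the times [1, ..., k]. *)
Fixpoint surv (y : T) (k : nat) (x : T) : R :=
  if k is k'.+1 then P (fun z => ind (~` [set y]) z * surv y k' z) x else 1.

Lemma surv_ge0 y k x : 0 <= surv y k x.
Proof.
elim: k x => [|k IH] x //=; apply: sumr_ge0 => j _.
by rewrite mulr_ge0 // mulr_ge0 // ind_ge0.
Qed.

Lemma indC (A : set T) x : ind (~` A) x = 1 - ind A x :> R.
Proof.
rewrite /ind /=; case: asboolP => h; case: asboolP => h' //.
  by rewrite subr0.
by rewrite subrr.
Qed.

Lemma surv_le y k x : surv y k.+1 x <= surv y k x.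
Proof.
elim: k x => [|k IH] x /=.
  rewrite -[leRHS](avg_cst nxt wt_sum1 1 x); apply: avg_le => // z.
  by rewrite mulr1 ind_le1.
by apply: avg_le => // z; apply: ler_wpM2l; [exact: ind_ge0|exact: IH].
Qed.

Lemma first_passageE y k x : S x ->
  first_passage S kernel_mx k x y = (surv y k x - surv y k.+1 x)%:E.
Proof.
elim: k x => [|k IH] x Sx.
  congr EFin; rewrite /= /kernel_mx.
  rewrite -(avg_cst nxt wt_sum1 1 x) -mulN1r -avgZ -avgD.
  by apply: eq_avg => z; rewrite indC avg_cst //; ring.
pose g z := surv y k z - surv y k.+1 z.
have g0 z : 0 <= g z by rewrite subr_ge0 surv_le.
transitivity (\esum_(z in S `\ y) ((kernel_mx x z)%:E * (g z)%:E))%E.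
  by rewrite [LHS]/=; apply: eq_esum => z [Sz _]; rewrite IH.
rewrite esum_kernel_mx //; congr EFin.
rewrite [surv y k.+1 x]/= [surv y k.+2 x]/= -[X in _ = _ - X]mul1r -mulNr -avgZ -avgD.
have indE j : 0 < wt x j -> ind (S `\ y) (nxt x j) = ind (~` [set y]) (nxt x j) :> R.
  move=> wj; rewrite /ind; congr ((nat_of_bool _)%:R); apply: asbool_equiv_eq.
  by split=> [[]|h] //; split=> //; exact: S_closed wj.
by apply/eqP; rewrite eq_le; apply/andP; split; apply: avg_le_at => // j wj;
  rewrite indE // /g /=; lra.
Qed.

(** Kac's argument: along a stationary functional [L],
    [L (surv y k.+1) = L (surv y k) - L (1_y) * surv y k y], and the sum over
    [k] telescopes. *)
Lemma kernel_positive_recurrent (L : (T -> R) -> R) :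
    (forall f g : T -> R, (forall x, 0 <= f x <= 1) -> (forall x, 0 <= g x <= 1) ->
       (forall x, f x <= g x) -> L f <= L g) ->
    (forall (f g : T -> R) (c : R), (forall x, 0 <= f x <= 1) -> (forall x, 0 <= g x <= 1) ->
       L (fun x => f x + c * g x) = L f + c * L g) ->
    (forall f : T -> R, (forall x, 0 <= f x <= 1) -> L (P f) = L f) ->
    L (fun=> 1) = 1 -> (forall y, S y -> 0 < L (ind [set y])) ->
  positive_recurrent S kernel_mx.
Proof.
move=> Lle Llin Linv L1 Lpos y Sy.
have surv01 k x : 0 <= surv y k x <= 1.
  rewrite surv_ge0 /=; elim: k => [//|k IH]; exact: le_trans (surv_le y k x) IH.
have ind01 x : 0 <= (ind [set y] x : R) <= 1 by rewrite ind_ge0 ind_le1.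
have kac k : L (surv y k.+1) = L (surv y k) - L (ind [set y]) * surv y k y.
  rewrite (_ : surv y k.+1 = P (fun z => ind (~` [set y]) z * surv y k z)) //.
  rewrite Linv; last first.
    move=> z; have /andP[s0 s1] := surv01 k z.
    by rewrite mulr_ge0 ?ind_ge0 //= mulr_ile1 ?ind_ge0 ?ind_le1.
  rewrite mulrC -mulNr -Llin //; congr L; apply/funext => z; rewrite indC /ind.
  by case: asboolP => [->|_] /=; ring.
have sum_le m : L (ind [set y]) * \sum_(k < m) surv y k y <= 1.
  have -> : L (ind [set y]) * \sum_(k < m) surv y k y = L (surv y 0) - L (surv y m).
    elim: m => [|m IH]; first by rewrite big_ord0 mulr0 subrr.
    by rewrite big_ord_recr mulrDr IH kac /=; ring.
  rewrite /= L1 lerBlDl lerDr.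
  have h0 : forall x : T, 0 <= (0 : R) <= 1 by rewrite lexx ler01.
  have L0 : L (fun=> 0) = 0.
    have := Llin (fun=> 0) (fun=> 0) 1 h0 h0.
    rewrite (_ : (fun _ => _ + _) = (fun=> 0)); first by rewrite mul1r => /esym/eqP; rewrite -subr_eq0 addrK => /eqP.
    by apply/funext => z; rewrite mulr0 addr0.
  by rewrite -L0; apply: Lle => // z; have /andP[] := surv01 m z.
have Ly := Lpos y Sy.
pose C := (L (ind [set y]))^-1.
have sumC m : \sum_(k < m) surv y k y <= C.
  by rewrite /C -[leRHS]mulr1 mulrC ler_pdivlMr // mulrC.
have noninc m k : (k <= m)%N -> surv y m y <= surv y k y.
  by move=> /subnK <-; elim: (m - k)%N => [//|i IH]; exact: le_trans (surv_le _ _ _) IH.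
have mul_le m : m%:R * surv y m y <= C.
  apply: le_trans (sumC m); rewrite -[m in m%:R]card_ord -sum1_card natr_sum mulr_suml.
  by apply: ler_sum => i _; rewrite mul1r noninc // ltnW.
have by_parts m : \sum_(k < m) k.+1%:R * (surv y k y - surv y k.+1 y)
    = \sum_(k < m) surv y k y - m%:R * surv y m y.
  elim: m => [|m IH]; first by rewrite !big_ord0 mul0r subr0.
  by rewrite !big_ord_recr IH /= -natr1; ring.
have fpE k : first_passage S kernel_mx k y y = (surv y k y - surv y k.+1 y)%:E.
  exact: first_passageE.
split.
  apply: cvg_lim => //.
  rewrite (_ : (fun m => _) = (fun m => (1 - surv y m y)%:E)); last first.
    apply/funext => m; rewrite (eq_bigr _ (fun k _ => fpE k)) sumEFin; congr EFin.
    rewrite big_mkord; elim: m => [|m IH]; first by rewrite big_ord0 subrr.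
    by rewrite big_ord_recr IH /=; ring.
  apply: cvg_EFin; first by near=> m.
  rewrite -[X in _ --> X]subr0; apply: cvgB; first exact: cvg_cst.
  rewrite -(cvg_shiftS (fun m => surv y m y)).
  apply: (@squeeze_cvgr _ _ _ _ (fun=> 0) (fun m => C * m.+1%:R^-1)).
  - near=> m; rewrite surv_ge0 /= ler_pdivlMr // mulrC; exact: mul_le.
  - exact: cvg_cst.
  - rewrite -[X in _ --> X](mulr0 C); apply: cvgM; first exact: cvg_cst.
    exact: cvg_harmonic.
apply: (@le_lt_trans _ _ C%:E); last exact: ltry.
apply: lime_le.
  by apply: is_cvg_nneseries => k _ _; rewrite fpE -EFinM lee_fin mulr_ge0 // subr_ge0 surv_le.
near=> m; rewrite (eq_bigr (fun k => (k.+1%:R * (surv y k y - surv y k.+1 y))%:E)); last first.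
  by move=> k _; rewrite fpE.
rewrite sumEFin lee_fin big_mkord; apply: le_trans (sumC m).
rewrite by_parts.
by rewrite lerBlDr lerDl mulr_ge0 // surv_ge0.
Unshelve. all: by end_near. Qed.

End Chain_of_a_kernel.

(** * Expectations of discrete random elements *)

Section Discrete_expectation.
Context {R : realType} {d : measure_display} {Om : measurableType d}.
Variable P : probability Om R.

Lemma measurable_fun_discrete (T : Type) (X : Om -> T) d' (U : measurableType d')
    (h : T -> U) (D : set Om) :
  discrete_rv X -> measurable_fun D (fun w => h (X w)).
Proof.
move=> mX mD B _; apply: measurableI => //.
exact: (mX (h @^-1` B)).
Qed.

Lemma discrete_rv_comp (T T' : Type) (X : Om -> T) (h : T -> T') :
  discrete_rv X -> discrete_rv (fun w => h (X w)).
Proof. by move=> mX B; exact: (mX (h @^-1` B)). Qed.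

(** A discrete integral depends on the joint law only, state by state. *)
Lemma eq_integral_discrete (T : countType) (X : Om -> T) (B B' : set Om)
    (f g : T -> R) :
    discrete_rv X -> measurable B -> measurable B' ->
    (forall x, 0 <= f x) -> (forall x, 0 <= g x) ->
    (forall x, (f x)%:E * P (B `&` X @^-1` [set x]) =
               (g x)%:E * P (B' `&` X @^-1` [set x]))%E ->
  (\int[P]_(w in B) (f (X w))%:E = \int[P]_(w in B') (g (X w))%:E)%E.
Proof.
move=> mX mB mB' f0 g0 fg.
pose F k : set Om := X @^-1` [set x | pickle x = k].
have mF k : measurable (F k) by exact: mX.
have tF : trivIset setT F.
  by apply/trivIsetP => i j _ _ ij; apply/seteqP; split => // w [/= wi wj]; move: ij; rewrite -wi -wj eqxx.
have split_int (C : set Om) (h : T -> R) : measurable C -> (forall x, 0 <= h x) ->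
    (\int[P]_(w in C) (h (X w))%:E
     = \sum_(k <oo) \int[P]_(w in C `&` F k) (h (X w))%:E)%E.
  move=> mC h0; rewrite {1}(_ : C = \bigcup_k (C `&` F k)); last first.
    apply/seteqP; split => [w Cw|w [k _ []//]].
    by exists (pickle (X w)).
  rewrite ge0_integral_bigcup //.
  - by move=> k; exact: measurableI.
  - exact: (measurable_fun_discrete (fun x => (h x)%:E) mX).
  - by move=> w _; rewrite lee_fin.
  - by apply: trivIset_setIl.
have part (C : set Om) (h : T -> R) k : measurable C ->
    (\int[P]_(w in C `&` F k) (h (X w))%:E =
     if unpickle k is Some x then
       if pickle x == k then (h x)%:E * P (C `&` X @^-1` [set x]) else 0 else 0)%E.
  move=> mC; case E : (unpickle k) => [x|].
    case: eqP => xk; last first.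
      have -> : C `&` F k = set0; last by rewrite integral_set0.
      apply/seteqP; split => // w [_ /= e].
      by move: E; rewrite -e pickleK => -[ex]; apply: xk; rewrite -ex.
    have -> : C `&` F k = C `&` X @^-1` [set x].
      apply/seteqP; split => w [Cw /= e]; split => //=; last by rewrite /F /= e.
      by move: E; rewrite -e pickleK => -[].
    rewrite -integral_cst; last by apply: measurableI => //; exact: mX.
    by apply: eq_integral => w /set_mem [_ /= ->].
  have -> : C `&` F k = set0; last by rewrite integral_set0.
  by apply/seteqP; split => // w [_ /= e]; move: E; rewrite -e pickleK.
rewrite !split_int //; apply: eq_eseriesr => k _; rewrite !part //.
by case: unpickle => [x|//]; case: ifP.
Qed.

Lemma integral_finite_partition (J : finType) (Z : Om -> J) (f : Om -> \bar R) :
    discrete_rv Z -> (forall w, 0 <= f w)%E -> measurable_fun setT f ->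
  (\int[P]_w f w = \sum_j \int[P]_(w in Z @^-1` [set j]) f w)%E.
Proof.
move=> mZ f0 mf; have e : \big[setU/set0]_(j <- index_enum J) (Z @^-1` [set j]) = setT.
  apply/seteqP; split => // w _; rewrite -bigcup_seq; exists (Z w) => //=.
  by rewrite mem_index_enum.
rewrite -{1}e ge0_integral_bigsetU //.
- exact: index_enum_uniq.
- by apply/trivIsetP => i j _ _ ij; apply/seteqP; split => // w [/= wi wj]; move: ij; rewrite -wi -wj eqxx.
- by rewrite e.
Qed.

Lemma measure_finite_partition (J : finType) (Z : Om -> J) (B : set Om) :
    discrete_rv Z -> measurable B ->
  (P B = \sum_j P (B `&` Z @^-1` [set j]))%E.
Proof.
move=> mZ mB; rewrite -[in LHS](setIT B) -integral_indic //.
rewrite (integral_finite_partition mZ); last first.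
- by apply/measurable_EFinP; exact: measurable_indic.
- by move=> w; rewrite lee_fin.
apply: eq_bigr => j _; rewrite integral_indic //; exact: mZ.
Qed.

Lemma expectation_finite (J : finType) (Z : Om -> J) (g : J -> R) :
    discrete_rv Z -> (forall j, 0 <= g j) ->
  ('E_P[fun w => g (Z w)] = \sum_j (g j)%:E * P (Z @^-1` [set j]))%E.
Proof.
move=> mZ g0; rewrite unlock (integral_finite_partition mZ); last first.
- exact: (measurable_fun_discrete (fun x => (g x)%:E) mZ).
- by move=> w; rewrite lee_fin.
apply: eq_bigr => j _; rewrite -integral_cst; last exact: mZ.
by apply: eq_integral => w /set_mem /= ->.
Qed.

Lemma integrable_discrete (T : Type) (X : Om -> T) (f : T -> R) (M : R) :
    discrete_rv X -> (forall x, `|f x| <= M) ->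
  P.-integrable setT (fun w => (f (X w))%:E).
Proof.
move=> mX fM; apply: measurable_bounded_integrable => //.
- by rewrite /= probability_setT ltry.
- exact: (measurable_fun_discrete f mX).
- exists M; split; rewrite ?num_real // => y My w _ /=.
  exact: le_trans (fM _) (ltW My).
Qed.

Lemma expectation_shift (T : Type) (X : Om -> T) (f : T -> R) (M c : R) :
    discrete_rv X -> (forall x, `|f x| <= M) ->
  ('E_P[fun w => (f (X w) + c)%R] = 'E_P[fun w => f (X w)] + c%:E)%E.
Proof.
move=> mX fM; rewrite unlock.
rewrite -[c%:E in RHS](_ : \int[P]_w (c%:E) = _)%E; last first.
  by rewrite integral_cst //= probability_setT mule1.
rewrite -integralD_EFin //; first exact: integrable_discrete fM.
exact: (integrable_discrete (f := fun=> c) (M := `|c|) mX).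
Qed.

(** Dominated convergence with the constant [M] as the dominating function. *)
Lemma expectation_bounded_cvg (T : Type) (X : Om -> T) (f : nat -> T -> R) (l M : R) :
    discrete_rv X -> (forall t x, `|f t x| <= M) ->
    (forall x, f t x @[t --> \oo] --> l) ->
  ('E_P[fun w => f t (X w)] @[t --> \oo] --> l%:E)%E.
Proof.
move=> mX fM fl; rewrite unlock.
have -> : (l%:E = \int[P]_w (l%:E))%E by rewrite integral_cst //= probability_setT mule1.
apply: (@dominated_cvg _ _ _ P _ measurableT (fun t w => (f t (X w))%:E) (fun=> l%:E)
  (fun=> M%:E)).
- by move=> t; exact: (measurable_fun_discrete (fun x => (f t x)%:E) mX).
- by move=> w _; apply: cvg_EFin; [near=> t|exact: fl].
- by [].
- exact: (integrable_discrete (f := fun=> M) (M := `|M|) mX).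
- by move=> t w _; rewrite lee_fin.
Unshelve. all: by end_near. Qed.

(** Monotone convergence along the truncations gives the mean of an unbounded
    function from the means of bounded ones. *)
Lemma expectation_truncation (T : Type) (X : Om -> T) (f : T -> R)
    (l : nat -> R) (L : R) :
    discrete_rv X -> (forall x, 0 <= f x) ->
    (forall m : nat, 'E_P[fun w => Num.min (f (X w)) m%:R] = (l m)%:E)%E ->
    l m @[m --> \oo] --> L ->
  'E_P[fun w => f (X w)]%E = L%:E.
Proof.
move=> mX f0 fl lL.
have c1 : ('E_P[fun w => Num.min (f (X w)) m%:R] @[m --> \oo]
           --> 'E_P[fun w => f (X w)])%E.
  rewrite unlock.
  have -> : (\int[P]_w (f (X w))%:E = \int[P]_w
      limn (fun m : nat => (Num.min (f (X w)) m%:R)%:E))%E.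
    apply: eq_integral => w _; apply/esym/cvg_lim => //.
    apply: cvg_EFin; first by near=> m.
    apply: cvg_near_cst; near=> m => /=; apply/min_idPl.
    near: m; exact: nbhs_infty_ger.
  apply: cvg_monotone_convergence => //.
  - by move=> m; exact: (measurable_fun_discrete (fun x => (Num.min (f x) m%:R)%:E) mX).
  - by move=> m w _; rewrite lee_fin le_min f0 ler0n.
  - move=> w _ m m' mm'; rewrite lee_fin le_min ge_min lexx /= ge_min ler_nat mm'.
    by rewrite orbT.
apply: (cvg_unique _ c1) => //.
rewrite (_ : (fun m => _) = (fun m => (l m)%:E)); last exact/funext.
by apply: cvg_EFin; [near=> m|exact: lL].
Unshelve. all: by end_near. Qed.

End Discrete_expectation.

(** * Limit laws of integer matrices *)

Section Limit_law.
Context {R : realType} {n : nat}.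
Local Notation T := 'M[nat]_n.
Variable L : (T -> R) -> R.
Definition bounded_fn (f : T -> R) := exists M : R, forall x, `|f x| <= M.
Hypothesis L_ge0 : forall f, bounded_fn f -> (forall x, 0 <= f x) -> 0 <= L f.
Hypothesis L_lin : forall f g c, bounded_fn f -> bounded_fn g ->
  L (fun x => f x + c * g x) = L f + c * L g.
Hypothesis L_cst : forall c, L (fun=> c) = c.
Hypothesis L_tight : forall e : R, 0 < e ->
  exists m, L (ind [set x | (m <= pickle x)%N]) <= e.

Let bounded_ind (A : set T) : bounded_fn (ind A).
Proof. by exists 1 => x; rewrite ger0_norm ?ind_ge0 ?ind_le1. Qed.

Let bounded_mul f g : bounded_fn f -> bounded_fn g -> bounded_fn (fun x => f x * g x).
Proof.
move=> [M fM] [N gN]; exists (M * N) => x; rewrite normrM ler_pM //.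
Qed.

Let mass_ge0 (k : nat) : 0 <= L (ind [set x | pickle x = k]).
Proof. by apply: L_ge0 => // x; exact: ind_ge0. Qed.

(** The masses of the states, carried by their codes; the codes that code no
    state have mass [0]. *)
Definition limit_law : set nat -> \bar R :=
  mseries (fun k => mscale (NngNum (mass_ge0 k)) \d_k) 0.

HB.instance Definition _ := Measure.on limit_law.

Let decode (k : nat) : T := odflt (\matrix_(i, j) 0%N) (pickle_inv k).

Let partial_sum f m : bounded_fn f ->
  \sum_(k < m) L (ind [set x | pickle x = k :> nat]) * f (decode k)
  = L (fun x => f x * ind [set x | (pickle x < m)%N] x).
Proof.
move=> bf; elim: m => [|m IH].
  rewrite big_ord0 -(L_cst 0); congr L; apply/funext => x.
  by rewrite /ind asboolF ?mulr0.
rewrite big_ord_recr /= IH (mulrC (L _)) -L_lin //; last exact: bounded_mul.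
congr L; apply/funext => x; rewrite /ind /=.
rewrite !asboolb ltnS (leq_eqVlt (pickle x)).
have -> : `[< pickle x = m >] = (pickle x == m) by apply/asboolP/eqP.
case: eqP => [<-|_] /=; last by rewrite mulr0 addr0.
by rewrite ltnn mulr0 add0r /decode pickleK_inv.
Qed.

Let sum_cvg f : bounded_fn f -> (forall x, 0 <= f x) ->
  (\sum_(k <oo) ((L (ind [set x | pickle x = k]))%:E * (f (decode k))%:E) = (L f)%:E)%E.
Proof.
move=> bf f0; apply: cvg_lim => //.
rewrite (_ : (fun m => _) = (fun m => (L (fun x => f x * ind [set x | (pickle x < m)%N] x))%:E)); last first.
  apply/funext => m; rewrite -partial_sum // big_mkord -sumEFin.
  by apply: eq_bigr => k _.
apply: cvg_EFin; first by near=> m.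
have [M fM] := bf; have M0 : 0 <= M by exact: le_trans (normr_ge0 _) (fM (\matrix_(i, j) 0%N)).
apply/cvgrPdist_le => e e0.
have [m0 hm0] := L_tight (divr_gt0 e0 (ltr_wpDl M0 ltr01)).
exists m0 => // m /= m0m; pose A : set T := [set x | (pickle x < m)%N].
have bA : bounded_fn (fun x => f x * ind A x) by exact: bounded_mul.
have -> : L f - L (fun x => f x * ind A x) = L (fun x => f x * ind (~` A) x).
  rewrite -mulN1r -L_lin //; congr L; apply/funext => x; rewrite indC; ring.
have bA' : bounded_fn (fun x => f x * ind (~` A) x) by exact: bounded_mul.
rewrite ger0_norm; last by apply: L_ge0 => // x; rewrite mulr_ge0 ?ind_ge0.
pose g : T -> R := ind [set x | (m0 <= pickle x)%N].
have : 0 <= L (fun x => 0 + (M + 1) * g x) - L (fun x => f x * ind (~` A) x).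
  rewrite -mulN1r -L_lin //.
    apply: L_ge0.
      have [N hN] := bA'; exists (M + 1 + N) => x.
      rewrite add0r mulN1r (le_trans (ler_normB _ _)) // lerD //.
      by rewrite normrM ger0_norm ?addr_ge0 // ler_piMr ?addr_ge0 // ger0_norm ?ind_ge0 ?ind_le1.
    move=> x; rewrite add0r mulN1r subr_ge0 ler_pM ?ind_ge0 //.
      by apply: (le_trans (ler_norm _)); rewrite (le_trans (fM x)) // lerDl.
    rewrite /ind ler_nat; case: asboolP => //= /negP; rewrite -leqNgt => h.
    by rewrite asboolT //=; exact: leq_trans h.
  exists (M + 1) => x; rewrite add0r normrM ger0_norm ?addr_ge0 //.
  by rewrite ler_piMr ?addr_ge0 // ger0_norm ?ind_ge0 ?ind_le1.
rewrite subr_ge0 (L_lin (f := fun=> 0)); [|by exists 0 => x; rewrite normr0|exact: bounded_ind].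
move=> /le_trans; apply; rewrite L_cst add0r mulrC -ler_pdivlMr //.
exact: ltr_wpDl.
Unshelve. all: by end_near. Qed.

Let integral_limit_law (f : T -> R) : bounded_fn f -> (forall x, 0 <= f x) ->
  (\int[limit_law]_k (f (decode k))%:E = (L f)%:E)%E.
Proof.
move=> bf f0; have f0' k : setT k -> (0%:E <= (f (decode k))%:E)%E by rewrite lee_fin.
rewrite -sum_cvg // ge0_integral_measure_series //.
apply: eq_eseriesr => k _; rewrite ge0_integral_mscale //.
by rewrite integral_dirac // diracT mul1e.
Qed.

Let limit_law_setT : limit_law setT = 1%E.
Proof.
rewrite -[RHS](_ : (L (fun=> 1))%:E = 1%E); last by rewrite L_cst.
rewrite -integral_limit_law //; last by exists 1 => x; rewrite normr1.
by rewrite integral_cst // mul1e.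
Qed.

HB.instance Definition _ := Measure_isProbability.Build _ _ _ limit_law limit_law_setT.

Let decode_rv : discrete_rv decode.
Proof. by []. Qed.

(** A positive normalized functional is only finitely additive in general; by
    [L_tight] no mass escapes to infinity, and the masses of the single states
    determine it. *)
Lemma limit_law_exists : exists Y : random_queue R n,
  forall f, bounded_fn f -> ('E_(rq_P Y)[fun w => f (rq_q w)] = (L f)%:E)%E.
Proof.
exists (@RandomQueue R n _ _ limit_law decode decode_rv) => f bf /=.
have [M fM] := bf.
have h : ('E_limit_law[fun w => (f (decode w) + M)%R] = (L f + M)%:E)%E.
  rewrite unlock (integral_limit_law (f := fun x => f x + M)).
  - have bM : bounded_fn (fun=> M) by exists `|M|.
    by have := L_lin 1 bf bM; rewrite !mul1r L_cst => <-.
  - by exists (M + M) => x; rewrite (le_trans (ler_normD _ _)) // lerD // ger0_norm //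
      (le_trans _ (fM x)).
  - by move=> x; rewrite -lerBlDr sub0r; have := fM x; rewrite ler_norml => /andP[].
move: h; rewrite (expectation_shift _ _ decode_rv fM) EFinD.
by move=> /(congr1 (fun z => z - M%:E)%E); rewrite !addeK.
Qed.

End Limit_law.

(** * Mean weight of the schedules *)

Section Mean_weight.
Context {R : realType} {n : nat}.
Implicit Types (q : 'M[nat]_n) (s : 'S_n).

Definition total q : R := \sum_i \sum_j (q i j)%:R.

(** The failure of [q] to be of the form [w i + w' j], tested on the 2 x 2
    submatrix with rows [i], [k] and columns [j], [l]. *)
Definition second_diff q (i k j l : 'I_n) : R :=
  (q i j)%:R + (q k l)%:R - (q i l)%:R - (q k j)%:R.

Definition mean_weight (m : 'S_n -> R) q : R := \sum_s m s * (weight q s)%:R.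

Lemma weightE q s : weight q s = (\sum_i q i (s i))%N.
Proof.
apply: eq_bigr => i _; rewrite (bigD1 (s i)) //= big1 ?addn0.
  by rewrite !mxE eqxx muln1.
by move=> j js; rewrite !mxE eq_sym (negbTE js) muln0.
Qed.

Lemma weightR q s : (weight q s)%:R = \sum_i (q i (s i))%:R :> R.
Proof. by rewrite weightE natr_sum. Qed.

Lemma total_ge0 q : 0 <= total q.
Proof. by apply: sumr_ge0 => i _; apply: sumr_ge0. Qed.

Lemma weight_le_total q s : (weight q s)%:R <= total q.
Proof.
rewrite weightR; apply: ler_sum => i _; rewrite (bigD1 (s i)) //= lerDl.
exact: sumr_ge0.
Qed.

Lemma unif_ge0 (T : finType) (A : {set T}) x : 0 <= unif A x :> R.
Proof. by rewrite /unif divr_ge0. Qed.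

Lemma unifT (T : finType) x : unif [set: T] x = #|T|%:R^-1 :> R.
Proof. by rewrite /unif inE mul1r cardsT. Qed.

Lemma unif_perm_sum1 : \sum_s unif [set: 'S_n] s = 1 :> R.
Proof.
rewrite (eq_bigr (fun=> #|{perm 'I_n}|%:R^-1)); last by move=> s _; exact: unifT.
have -> : \sum_(s : 'S_n) #|{perm 'I_n}|%:R^-1 = #|{perm 'I_n}|%:R^-1 *+ #|{perm 'I_n}| :> R.
  by rewrite sumr_const.
rewrite -(mulr_natr _ #|_|) mulVf // pnatr_eq0 -lt0n.
by apply/card_gt0P; exists 1%g.
Qed.

(** By symmetry each entry of a uniform permutation matrix is [1] with
    probability [1 / n]. *)
Lemma mean_weight_unif q : mean_weight (unif [set: 'S_n]) q = total q / n%:R.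
Proof.
case: (posnP n) => [n0|n0].
  rewrite /mean_weight /total [X in X / _]big1; last by move=> [i hi]; exfalso; rewrite n0 in hi.
  by rewrite mul0r big1 // => s _; rewrite weightR big1 ?mulr0 // => -[i hi]; exfalso; rewrite n0 in hi.
pose N i j : R := \sum_(s : 'S_n) (s i == j)%:R.
have Nconst i j k : N i j = N i k.
  rewrite /N (reindex_inj (mulIg (tperm j k))) /=; apply: eq_bigr => s _.
  by rewrite permM (canF_eq (tpermK j k)) tpermL.
have Nsum i j : n%:R * N i j = #|{perm 'I_n}|%:R.
  transitivity (\sum_k N i k).
    by rewrite (eq_bigr (fun=> N i j)) ?sumr_const ?card_ord ?mulr_natl // => k _; exact: Nconst.
  rewrite exchange_big /= (eq_bigr (fun=> 1)); first by rewrite sumr_const.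
  move=> s _; rewrite (bigD1 (s i)) //= eqxx big1 ?addr0 // => k ks.
  by rewrite eq_sym (negbTE ks).
have card0 : #|{perm 'I_n}|%:R != 0 :> R.
  by rewrite pnatr_eq0 -lt0n; apply/card_gt0P; exists 1%g.
have nn0 : n%:R != 0 :> R by rewrite pnatr_eq0 -lt0n.
rewrite /mean_weight (eq_bigr (fun s => #|{perm 'I_n}|%:R^-1 *
   (\sum_i \sum_j (q i j)%:R * (s i == j)%:R))); last first.
  move=> s _; rewrite unifT weightR; congr (_ * _); apply: eq_bigr => i _.
  rewrite (bigD1 (s i)) //= eqxx mulr1 big1 ?addr0 // => k ks.
  by rewrite eq_sym (negbTE ks) mulr0.
rewrite -big_distrr /= exchange_big /=.
rewrite (eq_bigr (fun i => \sum_j (q i j)%:R * (#|{perm 'I_n}|%:R / n%:R))); last first.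
  move=> i _; rewrite exchange_big /=; apply: eq_bigr => j _.
  by rewrite -big_distrr /= -/(N i j) -(Nsum i j) mulrAC mulfV // mul1r.
under eq_bigr do rewrite -big_distrl /=.
by rewrite -big_distrl /= -/(total q) mulrCA mulKf.
Qed.

(** For any 2 x 2 submatrix there are two schedules whose weights differ by the
    second difference: a permutation through [(i, j)] and [(k, l)], and its
    composition with the transposition of [i] and [k]. *)
Lemma second_diff_flip q (i k j l : 'I_n) : i != k -> j != l ->
  exists s, (s i = j) /\ (s k = l) /\
  (weight q s)%:R - (weight q (tperm i k * s)%g)%:R = second_diff q i k j l.
Proof.
move=> ik jl; pose s0 := tperm i j; pose s := (s0 * tperm (s0 k) l)%g.
have si : s i = j.
  rewrite /s permM /s0 tpermL tpermD //; last by rewrite eq_sym.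
  by apply: contraNneq ik; rewrite -{2}(tpermL i j) => /perm_inj ->.
have sk : s k = l by rewrite /s permM tpermL.
exists s; split=> //; split=> //.
clearbody s; rewrite !weightR (bigD1 i) //= (bigD1 k) /=; last by rewrite eq_sym.
rewrite [X in _ - X](bigD1 i) //= [X in _ - (_ + X)](bigD1 k) /=; last by rewrite eq_sym.
rewrite !permM tpermL tpermR si sk /second_diff.
rewrite [X in _ - (_ + (_ + X))](eq_bigr (fun x => (q x (s x))%:R)); first by ring.
by move=> x /andP[xi xk]; rewrite permM tpermD // eq_sym.
Qed.

Lemma second_diff_diag q (i k j l : 'I_n) : ~~ ((i != k) && (j != l)) ->
  second_diff q i k j l = 0.
Proof.
by rewrite negb_and !negbK => /orP[] /eqP ->; rewrite /second_diff; ring.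
Qed.

Variable rule : 'M[nat]_n -> seq 'S_n -> 'S_n -> R.
Hypothesis hrule : selection_rule rule.

Lemma rule_ge0 q c s : c != [::] -> 0 <= rule q c s.
Proof. by move=> c0; have [h _ _] := hrule q c0; exact: h. Qed.

Lemma rule_sum1 q c : c != [::] -> \sum_s rule q c s = 1.
Proof. by move=> c0; have [_ h _] := hrule q c0. Qed.

Lemma rule_weight_ge q (c : seq 'S_n) s' : s' \in c ->
  (weight q s')%:R <= mean_weight (rule q c) q.
Proof.
move=> sc; have c0 : c != [::] by case: (c) sc.
have [r0 r1 rw] := hrule q c0.
rewrite -[leLHS]mul1r -{1}r1 big_distrl /=; apply: ler_sum => s _.
have := r0 s; rewrite le_eqVlt => /orP[/eqP <-|rs]; first by rewrite !mul0r.
by rewrite ler_pM2l // ler_nat; have [_] := rw s rs; exact.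
Qed.

Definition prob (m : 'S_n -> R) := (forall s, 0 <= m s) /\ \sum_s m s = 1.

(** What makes a schedule law MaxWeight-like: a uniform schedule is
    beaten by an amount proportional to every second difference. *)
Definition maxweight_like (mu : schedule_law R n) :=
  (forall q, prob (mu q)) /\
  exists2 c : R, 0 < c & forall q i k j l,
    total q / n%:R + c * `|second_diff q i k j l| <= mean_weight (mu q) q.

Section Power_of_d.
Variable d : nat.
Hypothesis d_ge2 : (2 <= d)%N.

Let wts (ss : {ffun 'I_d -> 'S_n}) : R := \prod_(k < d) unif [set: 'S_n] (ss k).

Let wtsE ss : wts ss = #|{perm 'I_n}|%:R^-1 ^+ d.
Proof.
by rewrite /wts (eq_bigr (fun=> #|{perm 'I_n}|%:R^-1)) ?prodr_const ?card_ord // => k _; exact: unifT.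
Qed.

Let i0 : 'I_d := Ordinal (leq_trans (isT : (0 < 2)%N) d_ge2).
Let i1 : 'I_d := Ordinal d_ge2.

Let marginal (f : 'S_n -> R) :
  \sum_ss wts ss * f (ss i0) = \sum_s unif [set: 'S_n] s * f s.
Proof.
pose F (k : 'I_d) s := unif [set: 'S_n] s * (if k == i0 then f s else 1) : R.
transitivity (\sum_(ss : {ffun 'I_d -> 'S_n}) \prod_(k < d) F k (ss k)).
  apply: eq_bigr => ss _; rewrite /F big_split /=; congr (_ * _).
  by rewrite (bigD1 i0) //= ?eqxx big1 ?mulr1 // => k /negbTE ->.
rewrite -(bigA_distr_bigA F) (bigD1 i0) //= [X in _ * X]big1 ?mulr1.
  by apply: eq_bigr => s _; rewrite /F ?eqxx.
by move=> k /negbTE k0; rewrite -[RHS]unif_perm_sum1; apply: eq_bigr => s _; rewrite /F k0 mulr1.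
Qed.

Let codom_neq0 (ss : {ffun 'I_d -> 'S_n}) : codom ss != [::].
Proof. by apply/eqP => e; have := codom_f ss i0; rewrite e. Qed.

(** Keeping always the first candidate is uniform scheduling, and the selected
    candidate is never lighter. The gain of the selection over the first
    candidate is at least the second difference when the first candidate is
    the lighter schedule of [second_diff_flip] and the others are the heavier
    one, which has probability [(n!)^-d]. *)
Lemma power_of_d_maxweight_like : maxweight_like (power_of_d rule d).
Proof.
have N0 : 0 < #|{perm 'I_n}|%:R :> R by rewrite ltr0n; apply/card_gt0P; exists 1%g.
have w0 ss : 0 <= wts ss by rewrite wtsE exprn_ge0 // invr_ge0 ltW.
split.
  move=> q; split=> [s|].
    by apply: sumr_ge0 => ss _; rewrite mulr_ge0 ?w0 ?rule_ge0.
  rewrite exchange_big /=.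
  rewrite (eq_bigr (fun ss => wts ss * 1)); last first.
    by move=> ss _; rewrite -big_distrr /= rule_sum1.
  by rewrite (marginal (fun=> 1)); under eq_bigr do rewrite mulr1; exact: unif_perm_sum1.
exists (#|{perm 'I_n}|%:R^-1 ^+ d); first by rewrite exprn_gt0 // invr_gt0.
move=> q i k j l; set c := _ ^+ d.
have mwE : mean_weight (power_of_d rule d q) q
    = \sum_ss wts ss * mean_weight (rule q (codom ss)) q.
  rewrite /mean_weight /power_of_d.
  under eq_bigr do rewrite big_distrl /=.
  rewrite exchange_big /=; apply: eq_bigr => ss _.
  by rewrite big_distrr /=; apply: eq_bigr => s _; rewrite mulrA.
rewrite mwE -mean_weight_unif [X in X + _]/mean_weight -marginal.
have ge ss : (weight q (ss i0))%:R <= mean_weight (rule q (codom ss)) q.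
  by apply: rule_weight_ge; exact: codom_f.
have [ijkl|] := boolP ((i != k) && (j != l)); last first.
  by move=> /second_diff_diag ->; rewrite normr0 mulr0 addr0; apply: ler_sum => ss _; apply: ler_wpM2l; [exact: w0|exact: ge].
have [/andP[ik jl]] := conj ijkl I; move=> _.
have [s [_ [_ sE]]] := second_diff_flip q ik jl.
pose s' := (tperm i k * s)%g.
pose lo := if (weight q s <= weight q s')%N then s else s'.
pose hi := if (weight q s <= weight q s')%N then s' else s.
have hilo : `|second_diff q i k j l| = (weight q hi)%:R - (weight q lo)%:R.
  rewrite -sE -/s' /hi /lo; case: leqP => h.
    by rewrite ler0_norm ?opprB // subr_le0 ler_nat.
  by rewrite ger0_norm // subr_ge0 ler_nat ltnW.
pose ss0 : {ffun 'I_d -> 'S_n} := [ffun m => if m == i0 then lo else hi].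
rewrite (bigD1 ss0) //= [leRHS](bigD1 ss0) //= addrAC lerD //; last first.
  by apply: ler_sum => ss _; apply: ler_wpM2l; [exact: w0|exact: ge].
rewrite wtsE -/c -mulrDr ler_wpM2l //; first by rewrite /c exprn_ge0 // invr_ge0 ltW.
rewrite ffunE eqxx hilo addrCA subrr addr0; apply: rule_weight_ge.
by have := codom_f ss0 i1; rewrite ffunE.
Qed.

End Power_of_d.

Section Random_flip.
Variable d : nat.
Hypothesis n_ge2 : (2 <= n)%N.

Lemma flip_pairs_mem s (i k : 'I_n) : i != k ->
  ((i, s i), (k, s k)) \in flip_pairs s.
Proof.
move=> ik; rewrite inE /= !mxE !eqxx /= andbT.
by apply: contraNneq ik => -[->].
Qed.

Let flip_pairs_gt0 (s : 'S_n) : (0 < #|flip_pairs s|)%N.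
Proof.
apply/card_gt0P; exists ((Ordinal (ltnW n_ge2), s (Ordinal (ltnW n_ge2))), (Ordinal n_ge2, s (Ordinal n_ge2))).
exact: flip_pairs_mem.
Qed.

Let unif_flip_sum (s : 'S_n) : \sum_u unif (flip_pairs s) u = 1 :> R.
Proof.
rewrite /unif -big_distrl /= -natr_sum -big_mkcond sum1_card mulfV //.
by rewrite pnatr_eq0 -lt0n flip_pairs_gt0.
Qed.

Lemma flip_step_prob q s1 : prob (flip_step rule q s1).
Proof.
split=> [s|]; first by apply: sumr_ge0 => u _; rewrite mulr_ge0 ?unif_ge0 ?rule_ge0.
rewrite exchange_big /= -[RHS](unif_flip_sum s1); apply: eq_bigr => u _.
by rewrite -big_distrr /= rule_sum1 // mulr1.
Qed.

Lemma mean_weight_flip_stepE q s1 : mean_weight (flip_step rule q s1) q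
  = \sum_u unif (flip_pairs s1) u * mean_weight (rule q [:: s1; flip s1 u]) q.
Proof.
rewrite /mean_weight /flip_step; under eq_bigr do rewrite big_distrl /=.
rewrite exchange_big /=; apply: eq_bigr => u _.
by rewrite big_distrr /=; apply: eq_bigr => s _; rewrite mulrA.
Qed.

Lemma mean_weight_flip_step_ge q s1 :
  (weight q s1)%:R <= mean_weight (flip_step rule q s1) q.
Proof.
rewrite mean_weight_flip_stepE -[leLHS]mul1r -{1}(unif_flip_sum s1) big_distrl /=.
by apply: ler_sum => u _; rewrite ler_wpM2l ?unif_ge0 // rule_weight_ge // inE eqxx.
Qed.

Let flips (m : 'S_n -> R) q s := \sum_s1 m s1 * flip_step rule q s1 s.

Let mean_weight_flips m q :
  mean_weight (flips m q) q = \sum_s1 m s1 * mean_weight (flip_step rule q s1) q.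
Proof.
rewrite /mean_weight /flips; under eq_bigr do rewrite big_distrl /=.
rewrite exchange_big /=; apply: eq_bigr => s1 _.
by rewrite big_distrr /=; apply: eq_bigr => s _; rewrite mulrA.
Qed.

Let flips_prob m q : prob m -> prob (flips m q).
Proof.
move=> [m0 m1]; split=> [s|].
  by apply: sumr_ge0 => s1 _; rewrite mulr_ge0 //; have [h _] := flip_step_prob q s1.
rewrite exchange_big /= -[RHS]m1; apply: eq_bigr => s1 _.
by rewrite -big_distrr /=; have [_ ->] := flip_step_prob q s1; rewrite mulr1.
Qed.

Let flips_ge m q : prob m -> mean_weight m q <= mean_weight (flips m q) q.
Proof.
move=> [m0 _]; rewrite mean_weight_flips; apply: ler_sum => s1 _.
by rewrite ler_wpM2l // mean_weight_flip_step_ge.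
Qed.

Let unif_prob : prob (unif [set: 'S_n]).
Proof.
by split=> [s|]; [exact: unif_ge0|exact: unif_perm_sum1].
Qed.

Let random_flipS e q : random_flip rule e.+1 q = flips (random_flip rule e q) q.
Proof. by []. Qed.

Let random_flip_prob e q : prob (random_flip rule e q).
Proof. by elim: e => [|e IH]; [exact: unif_prob|exact: flips_prob]. Qed.

(** A flip step never lowers the weight, so it is enough to see the gain of the
    first one: starting from the lighter schedule of [second_diff_flip], it
    reaches the heavier one when the flipped pair is the given one. *)
Lemma random_flip_maxweight_like : (1 <= d)%N -> maxweight_like (random_flip rule d).
Proof.
move=> d1; split; first exact: random_flip_prob.
set U := #|{: ('I_n * 'I_n) * ('I_n * 'I_n)}|%:R : R.
have U0 : 0 < U by rewrite ltr0n (leq_trans (flip_pairs_gt0 1%g)) // max_card.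
have N0 : 0 < #|{perm 'I_n}|%:R :> R by rewrite ltr0n; apply/card_gt0P; exists 1%g.
exists (#|{perm 'I_n}|%:R^-1 * U^-1); first by rewrite mulr_gt0 ?invr_gt0.
move=> q i k j l; case: d d1 => // e _.
elim: e => [|e IH]; last first.
  apply: (le_trans IH); rewrite (random_flipS e.+1); apply: flips_ge.
  exact: random_flip_prob.
rewrite random_flipS mean_weight_flips -mean_weight_unif [X in X + _]/mean_weight /=.
have [ijkl|] := boolP ((i != k) && (j != l)); last first.
  move=> /second_diff_diag ->; rewrite normr0 mulr0 addr0.
  by apply: ler_sum => s _; rewrite ler_wpM2l ?unif_ge0 ?mean_weight_flip_step_ge.
have [/andP[ik jl]] := conj ijkl I; move=> _.
have [s [si [sk sE]]] := second_diff_flip q ik jl.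
pose s' := (tperm i k * s)%g.
pose lo := if (weight q s <= weight q s')%N then s else s'.
pose hi := if (weight q s <= weight q s')%N then s' else s.
have hilo : `|second_diff q i k j l| = (weight q hi)%:R - (weight q lo)%:R.
  rewrite -sE -/s' /hi /lo; case: leqP => h.
    by rewrite ler0_norm ?opprB // subr_le0 ler_nat.
  by rewrite ger0_norm // subr_ge0 ler_nat ltnW.
have hiE : hi = (tperm i k * lo)%g.
  by rewrite /hi /lo /s'; case: ifP => // _; rewrite mulgA tperm2 mul1g.
rewrite (bigD1 lo) //= [leRHS](bigD1 lo) //= addrAC lerD //; last first.
  by apply: ler_sum => t _; rewrite ler_wpM2l ?unif_ge0 ?mean_weight_flip_step_ge.
rewrite unifT -mulrA -mulrDr ler_pM2l ?invr_gt0 //.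
pose u := ((i, lo i), (k, lo k)).
rewrite mean_weight_flip_stepE hilo -[X in X + _]mul1r -{1}(unif_flip_sum lo) big_distrl /=.
rewrite (bigD1 u) //= [leRHS](bigD1 u) //= addrAC lerD //; last first.
  by apply: ler_sum => v _; rewrite ler_wpM2l ?unif_ge0 // rule_weight_ge // inE eqxx.
have hu : U^-1 <= unif (flip_pairs lo) u.
  rewrite /unif flip_pairs_mem // mul1r lef_pV2 ?posrE //; first by rewrite ler_nat max_card.
  by rewrite ltr0n flip_pairs_gt0.
have hl0 : 0 <= (weight q hi)%:R - (weight q lo)%:R :> R by rewrite -hilo.
apply: (@le_trans _ _ (unif (flip_pairs lo) u * (weight q hi)%:R)).
  have := ler_wpM2r hl0 hu; lra.
rewrite ler_wpM2l ?unif_ge0 // rule_weight_ge //.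
by rewrite !inE hiE eqxx orbT.
Qed.

End Random_flip.
End Mean_weight.

(** * The cone and the distance to it *)

Section Frobenius_norm.
Context {R : realType} {n : nat}.
Implicit Types x y z : 'M[R]_n.

Lemma frob_ge0 x : 0 <= frob x.
Proof. exact: sqrtr_ge0. Qed.

Lemma frob_sqr x : frob x ^+ 2 = \sum_i \sum_j x i j ^+ 2.
Proof. by rewrite sqr_sqrtr // !sumr_ge0 // => i _; rewrite sumr_ge0 // => j _; exact: sqr_ge0. Qed.

Lemma frob_sqr_pair x : frob x ^+ 2 = \sum_(u : 'I_n * 'I_n) x u.1 u.2 ^+ 2.
Proof. by rewrite frob_sqr pair_bigA. Qed.

Lemma frob_le_of_sqr x c : 0 <= c -> \sum_i \sum_j x i j ^+ 2 <= c ^+ 2 -> frob x <= c.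
Proof. by move=> c0 h; rewrite -(ger0_norm c0) -sqrtr_sqr ler_wsqrtr. Qed.

Lemma entry_le_frob x i j : `|x i j| <= frob x.
Proof.
rewrite -(ger0_norm (frob_ge0 x)) -ler_sqr ?nnegrE // !real_normK ?num_real //.
rewrite frob_sqr_pair (bigD1 (i, j)) //= lerDl.
by rewrite sumr_ge0 // => u _; exact: sqr_ge0.
Qed.

Lemma frob_le_entries x M : 0 <= M -> (forall i j, `|x i j| <= M) -> frob x <= n%:R * M.
Proof.
move=> M0 xM; apply: frob_le_of_sqr; first exact: mulr_ge0.
apply: (@le_trans _ _ (\sum_(i < n) \sum_(j < n) M ^+ 2)).
  apply: ler_sum => i _; apply: ler_sum => j _.
  by rewrite -real_normK ?num_real // lerXn2r ?nnegrE.
by rewrite !sumr_const !card_ord -mulrnA mulnn exprMn -natrX mulr_natl.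
Qed.

Lemma frob_cauchy_schwarz x y : \sum_(u : 'I_n * 'I_n) x u.1 u.2 * y u.1 u.2 <= frob x * frob y.
Proof.
have h0 (z w : 'M[R]_n) : frob z = 0 -> \sum_(u : 'I_n * 'I_n) z u.1 u.2 * w u.1 u.2 = 0.
  move=> z0; rewrite big1 // => u _; have := entry_le_frob z u.1 u.2.
  by rewrite z0 normr_le0 => /eqP ->; rewrite mul0r.
have := frob_ge0 x; rewrite le_eqVlt => /orP[/eqP/esym x0|x0]; first by rewrite h0 // x0 mul0r.
have := frob_ge0 y; rewrite le_eqVlt => /orP[/eqP/esym y0|y0].
  by under eq_bigr do rewrite mulrC; rewrite h0 // y0 mulr0.
set X := frob x in x0 *; set Y := frob y in y0 *.
have : 0 <= \sum_(u : 'I_n * 'I_n) (Y * x u.1 u.2 - X * y u.1 u.2) ^+ 2.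
  by apply: sumr_ge0 => u _; exact: sqr_ge0.
have -> : \sum_(u : 'I_n * 'I_n) (Y * x u.1 u.2 - X * y u.1 u.2) ^+ 2 =
    Y ^+ 2 * (\sum_(u : 'I_n * 'I_n) x u.1 u.2 ^+ 2)
    + X ^+ 2 * (\sum_(u : 'I_n * 'I_n) y u.1 u.2 ^+ 2)
    - 2 * X * Y * \sum_(u : 'I_n * 'I_n) x u.1 u.2 * y u.1 u.2.
  rewrite !mulr_sumr -mulN1r mulr_sumr -!big_split /=; apply: eq_bigr => u _; ring.
rewrite -!frob_sqr_pair -/X -/Y => h.
have XY : 0 < 2 * (X * Y) by rewrite !mulr_gt0.
by rewrite -(ler_pM2l XY); lra.
Qed.

Lemma frobD x y : frob (x + y) <= frob x + frob y.
Proof.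
apply: frob_le_of_sqr; first by rewrite addr_ge0 ?frob_ge0.
rewrite pair_bigA /=.
rewrite (eq_bigr (fun u : 'I_n * 'I_n => x u.1 u.2 ^+ 2 + y u.1 u.2 ^+ 2
   + 2 * (x u.1 u.2 * y u.1 u.2))); last by move=> u _; rewrite mxE; ring.
rewrite !big_split /= -mulr_sumr -!frob_sqr_pair.
have := frob_cauchy_schwarz x y; lra.
Qed.

Lemma frobN x : frob (- x) = frob x.
Proof.
by congr Num.sqrt; apply: eq_bigr => i _; apply: eq_bigr => j _; rewrite mxE sqrrN.
Qed.

End Frobenius_norm.

Section Projection.
Context {R : realType} {n' : nat}.
Local Notation n := n'.+1.
Implicit Types x y z : 'M[R]_n.

Lemma coneK0 : coneK (0 : 'M[R]_n).
Proof.
by split=> [|i j]; [exists (fun=> 0), (fun=> 0) => i j|]; rewrite mxE ?addr0.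
Qed.

(** Both families can be taken nonnegative: move the least [w i] to the other
    side. *)
Lemma coneK_param z : coneK z -> exists w w' : 'I_n -> R,
  (forall i, 0 <= w i) /\ (forall j, 0 <= w' j) /\ forall i j, z i j = w i + w' j.
Proof.
move=> [[w [w' zE]] z0].
pose m := [arg min_(i < ord0) w i]%O.
have wm i : w m <= w i by rewrite /m; case: Order.TotalTheory.arg_minP => // k _; exact.
exists (fun i => w i - w m), (fun j => w' j + w m); split; last split.
- by move=> i; rewrite subr_ge0.
- by move=> j; rewrite addrC -zE; exact: z0.
- by move=> i j; rewrite zE; ring.
Qed.

Let glue (u : 'rV[R]_(n + n)) : 'M[R]_n :=
  \matrix_(i, j) (u ord0 (lshift n i) + u ord0 (rshift n j)).

Let continuous_sum (I : Type) (r : seq I) (f : I -> 'rV[R]_(n + n) -> R)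
    (u : 'rV[R]_(n + n)) : (forall i, {for u, continuous (f i)}) ->
  {for u, continuous (fun v => \sum_(i <- r) f i v)}.
Proof.
move=> cf; elim: r => [|i r IH].
  have -> : (fun v => \sum_(i <- [::]) f i v) = (fun=> 0).
    by apply/funext => v; rewrite big_nil.
  exact: (@cst_continuous _ _ (0 : R) u).
have -> : (fun v => \sum_(j <- i :: r) f j v) = (fun v => f i v + \sum_(j <- r) f j v).
  by apply/funext => v; rewrite big_cons.
by apply: continuousD; [exact: cf|exact: IH].
Qed.

Let continuous_sqdist x (u : 'rV[R]_(n + n)) :
  {for u, continuous (fun v => \sum_(p : 'I_n * 'I_n) (x p.1 p.2 - glue v p.1 p.2) ^+ 2)}.
Proof.
apply: continuous_sum => p.
pose e (v : 'rV[R]_(n + n)) : R := x p.1 p.2 - (v ord0 (lshift n p.1) + v ord0 (rshift n p.2)).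
have c : {for u, continuous e}.
  apply: continuousB; first exact: (@cst_continuous _ _ (x p.1 p.2) u).
  by apply: continuousD; exact: coord_continuous.
have -> : (fun v => (x p.1 p.2 - glue v p.1 p.2) ^+ 2) = (fun v => e v * e v).
  by apply/funext => v; rewrite !mxE expr2.
exact: continuousM.
Qed.

(** A nearest point exists: outside a large box the distance exceeds the
    distance to [0]. *)
Lemma is_projK_exists x : exists y, is_projK x y.
Proof.
pose B := 2 * frob x.
have B0 : 0 <= B by rewrite mulr_ge0 ?frob_ge0.
pose A : set 'rV[R]_(n + n) := [set u | forall i, `[0, B]%classic (u ord0 i)].
have cA : compact A.
  by apply: (@rV_compact R _ (fun=> `[0, B]%classic)) => i; exact: segment_compact.
have A0 : A 0 by move=> i; rewrite /= mxE in_itv /= lexx.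
pose g u := \sum_(p : 'I_n * 'I_n) (x p.1 p.2 - glue u p.1 p.2) ^+ 2.
have gE u : g u = frob (x - glue u) ^+ 2.
  by rewrite frob_sqr_pair; apply: eq_bigr => p _; rewrite !mxE.
have [] := @compact_EVT_max _ R (fun u => - g u) A (ex_intro _ _ A0) cA.
  apply: continuous_subspaceT => u; apply: continuousN; exact: continuous_sqdist.
move=> c /set_mem Ac cmax.
have cmin u : A u -> frob (x - glue c) <= frob (x - glue u).
  move=> Au; have := cmax u (mem_set Au); rewrite lerN2 !gE.
  by rewrite ler_sqr ?nnegrE ?frob_ge0.
exists (glue c); split.
  split; first by exists (fun i => c ord0 (lshift n i)), (fun j => c ord0 (rshift n j)) => i j; rewrite mxE.
  by move=> i j; rewrite mxE addr_ge0 //; [have := Ac (lshift n i)|have := Ac (rshift n j)];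
    rewrite /= in_itv /= => /andP[].
move=> z /coneK_param[w [w' [w0 [w0' zE]]]].
pose u : 'rV[R]_(n + n) := \row_k match fintype.split k with inl i => w i | inr j => w' j end.
have uz : glue u = z.
  apply/matrixP => i j; rewrite !mxE zE.
  by rewrite (unsplitK (inl i)) (unsplitK (inr j)).
have [Au|nA] := pselect (A u); first by rewrite -uz; exact: cmin.
have far i j : B < z i j -> frob (x - glue c) <= frob (x - z).
  move=> Bz; have -> : frob (x - glue c) <= frob (x - z) = true; last by [].
  apply: (@le_trans _ _ (frob x)).
    apply: (le_trans (cmin 0 A0)).
    by rewrite (_ : glue 0 = 0) ?subr0 //; apply/matrixP => a b; rewrite !mxE addr0.
  have h1 := entry_le_frob (x - z) i j; have h2 := entry_le_frob x i j.
  move: h1 h2 Bz; rewrite !mxE /B ler_norml => h1; rewrite ler_norml => /andP[_ h2] Bz.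
  by move: h1 => /andP[h1 _]; lra.
have [k hk] : exists k, ~ `[0, B]%classic (u ord0 k).
  by apply/existsNP.
move: hk; rewrite /= in_itv /= mxE; case: fintype.split => [i|j] /negP; rewrite negb_and -!ltNge.
- rewrite ltNge w0 /= => Bw; apply: (far i ord0).
  by rewrite zE (lt_le_trans Bw) // lerDl.
- rewrite ltNge w0' /= => Bw; apply: (far ord0 j).
  by rewrite zE (lt_le_trans Bw) // lerDr.
Qed.

Lemma projKP x : is_projK x (Defs.projK x).
Proof. by rewrite /Defs.projK; have [y hy] := is_projK_exists x; apply: (xgetI _ hy). Qed.

Lemma perpK_le x y : coneK y -> frob (perpK x) <= frob (x - y).
Proof. by move=> Ky; have [_] := projKP x; exact. Qed.

Lemma perpK_le_frob x : frob (perpK x) <= frob x.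
Proof. by have := perpK_le x coneK0; rewrite subr0. Qed.

(** A distance to a set is 1-Lipschitz. *)
Lemma perpK_lipschitz x z : `|frob (perpK x) - frob (perpK z)| <= frob (x - z).
Proof.
have h (a b : 'M[R]_n) : frob (perpK a) <= frob (a - b) + frob (perpK b).
  have [Kb _] := projKP b; apply: (le_trans (perpK_le a Kb)).
  by apply: le_trans (frobD _ _); rewrite /perpK addrA subrK.
have e : frob (z - x) = frob (x - z) by rewrite -frobN opprB.
rewrite ler_distl lerBlDl; apply/andP; split; first by rewrite -e; exact: h.
by rewrite [leRHS]addrC; exact: h.
Qed.

(** The matrix [x i 0 + x 0 j - x 0 0] lies in the space of the sums
    [w i + w' j] and differs from [x] by second differences; adding their bound
    [M] to every entry makes it nonnegative. *)
Lemma perpK_le_second_diff x M : 0 <= M -> (forall i j, 0 <= x i j) ->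
  (forall i j, `|x i j + x ord0 ord0 - x i ord0 - x ord0 j| <= M) ->
  frob (perpK x) <= 2 * n%:R * M.
Proof.
move=> M0 x0 xM.
pose y : 'M[R]_n := \matrix_(i, j) (x i ord0 + (x ord0 j - x ord0 ord0 + M)).
have b i j : - M <= x i j + x ord0 ord0 - x i ord0 - x ord0 j <= M.
  by rewrite -ler_norml.
have Ky : coneK y.
  split; first by exists (fun i => x i ord0), (fun j => x ord0 j - x ord0 ord0 + M) => i j; rewrite mxE.
  by move=> i j; rewrite mxE; have /andP[h1 h2] := b i j; have := x0 i j; lra.
apply: (le_trans (perpK_le x Ky)); rewrite (_ : 2 * n%:R * M = n%:R * (2 * M)); last by ring.
apply: frob_le_entries; first by rewrite mulr_ge0.
move=> i j; rewrite !mxE ler_norml; have /andP[] := b i j.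
move: (x i j) (x ord0 ord0) (x i ord0) (x ord0 j) => s t s' t' h1 h2.
by clear -h1 h2; apply/andP; split; lra.
Qed.

End Projection.

(** * The queue length kernel *)

Section Elementary_inequalities.
Context {R : realFieldType}.
Implicit Types a b c d k s t w : R.

Lemma sqrD_le s t b : t ^+ 2 <= b -> (s + t) ^+ 2 <= s ^+ 2 + 2 * s * t + b.
Proof. by move=> h; rewrite sqrrD -mulrnAl -(mulr_natl s) lerD2l. Qed.

Lemma drift_arith_frob b w k a c : b <= w -> k * a <= k * c ->
  2 * (b - w - k * c) <= - (2 * k * a).
Proof. by move=> h1 h2; rewrite -mulrA; lra. Qed.

Lemma drift_arith_perp a b w k s t d : 2 * a <= w - b -> k * (s - t) <= d -> d <= a ->
  2 * (b - w - k * (t - s)) <= - (2 * a).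
Proof. by move=> h1 h2 h3; rewrite -(opprB s t) mulrN; lra. Qed.

Lemma lin_norm a b c t : 0 <= a <= t -> 0 <= b <= t -> 0 <= c <= t ->
  `|a + b - c| <= 2 * t.
Proof.
move=> /andP[a0 a1] /andP[b0 b1] /andP[c0 c1].
by rewrite ler_norml; apply/andP; split; lra.
Qed.

Lemma lin_unused a b c d t w : a <= 4 * w -> b <= 2 * t -> 8 * w <= c + d ->
  2 * a + b <= c + (d + 2 * t).
Proof. by move=> h1 h2 h3; lra. Qed.

(** A weighted inequality of arithmetic and geometric means, with
    [t ^+ 2 <= k * t]. *)
Lemma young_unused v t k eta : 0 < eta -> 0 <= t -> t <= k ->
  8 * (v * t) <= 4 * eta * v ^+ 2 + 4 * k / eta * t.
Proof.
move=> eta0 t0 tk.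
have h1 : t * t <= k * t by rewrite ler_wpM2r.
have h2 : 0 <= (eta * v - t) ^+ 2 by exact: sqr_ge0.
rewrite -(ler_pM2r eta0).
have -> : (4 * eta * v ^+ 2 + 4 * k / eta * t) * eta = 4 * (eta * v) ^+ 2 + 4 * (k * t).
  by field; rewrite gt_eqF.
have -> : 8 * (v * t) * eta = 8 * ((eta * v) * t) by ring.
by move: (eta * v) h2 => w h2; move: h2; rewrite sqrrB -expr2 in h1 *; lra.
Qed.

End Elementary_inequalities.

Section Queue_kernel.
Context {R : realType} {n' amax : nat}.
Local Notation n := n'.+1.
Local Notation state := 'M[nat]_n.
Local Notation arrivals := {ffun 'I_n * 'I_n -> 'I_amax.+1}.
Variable m : 'I_n * 'I_n -> 'I_amax.+1 -> R.
Variable mu : schedule_law R n.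

Definition arrival_prob (b : arrivals) : R := \prod_u m u (b u).
Definition arrival_mx (b : arrivals) : state := \matrix_(i, j) (b (i, j) : nat).
Definition queue_wt (q : state) (j : arrivals * 'S_n) : R := arrival_prob j.1 * mu q j.2.
Definition queue_nxt (q : state) (j : arrivals * 'S_n) : state :=
  next_queue q (arrival_mx j.1) j.2.

Hypothesis m_ge0 : forall u k, 0 <= m u k.
Hypothesis m_sum1 : forall u, \sum_k m u k = 1.
Hypothesis mu_prob : forall q, prob (mu q).

Lemma arrival_prob_ge0 b : 0 <= arrival_prob b.
Proof. exact: prodr_ge0. Qed.

Lemma arrival_prob_prod (h : 'I_n * 'I_n -> 'I_amax.+1 -> R) :
  \sum_b arrival_prob b * \prod_u h u (b u) = \prod_u \sum_k m u k * h u k.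
Proof.
by rewrite bigA_distr_bigA; apply: eq_bigr => b _; rewrite -big_split.
Qed.

Lemma arrival_prob_sum1 : \sum_b arrival_prob b = 1.
Proof.
have := arrival_prob_prod (fun _ _ => 1).
rewrite [RHS]big1; last by move=> u _; under eq_bigr do rewrite mulr1; exact: m_sum1.
by move=> <-; apply: eq_bigr => b _; rewrite big1 ?mulr1.
Qed.

Lemma arrival_marginal v (h : 'I_amax.+1 -> R) :
  \sum_b arrival_prob b * h (b v) = \sum_k m v k * h k.
Proof.
have := arrival_prob_prod (fun u k => if u == v then h k else 1).
rewrite (bigD1 v) //= eqxx [X in _ = _ * X]big1 ?mulr1; last first.
  by move=> u /negbTE uv; under eq_bigr do rewrite uv mulr1; exact: m_sum1.
move=> <-; apply: eq_bigr => b _; congr (_ * _).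
by rewrite (bigD1 v) //= eqxx big1 ?mulr1 // => u /negbTE ->.
Qed.

Lemma arrival_marginal2 v v' (h h' : 'I_amax.+1 -> R) : v != v' ->
  \sum_b arrival_prob b * (h (b v) * h' (b v')) =
  (\sum_k m v k * h k) * (\sum_k m v' k * h' k).
Proof.
move=> vv'; have v'v : v' != v by rewrite eq_sym.
have := arrival_prob_prod (fun u k => if u == v then h k else if u == v' then h' k else 1).
rewrite (bigD1 v) //= eqxx (bigD1 v') //= (negbTE v'v) eqxx [X in _ = _ * (_ * X)]big1 ?mulr1; last first.
  by move=> u /andP[/negbTE uv /negbTE uv']; under eq_bigr do rewrite uv uv' mulr1; exact: m_sum1.
move=> <-; apply: eq_bigr => b _; congr (_ * _).
rewrite (bigD1 v) //= eqxx (bigD1 v') //= (negbTE v'v) eqxx big1 ?mulr1 //.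
by move=> u /andP[/negbTE -> /negbTE ->].
Qed.

Lemma queue_wt_ge0 q j : 0 <= queue_wt q j.
Proof. by rewrite mulr_ge0 ?arrival_prob_ge0 //; have [] := mu_prob q. Qed.

Definition step_mean (q : state) (G : arrivals * 'S_n -> R) : R := \sum_j queue_wt q j * G j.

Lemma step_mean_arrival q (g : arrivals -> R) :
  step_mean q (fun j => g j.1) = \sum_b arrival_prob b * g b.
Proof.
rewrite /step_mean -(pair_big xpredT xpredT (fun b s => queue_wt q (b, s) * g b)) /=.
apply: eq_bigr => b _; rewrite -[RHS]mulr1; have [_ <-] := mu_prob q.
by rewrite big_distrr /=; apply: eq_bigr => s _; rewrite /queue_wt /= mulrAC.
Qed.

Lemma step_mean_schedule q (g : 'S_n -> R) : step_mean q (fun j => g j.2) = \sum_s mu q s * g s.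
Proof.
rewrite /step_mean -(pair_big xpredT xpredT (fun b s => queue_wt q (b, s) * g s)) /= exchange_big /=.
apply: eq_bigr => s _; rewrite -[RHS]mul1r -arrival_prob_sum1.
by rewrite big_distrl /=; apply: eq_bigr => b _; rewrite /queue_wt /= mulrA.
Qed.

Lemma queue_wt_sum1 q : \sum_j queue_wt q j = 1.
Proof.
have := step_mean_arrival q (fun=> 1); rewrite /step_mean; under eq_bigr do rewrite mulr1.
by move=> ->; under eq_bigr do rewrite mulr1; exact: arrival_prob_sum1.
Qed.

Lemma step_mean_cst q c : step_mean q (fun=> c) = c.
Proof. by rewrite /step_mean -big_distrl /= queue_wt_sum1 mul1r. Qed.

Lemma step_meanD q G H : step_mean q (fun j => G j + H j) = step_mean q G + step_mean q H.
Proof. by rewrite /step_mean -big_split /=; apply: eq_bigr => j _; rewrite mulrDr. Qed.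

Lemma step_meanZ q c G : step_mean q (fun j => c * G j) = c * step_mean q G.
Proof. by rewrite /step_mean big_distrr /=; apply: eq_bigr => j _; rewrite mulrCA. Qed.

Lemma step_meanB q G H : step_mean q (fun j => G j - H j) = step_mean q G - step_mean q H.
Proof.
rewrite -[X in _ = _ + X]mulN1r -step_meanZ -step_meanD; apply: eq_bigr => j _; congr (_ * _).
by rewrite mulN1r.
Qed.

Lemma step_mean_sum q (I : finType) (G : I -> arrivals * 'S_n -> R) :
  step_mean q (fun j => \sum_i G i j) = \sum_i step_mean q (G i).
Proof.
rewrite /step_mean exchange_big /=; apply: eq_bigr => j _.
by rewrite big_distrr.
Qed.

Lemma step_mean_le q G H : (forall j, G j <= H j) -> step_mean q G <= step_mean q H.
Proof. by move=> GH; apply: ler_sum => j _; rewrite ler_wpM2l // queue_wt_ge0. Qed.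

Lemma eq_step_mean q G H : G =1 H -> step_mean q G = step_mean q H.
Proof. by move=> GH; apply: eq_bigr => j _; rewrite GH. Qed.

Local Notation P := (avg queue_wt queue_nxt).

Lemma avg_step_mean f q : P f q = step_mean q (fun j => f (queue_nxt q j)).
Proof. by []. Qed.

Definition realmx (q : state) : 'M[R]_n := map_mx (fun k : nat => k%:R : R) q.
Definition arr (j : arrivals * 'S_n) (i k : 'I_n) : R := (j.1 (i, k))%:R.
Definition srv (j : arrivals * 'S_n) (i k : 'I_n) : R := (j.2 i == k)%:R.
Definition unused (q : state) (j : arrivals * 'S_n) (i k : 'I_n) : R :=
  ((q i k + j.1 (i, k) < (j.2 i == k))%N)%:R.

Let subE (A B : 'M[R]_n) i k : (A - B) i k = A i k - B i k.
Proof. by rewrite !mxE. Qed.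

Lemma realmxE q i k : realmx q i k = (q i k)%:R.
Proof. by rewrite mxE. Qed.

Let nat_of_boolE (b : bool) : (b%:R : nat) = b. Proof. by case: b. Qed.

Lemma next_entry q j i k :
  realmx (queue_nxt q j) i k = (q i k)%:R + arr j i k - srv j i k + unused q j i k.
Proof.
have key (a : nat) (b : bool) : (a - (b%:R : nat))%:R = a%:R - b%:R + (a < b)%N%:R :> R.
  rewrite nat_of_boolE; case: b; last by rewrite ltn0 subn0 subr0 addr0.
  case: a => [|a]; first by rewrite sub0n /=; ring.
  by rewrite subn1 (_ : (a.+1 < true)%N = false) //= -natr1 addr0 addrK.
by rewrite /realmx /queue_nxt /unused /arr /srv !mxE key natrD.
Qed.

Lemma unused_le_srv q j i k : unused q j i k <= srv j i k.
Proof. by rewrite ler_nat; case: (_ == _); case: ltnP. Qed.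

Lemma unused_ge0 q j i k : 0 <= unused q j i k.
Proof. exact: ler0n. Qed.

Lemma unused_next q j i k : unused q j i k * realmx (queue_nxt q j) i k = 0.
Proof.
rewrite realmxE /unused /queue_nxt !mxE; case: ltnP => h; last by rewrite mul0r.
rewrite nat_of_boolE.
by move: (ltnW h); rewrite -subn_eq0 => /eqP ->; rewrite mulr0.
Qed.

Lemma arr_ge0 j i k : 0 <= arr j i k. Proof. exact: ler0n. Qed.

Lemma arr_le j i k : arr j i k <= amax%:R.
Proof. by rewrite ler_nat -ltnS. Qed.

Lemma srv01 j i k : 0 <= srv j i k <= 1.
Proof. by rewrite ler0n lern1 leq_b1. Qed.

Lemma srv_row j i : \sum_k srv j i k = 1.
Proof.
rewrite (bigD1 (j.2 i)) //= /srv eqxx big1 ?addr0 // => k /negbTE; rewrite eq_sym => ->.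
by [].
Qed.

Lemma srv_col j k : \sum_i srv j i k = 1.
Proof.
rewrite (bigD1 ((j.2)^-1 k)%g) //= /srv permKV eqxx big1 ?addr0 // => i ik.
by case: eqP => // e; move: ik; rewrite -e permK eqxx.
Qed.

Lemma step_mean_srv_row q i : \sum_k step_mean q (fun j => srv j i k) = 1.
Proof. by rewrite -step_mean_sum -[RHS](step_mean_cst q); apply: eq_step_mean => j; exact: srv_row. Qed.

Lemma step_mean_srv_col q k : \sum_i step_mean q (fun j => srv j i k) = 1.
Proof. by rewrite -step_mean_sum -[RHS](step_mean_cst q); apply: eq_step_mean => j; exact: srv_col. Qed.

Lemma step_mean_weight (q : state) : \sum_i \sum_k (q i k)%:R * step_mean q (fun j => srv j i k) = mean_weight (mu q) q.
Proof.
rewrite /mean_weight -(step_mean_schedule q (fun s => (weight q s)%:R)).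
under eq_bigr do under eq_bigr do rewrite -step_meanZ.
under eq_bigr do rewrite -step_mean_sum.
rewrite -step_mean_sum; apply: eq_step_mean => j; rewrite weightR; apply: eq_bigr => i _.
rewrite (bigD1 (j.2 i)) //= /srv eqxx mulr1 big1 ?addr0 // => k /negbTE.
by rewrite eq_sym => ->; rewrite mulr0.
Qed.

Variables (e c : R).
Hypothesis e01 : 0 < e < 1.
Hypothesis c_gt0 : 0 < c.
Hypothesis m_mean : forall u, \sum_k m u k * k%:R = (1 - e) / n%:R.
Hypothesis mu_gap : forall q i k j l,
  total q / n%:R + c * `|second_diff q i k j l| <= mean_weight (mu q) q.

Let n_gt0 : 0 < n%:R :> R. Proof. by rewrite ltr0n. Qed.

Lemma step_mean_arr q i k : step_mean q (fun j => arr j i k) = (1 - e) / n%:R.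
Proof.
rewrite -(m_mean (i, k)) -(arrival_marginal (i, k) (fun l => l%:R)).
exact: (step_mean_arrival q (fun b => (b (i, k))%:R)).
Qed.

Definition step_bound : R := amax.+1%:R.

Lemma arr_srv_sqr j i k : (arr j i k - srv j i k) ^+ 2 <= step_bound ^+ 2.
Proof.
rewrite -real_normK ?num_real // lerXn2r ?nnegrE // /step_bound -natr1.
have := arr_ge0 j i k; have := arr_le j i k; have /andP[] := srv01 j i k.
by move=> s0 s1 a1 a0; rewrite ler_norml; apply/andP; split; lra.
Qed.

Lemma next_entry_dist q j i k : `|realmx (queue_nxt q j) i k - realmx q i k| <= step_bound.
Proof.
rewrite next_entry realmxE /step_bound -natr1.
have := arr_ge0 j i k; have := arr_le j i k; have /andP[] := srv01 j i k.
have := unused_ge0 q j i k; have := unused_le_srv q j i k.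
by move=> u1 u0 s0 s1 a1 a0; rewrite ler_norml; apply/andP; split; lra.
Qed.

Lemma next_frob_dist q j : frob (realmx (queue_nxt q j) - realmx q) <= n%:R * step_bound.
Proof.
apply: frob_le_entries; first exact: ler0n.
by move=> i k; rewrite subE; exact: next_entry_dist.
Qed.

(** The truncation at [0] only brings the queue closer to a nonnegative [y]. *)
Lemma next_entry_sqr_le q j i k (y : R) : 0 <= y ->
  (realmx (queue_nxt q j) i k - y) ^+ 2 <= ((q i k)%:R - y + (arr j i k - srv j i k)) ^+ 2.
Proof.
move=> y0; have := unused_next q j i k; have := next_entry q j i k.
set x := realmx _ i k; set z := (q i k)%:R; set u := unused q j i k.
have [->|->] : u = 0 \/ u = 1 by rewrite /u /unused; case: ltnP; [right|left].
  by move=> -> _; rewrite le_eqVlt; apply/orP; left; apply/eqP; ring.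
move=> xE; rewrite mul1r => x0.
have -> : z - y + (arr j i k - srv j i k) = - (y + 1) by move: xE; rewrite x0; lra.
by rewrite x0 sub0r !sqrrN lerXn2r ?nnegrE ?addr_ge0 // lerDl.
Qed.

Let srv_additive q (y : 'M[R]_n) : spaceS y ->
  \sum_i \sum_k y i k * step_mean q (fun j => srv j i k) = (\sum_i \sum_k y i k) / n%:R.
Proof.
move=> [w [w' yE]].
rewrite (eq_bigr (fun i => w i + \sum_k w' k * step_mean q (fun j => srv j i k))); last first.
  move=> i _; rewrite -[w i]mulr1 -(step_mean_srv_row q i) mulr_sumr -big_split /=.
  by apply: eq_bigr => k _; rewrite yE mulrDl.
rewrite big_split /= exchange_big /=.
rewrite [X in _ + X](eq_bigr w'); last first.
  by move=> k _; rewrite -mulr_sumr step_mean_srv_col mulr1.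
have -> : \sum_i \sum_k y i k = n%:R * (\sum_i w i + \sum_k w' k).
  rewrite (eq_bigr (fun i => n%:R * w i + \sum_k w' k)); last first.
    move=> i _; rewrite (eq_bigr (fun k => w i + w' k)); last by move=> k _; exact: yE.
    by rewrite big_split /= sumr_const card_ord mulr_natl.
  by rewrite big_split /= -mulr_sumr mulrDr; congr (_ + _); rewrite sumr_const card_ord mulr_natl.
by rewrite mulrC mulKf // gt_eqF.
Qed.

(** The one-step drift of the squared distance to a point [y] of the cone.
    Since [y] is of the form [w i + w' j], every schedule serves it equally,
    and only the terms in [q] feel the schedule. *)
Lemma sqdist_drift q (y : 'M[R]_n) : coneK y ->
  step_mean q (fun j => frob (realmx (queue_nxt q j) - y) ^+ 2) <=
  frob (realmx q - y) ^+ 2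
  + 2 * (total q / n%:R - mean_weight (mu q) q
         - e / n%:R * (total q - \sum_i \sum_k y i k))
  + (n%:R * step_bound) ^+ 2.
Proof.
move=> [Sy y0].
pose x i k : R := (q i k)%:R - y i k.
apply: (@le_trans _ _ (step_mean q (fun j => \sum_i \sum_k
    (x i k ^+ 2 + (2 * x i k) * (arr j i k - srv j i k) + step_bound ^+ 2)))).
  apply: step_mean_le => j; rewrite frob_sqr; apply: ler_sum => i _; apply: ler_sum => k _.
  rewrite subE; apply: (le_trans (next_entry_sqr_le q j i k (y0 i k))).
  have h := arr_srv_sqr j i k; rewrite -/(x i k).
  exact: sqrD_le.
rewrite step_mean_sum (eq_bigr (fun i => \sum_k (x i k ^+ 2 + 2 * (x i k * ((1 - e) / n%:R)
    - x i k * step_mean q (fun j => srv j i k)) + step_bound ^+ 2))); last first.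
  move=> i _; rewrite step_mean_sum; apply: eq_bigr => k _.
  by rewrite !step_meanD !step_mean_cst step_meanZ step_meanB step_mean_arr; ring.
pose A := \sum_i \sum_k x i k ^+ 2; pose T := \sum_i \sum_k x i k.
pose B := \sum_i \sum_k x i k * step_mean q (fun j => srv j i k).
have -> : \sum_i \sum_k (x i k ^+ 2 + 2 * (x i k * ((1 - e) / n%:R)
    - x i k * step_mean q (fun j => srv j i k)) + step_bound ^+ 2)
    = A + 2 * (T * ((1 - e) / n%:R) - B) + (n%:R * step_bound) ^+ 2.
  rewrite /A /T /B mulr_suml -sumrB mulr_sumr -big_split /=.
  have -> : (n%:R * step_bound) ^+ 2 = \sum_(i < n) \sum_(k < n) step_bound ^+ 2.
    by rewrite !sumr_const !card_ord -mulrnA mulnn exprMn -natrX mulr_natl.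
  rewrite -big_split /=; apply: eq_bigr => i _.
  by rewrite mulr_suml -sumrB mulr_sumr -!big_split.
have -> : frob (realmx q - y) ^+ 2 = A.
  by rewrite frob_sqr; apply: eq_bigr => i _; apply: eq_bigr => k _; rewrite !mxE.
have -> : B = mean_weight (mu q) q - (\sum_i \sum_k y i k) / n%:R.
  rewrite -step_mean_weight -(srv_additive q Sy) -sumrB; apply: eq_bigr => i _.
  by rewrite -sumrB; apply: eq_bigr => k _; rewrite /x mulrBl.
have -> : T = total q - \sum_i \sum_k y i k.
  by rewrite /T /total -sumrB; apply: eq_bigr => i _; rewrite -sumrB.
set t := total q; set s := \sum_i _; set w := mean_weight _ _.
rewrite lerD2r lerD2l ler_pM2l // le_eqVlt; apply/orP; left; apply/eqP.
by field; rewrite gt_eqF.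
Qed.

Let gap0 q : total q / n%:R <= mean_weight (mu q) q.
Proof.
by apply: le_trans (mu_gap q ord0 ord0 ord0 ord0); rewrite lerDl mulr_ge0 // ltW.
Qed.

Lemma frob_le_total q : frob (realmx q) <= total q.
Proof.
apply: frob_le_of_sqr; first exact: total_ge0.
rewrite expr2 {1}/total mulr_suml; apply: ler_sum => i _; rewrite mulr_suml.
apply: ler_sum => k _; rewrite realmxE expr2 ler_wpM2l // /total (bigD1 i) //= (bigD1 k) //=.
by rewrite -addrA lerDl addr_ge0 // ?sumr_ge0 // => a _; rewrite sumr_ge0.
Qed.

(** The case [y = 0] of [sqdist_drift]. *)
Lemma frob_drift q :
  P (fun x => frob (realmx x) ^+ 2) q <=
  frob (realmx q) ^+ 2 - 2 * (e / n%:R) * frob (realmx q) + (n%:R * step_bound) ^+ 2.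
Proof.
have := sqdist_drift q (@coneK0 R n'); rewrite subr0.
have -> : \sum_i \sum_k (0 : 'M[R]_n) i k = 0.
  by rewrite big1 // => i _; rewrite big1 // => k _; rewrite mxE.
rewrite subr0 (@eq_step_mean q _ (fun j => frob (realmx (queue_nxt q j)) ^+ 2)); last first.
  by move=> j; rewrite subr0.
rewrite (avg_step_mean (fun x => frob (realmx x) ^+ 2)) => /le_trans; apply; rewrite lerD2r lerD2l.
have h1 := gap0 q; have h2 := frob_le_total q.
have e0 : 0 <= e / n%:R by case/andP: e01 => h _; rewrite divr_ge0 // ltW.
have h3 := ler_wpM2l e0 h2.
exact: drift_arith_frob.
Qed.

Definition perp_norm (q : state) : R := frob (perpK (realmx q)).

Lemma perp_norm_ge0 q : 0 <= perp_norm q.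
Proof. exact: frob_ge0. Qed.

(** The distance to the cone is controlled by the second differences, hence by
    the gain of the schedule over a uniform one. *)
Lemma perp_norm_gap q :
  c / (2 * n%:R) * perp_norm q <= mean_weight (mu q) q - total q / n%:R.
Proof.
set X := _ - _; have X0 : 0 <= X by rewrite subr_ge0 gap0.
have h : perp_norm q <= 2 * n%:R * (X / c).
  apply: perpK_le_second_diff; first by rewrite divr_ge0 // ltW.
    by move=> i j; rewrite realmxE.
  move=> i j; rewrite !realmxE -/(second_diff (R := R) q i ord0 j ord0) ler_pdivlMr // mulrC.
  by rewrite /X lerBrDl mu_gap.
have c2 : 0 < c / (2 * n%:R) by rewrite divr_gt0 // mulr_gt0.
have := ler_wpM2l (ltW c2) h.
suff -> : c / (2 * n%:R) * (2 * n%:R * (X / c)) = X by [].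
by field; rewrite !gt_eqF.
Qed.

(** Freeze the projection [y] of [q] and use [sqdist_drift]. The gain of the
    schedule pulls the queue towards the cone with a force independent of [e],
    whereas the mismatch of the totals of [q] and [y] pushes it away with a
    force proportional to [e]; for small [e] half of the pull remains. *)
Lemma perp_norm_drift q : e <= c / (4 * n%:R ^+ 2) ->
  P (fun x => perp_norm x ^+ 2) q <=
  perp_norm q ^+ 2 - 2 * (c / (4 * n%:R)) * perp_norm q + (n%:R * step_bound) ^+ 2.
Proof.
move=> ec; have [Ky _] := projKP (realmx q); set y := Defs.projK _ in Ky.
apply: (@le_trans _ _ (step_mean q (fun j => frob (realmx (queue_nxt q j) - y) ^+ 2))).
  rewrite avg_step_mean; apply: step_mean_le => j.
  apply: lerXn2r; rewrite ?nnegrE; [exact: frob_ge0|exact: frob_ge0|].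
  exact: perpK_le.
apply: (le_trans (sqdist_drift q Ky)).
have -> : frob (realmx q - y) = perp_norm q by [].
rewrite lerD2r lerD2l.
have h1 := perp_norm_gap q.
have h2 : \sum_i \sum_k y i k - total q <= n%:R ^+ 2 * perp_norm q.
  rewrite /total -sumrB; apply: (@le_trans _ _ (\sum_(i < n) \sum_(k < n) perp_norm q)).
    apply: ler_sum => i _; rewrite -sumrB; apply: ler_sum => k _.
    apply: le_trans (entry_le_frob (perpK (realmx q)) i k).
    by rewrite !mxE -/y distrC ler_norm.
  by rewrite !sumr_const !card_ord -mulrnA mulnn -natrX mulr_natl.
have e0 : 0 <= e / n%:R by case/andP: e01 => h _; rewrite divr_ge0 // ltW.
have h3 := ler_wpM2l e0 h2.
have h4 : e / n%:R * (n%:R ^+ 2 * perp_norm q) <= c / (4 * n%:R) * perp_norm q.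
  have -> : e / n%:R * (n%:R ^+ 2 * perp_norm q) = e * n%:R * perp_norm q.
    by field; rewrite gt_eqF.
  rewrite ler_wpM2r ?perp_norm_ge0 //.
  have -> : c / (4 * n%:R) = c / (4 * n%:R ^+ 2) * n%:R by field; rewrite gt_eqF.
  by rewrite ler_pM2r.
have h5 : c / (2 * n%:R) * perp_norm q = 2 * (c / (4 * n%:R) * perp_norm q).
  by field; rewrite gt_eqF.
rewrite h5 in h1.
have -> : 2 * (c / (4 * n%:R)) * perp_norm q = 2 * (c / (4 * n%:R) * perp_norm q).
  exact/esym/mulrA.
exact: drift_arith_perp h1 h3 h4.
Qed.

Lemma perp_norm_le_frob q : perp_norm q <= frob (realmx q).
Proof. exact: perpK_le_frob. Qed.

Lemma frob_jump q j :
  `|frob (realmx (queue_nxt q j)) - frob (realmx q)| <= n%:R * step_bound.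
Proof.
apply: le_trans (next_frob_dist q j).
rewrite ler_distl lerBlDr; apply/andP; split.
  rewrite -(frobN (_ - _)) opprB -{1}(subrK (realmx (queue_nxt q j)) (realmx q)).
  by rewrite addrC; apply: frobD.
rewrite -{1}(subrK (realmx q) (realmx (queue_nxt q j))) addrC; exact: frobD.
Qed.

Lemma perp_norm_jump q j :
  `|perp_norm (queue_nxt q j) - perp_norm q| <= n%:R * step_bound.
Proof. exact: le_trans (perpK_lipschitz _ _) (next_frob_dist q j). Qed.

Definition empty_queue : state := \matrix_(i, k) 0%N.
Definition totn (q : state) : nat := (\sum_i \sum_k q i k)%N.
Hypothesis m_zero : forall u, 0 < m u ord0.

Lemma totalE q : total q = (totn q)%:R :> R.
Proof. by rewrite natr_sum; apply: eq_bigr => i _; rewrite natr_sum. Qed.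

Lemma totn_eq0 q : totn q = 0%N -> q = empty_queue.
Proof.
move=> /eqP; rewrite sum_nat_eq0 => /forallP h; apply/matrixP => i k.
by have := h i; rewrite sum_nat_eq0 => /forallP /(_ k) /eqP; rewrite mxE.
Qed.

Let no_arrival : arrivals := [ffun=> ord0].

Lemma arrival_mx0 : arrival_mx no_arrival = empty_queue.
Proof. by apply/matrixP => i k; rewrite !mxE ffunE. Qed.

Lemma arrival_prob0 : 0 < arrival_prob no_arrival.
Proof. by apply: prodr_gt0 => u _; rewrite ffunE. Qed.

Lemma next_empty_le q s : (totn (next_queue q empty_queue s) <= totn q)%N.
Proof.
by apply: leq_sum => i _; apply: leq_sum => k _; rewrite !mxE addn0 leq_subr.
Qed.

Lemma next_empty_lt q s : (0 < weight q s)%N ->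
  (totn (next_queue q empty_queue s) < totn q)%N.
Proof.
rewrite weightE => w0; have [i qi] : exists i, (0 < q i (s i))%N.
  apply/existsP; apply: contraTT w0; rewrite negb_exists => /forallP h.
  by rewrite -leqNgt leqn0 sum_nat_eq0; apply/forallP => i; have := h i; rewrite -eqn0Ngt.
rewrite /totn (bigD1 i) //= [X in (_ < X)%N](bigD1 i) //= -addSn leq_add //; last first.
  by apply: leq_sum => a _; apply: leq_sum => b _; rewrite !mxE addn0 leq_subr.
rewrite (bigD1 (s i)) //= [X in (_ < X)%N](bigD1 (s i)) //= -addSn leq_add //; last first.
  by apply: leq_sum => b _; rewrite !mxE addn0 leq_subr.
by rewrite !mxE addn0 eqxx nat_of_boolE subn1 prednK.
Qed.

(** A schedule of positive weight removes a packet when nothing arrives, and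
    such a schedule has probability at least [1 / n], because the mean weight is
    at least [total q / n] while no weight exceeds [total q]. *)
Lemma serving_prob q : n%:R^-1 <= \sum_(s | (totn (next_queue q empty_queue s) <= (totn q).-1)%N) mu q s.
Proof.
have [mu0 mu1] := mu_prob q.
have [t0|t0] := posnP (totn q).
  rewrite (eq_bigl xpredT) ?mu1; last by move=> s; rewrite (leq_trans (next_empty_le q s)) // t0.
  by rewrite invf_le1 // ler1n.
have T0 : (0 : R) < total q by rewrite totalE ltr0n.
rewrite -(ler_pM2l T0); apply: (le_trans (gap0 q)).
rewrite /mean_weight (bigID (fun s => (0 < weight q s)%N)) /= [X in _ + X]big1 ?addr0; last first.
  by move=> s; rewrite -eqn0Ngt => /eqP ->; rewrite mulr0.
rewrite mulr_sumr big_mkcond [leRHS]big_mkcond; apply: ler_sum => s _.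
case: ifP => [w0|_]; last by case: ifP => // _; rewrite mulr_ge0 // ltW.
have lt := next_empty_lt w0; rewrite -ltnS prednK // lt mulrC ler_wpM2r //.
exact: weight_le_total.
Qed.

Definition reach_prob : R := arrival_prob no_arrival / n%:R.

Lemma reach_prob_gt0 : 0 < reach_prob.
Proof. by rewrite divr_gt0 // arrival_prob0. Qed.

(** With [reach_prob] the total drops by one or is already zero; [N] such steps
    in a row empty the switch. *)
Lemma reach_empty N q : (totn q <= N)%N ->
  reach_prob ^+ N <= iter N P (ind [set empty_queue]) q.
Proof.
elim: N q => [|N IH] q qN.
  have q0 : totn q = 0%N by apply/eqP; rewrite -leqn0.
  by rewrite expr0 /= /ind asboolT // (totn_eq0 q0).
have [mu0 mu1] := mu_prob q.
rewrite iterS; set g := iter N P _.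
have g0 x : 0 <= g x.
  by apply: avgn_ge0; [exact: queue_wt_ge0|exact: queue_wt_sum1|exact: ind_ge0].
have h1 : \sum_s queue_wt q (no_arrival, s) * g (queue_nxt q (no_arrival, s)) <= P g q.
  rewrite /avg -(pair_big xpredT xpredT (fun b s => queue_wt q (b, s) * g (queue_nxt q (b, s)))) /=.
  rewrite (bigD1 no_arrival) //= lerDl sumr_ge0 // => b _; rewrite sumr_ge0 // => s _.
  by rewrite mulr_ge0 // queue_wt_ge0.
apply: le_trans h1; rewrite exprSr.
have rN : 0 <= reach_prob ^+ N by rewrite exprn_ge0 // ltW // reach_prob_gt0.
apply: (@le_trans _ _ (reach_prob ^+ N * (arrival_prob no_arrival *
    \sum_(s | (totn (next_queue q empty_queue s) <= (totn q).-1)%N) mu q s))).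
  rewrite ler_wpM2l // /reach_prob ler_wpM2l ?serving_prob //; exact/ltW/arrival_prob0.
rewrite mulrA mulr_sumr big_mkcond; apply: ler_sum => s _.
case: ifP => [le|_]; last by rewrite mulr_ge0 // queue_wt_ge0.
rewrite /queue_wt /queue_nxt /= arrival_mx0 -mulrA mulrC ler_wpM2l //.
  by rewrite mulr_ge0 // ltW // arrival_prob0.
apply: IH; apply: (leq_trans le); rewrite -ltnS.
by case: (totn q) qN.
Qed.

Local Notation lam := ((1 - e) / n%:R).

Definition var (u : 'I_n * 'I_n) : R := \sum_k m u k * (k%:R - lam) ^+ 2.

Lemma centered_mean u : \sum_k m u k * (k%:R - lam) = 0.
Proof.
under eq_bigr do rewrite mulrBr.
by rewrite sumrB m_mean -mulr_suml m_sum1 mul1r subrr.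
Qed.

(** Arrivals at different pairs are uncorrelated. *)
Lemma centered_sum_sqr q (I : finType) (f : I -> 'I_n * 'I_n) : injective f ->
  step_mean q (fun j => (\sum_x ((j.1 (f x))%:R - lam)) ^+ 2) = \sum_x var (f x).
Proof.
move=> f_inj; rewrite (step_mean_arrival q (fun b => (\sum_x ((b (f x))%:R - lam)) ^+ 2)).
rewrite (eq_bigr (fun b => \sum_x \sum_y arrival_prob b *
    (((b (f x))%:R - lam) * ((b (f y))%:R - lam)))); last first.
  move=> b _; rewrite expr2 mulr_suml mulr_sumr; apply: eq_bigr => x _.
  by rewrite !mulr_sumr.
rewrite exchange_big /=; apply: eq_bigr => x _; rewrite exchange_big (bigD1 x) //=.
rewrite [X in _ + X]big1 ?addr0.
  exact: (arrival_marginal (f x) (fun k : 'I_amax.+1 => (k%:R - lam) ^+ 2)).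
move=> y yx; pose h (k : 'I_amax.+1) := k%:R - lam.
rewrite (arrival_marginal2 h h) ?centered_mean ?mul0r //.
by rewrite (inj_eq f_inj) eq_sym.
Qed.

Lemma centered_sum_mean q (I : finType) (f : I -> 'I_n * 'I_n) :
  step_mean q (fun j => \sum_x ((j.1 (f x))%:R - lam)) = 0.
Proof.
rewrite step_mean_sum big1 // => x _; rewrite (step_mean_arrival q (fun b => (b (f x))%:R - lam)).
by rewrite (arrival_marginal (f x) (fun k : 'I_amax.+1 => k%:R - lam)) centered_mean.
Qed.

Let step_mean_shift_sqr q (G : arrivals * 'S_n -> R) s v : step_mean q G = 0 ->
  step_mean q (fun j => G j ^+ 2) = v -> step_mean q (fun j => (G j - s) ^+ 2) = v + s ^+ 2.
Proof.
move=> G0 Gv; rewrite (@eq_step_mean q _ (fun j => G j ^+ 2 + (- (2 * s)) * G j + s ^+ 2)).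
  by rewrite !step_meanD step_meanZ step_mean_cst G0 Gv mulr0 addr0.
by move=> j; ring.
Qed.

Let step_mean_shift q (G : arrivals * 'S_n -> R) s : step_mean q G = 0 -> step_mean q (fun j => G j - s) = - s.
Proof. by move=> G0; rewrite step_meanB step_mean_cst G0 sub0r. Qed.

Let rowc (j : arrivals * 'S_n) i : R := \sum_k ((j.1 (i, k))%:R - lam).
Let colc (j : arrivals * 'S_n) k : R := \sum_i ((j.1 (i, k))%:R - lam).
Let totc (j : arrivals * 'S_n) : R := \sum_u ((j.1 u)%:R - lam).

Let inj_row (i : 'I_n) : injective (fun k : 'I_n => (i, k)). Proof. by move=> a b []. Qed.
Let inj_col (k : 'I_n) : injective (fun i : 'I_n => (i, k)). Proof. by move=> a b []. Qed.

Definition row_sum (q : state) i : R := \sum_k (q i k)%:R.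
Definition col_sum (q : state) k : R := \sum_i (q i k)%:R.

(** The squared norm of the orthogonal projection of [q] onto the space of the
    matrices [w i + w' j]. *)
Definition sqproj (q : state) : R :=
  (\sum_i row_sum q i ^+ 2) / n%:R + (\sum_k col_sum q k ^+ 2) / n%:R
  - total q ^+ 2 / n%:R ^+ 2.

Let rowu q j i : R := \sum_k unused q j i k.
Let colu q j k : R := \sum_i unused q j i k.
Let totu q j : R := \sum_i \sum_k unused q j i k.

Definition mean_unused (q : state) : R := step_mean q (totu q).

Let n_neq0 : n%:R != 0 :> R. Proof. by rewrite gt_eqF. Qed.

Let nextR q j i k : (queue_nxt q j i k)%:R =
  (q i k)%:R + ((j.1 (i, k))%:R - lam) + lam - srv j i k + unused q j i k :> R.
Proof. by rewrite -realmxE next_entry /arr; ring. Qed.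

Let sum_lam : \sum_(k < n) lam = 1 - e.
Proof. by rewrite sumr_const card_ord -(mulr_natr lam) divfK. Qed.

Let row_sum_next q j i :
  row_sum (queue_nxt q j) i = row_sum q i + (rowc j i - e) + rowu q j i.
Proof.
rewrite /row_sum /rowc /rowu; under eq_bigr do rewrite nextR.
by rewrite big_split /= sumrB srv_row big_split /= big_split /= sum_lam; ring.
Qed.

Let col_sum_next q j k :
  col_sum (queue_nxt q j) k = col_sum q k + (colc j k - e) + colu q j k.
Proof.
rewrite /col_sum /colc /colu; under eq_bigr do rewrite nextR.
by rewrite big_split /= sumrB srv_col big_split /= big_split /= sum_lam; ring.
Qed.

Let total_next q j :
  total (queue_nxt q j) = total q + (totc j - n%:R * e) + totu q j.
Proof.
have -> : total (queue_nxt q j) = \sum_i row_sum (queue_nxt q j) i by [].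
under eq_bigr do rewrite row_sum_next.
rewrite big_split /= big_split /= sumrB sumr_const card_ord mulr_natl.
congr (_ + (_ - _) + _).
rewrite /rowc /totc (pair_bigA _ (fun i k => (j.1 (i, k))%:R - lam)) /=.
by apply: eq_bigr => -[].
Qed.

Lemma total_step q : P total q = total q - n%:R * e + mean_unused q.
Proof.
rewrite (avg_step_mean total); under eq_step_mean do rewrite total_next.
rewrite step_meanD step_meanD step_mean_cst; congr (_ + _ + _); apply: step_mean_shift.
exact: (centered_sum_mean q id).
Qed.

Let unused_sqr_le (I : finType) (x : I -> R) : (forall i, 0 <= x i <= 1) ->
  0 <= \sum_i x i ^+ 2 <= \sum_i x i.
Proof.
move=> x01; apply/andP; split; first by apply: sumr_ge0 => i _; exact: sqr_ge0.
by apply: ler_sum => i _; have /andP[x0 x1] := x01 i; rewrite expr2 ler_piMr.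
Qed.

Let rowu01 q j i : 0 <= rowu q j i <= 1.
Proof.
rewrite sumr_ge0; last by move=> k _; exact: unused_ge0.
by rewrite -(srv_row j i); apply: ler_sum => k _; exact: unused_le_srv.
Qed.

Let colu01 q j k : 0 <= colu q j k <= 1.
Proof.
rewrite sumr_ge0; last by move=> i _; exact: unused_ge0.
by rewrite -(srv_col j k); apply: ler_sum => i _; exact: unused_le_srv.
Qed.

Let totu_ge0 q j : 0 <= totu q j.
Proof. by apply: sumr_ge0 => i _; have /andP[] := rowu01 q j i. Qed.

Let totu_le q j : totu q j <= n%:R.
Proof.
apply: (@le_trans _ _ (\sum_(i < n) 1)); last by rewrite sumr_const card_ord.
by apply: ler_sum => i _; have /andP[] := rowu01 q j i.
Qed.

Lemma mean_unused_ge0 q : 0 <= mean_unused q.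
Proof. by rewrite -(step_mean_cst q 0); apply: step_mean_le => j. Qed.

Lemma mean_unused_le q : mean_unused q <= n%:R.
Proof. by rewrite -[leRHS](step_mean_cst q); apply: step_mean_le => j; exact: totu_le. Qed.

(** The entries of the orthogonal projection onto the space of the matrices
    [w i + w' j]. *)
Let prj (x : 'I_n -> 'I_n -> R) i k : R :=
  (\sum_l x i l + \sum_l x l k) / n%:R - (\sum_a \sum_b x a b) / n%:R ^+ 2.

Let prjB x y i k : prj (fun a b => x a b - y a b) i k = prj x i k - prj y i k.
Proof.
have e1 : \sum_a \sum_b (x a b - y a b) = \sum_a \sum_b x a b - \sum_a \sum_b y a b.
  by rewrite -sumrB; apply: eq_bigr => a _; rewrite sumrB.
by rewrite /prj e1 !sumrB; ring.
Qed.

Let prj_additive (w w' : 'I_n -> R) i k : prj (fun a b => w a + w' b) i k = w i + w' k.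
Proof.
have e1 : \sum_(a < n) \sum_(b < n) (w a + w' b) = n%:R * \sum_a w a + n%:R * \sum_b w' b.
  rewrite mulr_sumr; under eq_bigr do rewrite big_split /= sumr_const card_ord -mulr_natl.
  by rewrite big_split /= sumr_const card_ord -(mulr_natl (\sum_b w' b)).
have e2 : \sum_(b < n) (w i + w' b) = n%:R * w i + \sum_b w' b.
  by rewrite big_split /= sumr_const card_ord mulr_natl.
have e3 : \sum_(a < n) (w a + w' k) = \sum_a w a + n%:R * w' k.
  by rewrite big_split /= sumr_const card_ord mulr_natl.
by rewrite /prj e1 e2 e3; field.
Qed.

Let prj_bound x v i k : (forall a b, `|x a b| <= v) -> `|prj x i k| <= 3 * v.
Proof.
move=> xv; have s1 (f : 'I_n -> R) c0 : (forall a, `|f a| <= c0) -> `|\sum_a f a| <= n%:R * c0.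
  move=> fc; apply: (le_trans (ler_norm_sum _ _ _)).
  apply: (@le_trans _ _ (\sum_(a < n) c0)); last by rewrite sumr_const card_ord mulr_natl.
  by apply: ler_sum => a _; exact: fc.
have h1 := s1 _ _ (xv i); have h2 := s1 (x^~ k) v (fun a => xv a k).
have h3 := s1 (fun a => \sum_b x a b) (n%:R * v) (fun a => s1 _ _ (xv a)).
apply: (le_trans (ler_normB _ _)); rewrite !normrM normfV normfV normrX (ger0_norm (ler0n R n)).
have -> : 3 * v = (n%:R * v + n%:R * v) / n%:R + (n%:R * (n%:R * v)) / n%:R ^+ 2 by field.
rewrite lerD //; first by rewrite ler_pM2r ?invr_gt0 // (le_trans (ler_normD _ _)) // lerD.
by rewrite ler_pM2r // invr_gt0 exprn_gt0.
Qed.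

(** The contributions of the unused service to the increment of [sqproj]: the
    increment contains [2 * Bu - Wu]. *)
Let Bu q j : R := (\sum_i row_sum (queue_nxt q j) i * rowu q j i) / n%:R
  + (\sum_k col_sum (queue_nxt q j) k * colu q j k) / n%:R
  - total (queue_nxt q j) * totu q j / n%:R ^+ 2.

Let Wu q j : R := (\sum_i rowu q j i ^+ 2) / n%:R + (\sum_k colu q j k ^+ 2) / n%:R
  - totu q j ^+ 2 / n%:R ^+ 2.

(** The unused service sits where the next queue is empty, so that it only
    meets the component of the next queue orthogonal to the projection. *)
Let BuE q j : Bu q j = - \sum_i \sum_k unused q j i k *
  ((queue_nxt q j i k)%:R - prj (fun a b => (queue_nxt q j a b)%:R) i k).
Proof.
have -> : Bu q j = \sum_i \sum_k unused q j i k * prj (fun a b => (queue_nxt q j a b)%:R) i k.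
  rewrite /Bu /prj -/(total (queue_nxt q j)).
  have -> : \sum_i row_sum (queue_nxt q j) i * rowu q j i
      = \sum_i \sum_k unused q j i k * row_sum (queue_nxt q j) i.
    by apply: eq_bigr => i _; rewrite mulrC mulr_suml.
  have -> : \sum_k col_sum (queue_nxt q j) k * colu q j k
      = \sum_i \sum_k unused q j i k * col_sum (queue_nxt q j) k.
    by rewrite exchange_big; apply: eq_bigr => i _; rewrite mulrC mulr_suml.
  rewrite /row_sum /col_sum; move: (total (queue_nxt q j)) => T.
  rewrite -mulrA mulrCA /totu !mulr_suml -sumrN -!big_split /=; apply: eq_bigr => i _.
  by rewrite !mulr_suml -sumrN -!big_split /=; apply: eq_bigr => k _; ring.
rewrite -sumrN; apply: eq_bigr => i _; rewrite -sumrN; apply: eq_bigr => k _.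
have h0 : unused q j i k * (queue_nxt q j i k)%:R = 0.
  by rewrite -(unused_next q j i k) realmxE.
by move: (prj _ i k) => t; rewrite mulrBr h0 sub0r opprK.
Qed.

(** For [y] the projection on the cone, the linear projection fixes [y], so
    that the component of the next queue orthogonal to the linear space is
    bounded by its distance to the cone. *)
Let Bu_bound q j : `|Bu q j| <= 4 * (perp_norm (queue_nxt q j) * totu q j).
Proof.
have [[[w [w' yE]] _] _] := projKP (realmx (queue_nxt q j)).
set y := Defs.projK _ in yE; set v := perp_norm _.
pose x a b : R := (queue_nxt q j a b)%:R.
have xv a b : `|x a b - (w a + w' b)| <= v.
  by apply: le_trans (entry_le_frob (perpK (realmx (queue_nxt q j))) a b); rewrite subE realmxE -/y yE.
have key i k : `|x i k - prj x i k| <= 4 * v.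
  have -> : x i k - prj x i k = (x i k - (w i + w' k)) - prj (fun a b => x a b - (w a + w' b)) i k.
    by rewrite prjB prj_additive; ring.
  apply: (le_trans (ler_normB _ _)).
  have -> : 4 * v = v + 3 * v by ring.
  by rewrite lerD //; exact: prj_bound.
rewrite BuE normrN mulrA mulrC /totu mulr_suml.
apply: (le_trans (ler_norm_sum _ _ _)); apply: ler_sum => i _; rewrite mulr_suml.
apply: (le_trans (ler_norm_sum _ _ _)); apply: ler_sum => k _.
by rewrite normrM (ger0_norm (unused_ge0 _ _ _ _)) ler_wpM2l ?unused_ge0 //; exact: key.
Qed.

Let Wu_bound q j : `|Wu q j| <= 2 * totu q j.
Proof.
have /andP[r0 r1] := unused_sqr_le (rowu01 q j).
have /andP[c0 c1] := unused_sqr_le (colu01 q j).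
have colE : \sum_k colu q j k = totu q j by rewrite /totu exchange_big.
have t0 := totu_ge0 q j; have tn := totu_le q j.
have nV : 0 < (n%:R : R)^-1 <= 1 by rewrite invr_gt0 n_gt0 /= invf_le1 // ler1n.
have /andP[v0 v1] := nV.
rewrite /Wu -exprVn.
have b1 : 0 <= (\sum_i rowu q j i ^+ 2) / n%:R <= totu q j.
  by rewrite divr_ge0 //= ?(le_trans _ r1) // ler_piMr.
have b2 : 0 <= (\sum_k colu q j k ^+ 2) / n%:R <= totu q j.
  by rewrite divr_ge0 //= -colE (le_trans _ c1) // ler_piMr.
have b3 : 0 <= totu q j ^+ 2 * n%:R^-1 ^+ 2 <= totu q j.
  rewrite mulr_ge0 ?sqr_ge0 //= expr2 -mulrA ler_piMr // expr2 mulrA mulr_ile1 //.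
  - by rewrite mulr_ge0 // ltW.
  - by rewrite ler_pdivrMr // mul1r.
exact: lin_norm b1 b2 b3.
Qed.

Let sqproj_next q j : sqproj (queue_nxt q j) = sqproj q
  + (2 / n%:R) * (\sum_i row_sum q i * (rowc j i - e) + \sum_k col_sum q k * (colc j k - e))
  - (2 / n%:R ^+ 2) * total q * (totc j - n%:R * e)
  + (\sum_i (rowc j i - e) ^+ 2 + \sum_k (colc j k - e) ^+ 2) / n%:R
  - (totc j - n%:R * e) ^+ 2 / n%:R ^+ 2
  + (2 * Bu q j - Wu q j).
Proof.
have sq (r a u r' : R) : r' = r + a + u -> r' ^+ 2 = r ^+ 2 + 2 * (r * a) + a ^+ 2 + (2 * (r' * u) - u ^+ 2).
  by move=> ->; ring.
rewrite /sqproj (sq _ _ _ _ (total_next q j)).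
under eq_bigr do rewrite (sq _ _ _ _ (row_sum_next q j _)).
under [X in _ + X / _ - _]eq_bigr do rewrite (sq _ _ _ _ (col_sum_next q j _)).
rewrite !big_split /= !sumrN -!mulr_sumr /Bu /Wu; ring.
Qed.

Definition sqproj_drift : R := (2 / n%:R - 1 / n%:R ^+ 2) * \sum_u var u + e ^+ 2.

Let step_mean_quad q : step_mean q (fun j =>
    (\sum_i (rowc j i - e) ^+ 2 + \sum_k (colc j k - e) ^+ 2) / n%:R
    - (totc j - n%:R * e) ^+ 2 / n%:R ^+ 2) = sqproj_drift.
Proof.
have rE i : step_mean q (fun j => (rowc j i - e) ^+ 2) = \sum_k var (i, k) + e ^+ 2.
  by apply: step_mean_shift_sqr; [exact: centered_sum_mean|exact: centered_sum_sqr (@inj_row i)].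
have cE k : step_mean q (fun j => (colc j k - e) ^+ 2) = \sum_i var (i, k) + e ^+ 2.
  apply: step_mean_shift_sqr; first exact: (centered_sum_mean q (fun i => (i, k))).
  exact: (centered_sum_sqr q (@inj_col k)).
have tE : step_mean q (fun j => (totc j - n%:R * e) ^+ 2) = \sum_u var u + (n%:R * e) ^+ 2.
  by apply: step_mean_shift_sqr; [exact: (centered_sum_mean q id)|exact: (centered_sum_sqr q (@inj_id _))].
have sumC (x : R) : \sum_(i < n) x = n%:R * x by rewrite sumr_const card_ord mulr_natl.
have rS : \sum_i step_mean q (fun j => (rowc j i - e) ^+ 2) = \sum_u var u + n%:R * e ^+ 2.
  under eq_bigr do rewrite rE.
  rewrite big_split /= sumC (pair_bigA _ (fun i k => var (i, k))) /=.
  by congr (_ + _); apply: eq_bigr => -[].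
have cS : \sum_k step_mean q (fun j => (colc j k - e) ^+ 2) = \sum_u var u + n%:R * e ^+ 2.
  under eq_bigr do rewrite cE.
  rewrite big_split /= sumC exchange_big (pair_bigA _ (fun i k => var (i, k))) /=.
  by congr (_ + _); apply: eq_bigr => -[].
rewrite (@eq_step_mean q _ (fun j => n%:R^-1 * (\sum_i (rowc j i - e) ^+ 2 + \sum_k (colc j k - e) ^+ 2)
    - n%:R ^- 2 * (totc j - n%:R * e) ^+ 2)); last first.
  by move=> j; rewrite mulrC [X in _ - X]mulrC.
rewrite step_meanB !step_meanZ step_meanD !step_mean_sum rS cS tE /sqproj_drift.
by move: (\sum_u var u) => s; field.
Qed.

Let step_mean_lin q : step_mean q (fun j =>
    (2 / n%:R) * (\sum_i row_sum q i * (rowc j i - e) + \sum_k col_sum q k * (colc j k - e))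
    - (2 / n%:R ^+ 2) * total q * (totc j - n%:R * e)) = - (2 * (e / n%:R) * total q).
Proof.
have hT : step_mean q (fun j => totc j - n%:R * e) = - (n%:R * e).
  by apply: step_mean_shift; exact: (centered_sum_mean q id).
have hr i : step_mean q (fun j => rowc j i - e) = - e.
  by apply: step_mean_shift; exact: (centered_sum_mean q (fun k => (i, k))).
have hc k : step_mean q (fun j => colc j k - e) = - e.
  by apply: step_mean_shift; exact: (centered_sum_mean q (fun i => (i, k))).
rewrite step_meanB !step_meanZ hT step_meanD !step_mean_sum.
rewrite (eq_bigr (fun i => - e * row_sum q i)); last first.
  by move=> i _; rewrite step_meanZ hr mulrC.
rewrite [X in _ * (_ + X)](eq_bigr (fun k => - e * col_sum q k)); last first.
  by move=> k _; rewrite step_meanZ hc mulrC.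
rewrite -!mulr_sumr.
have -> : \sum_i row_sum q i = total q by [].
have -> : \sum_k col_sum q k = total q by rewrite /col_sum exchange_big.
by move: (total q) => t; field.
Qed.

(** The drift of the squared projected norm is
    [- 2 * (e / n) * total q + sqproj_drift] up to the effect of the unused
    service, split here by the parameter [eta] into a small multiple of the
    squared distance to the cone and a multiple of the mean unused service. *)
Lemma sqproj_step q eta : 0 < eta ->
  `|P sqproj q - sqproj q + 2 * (e / n%:R) * total q - sqproj_drift| <=
  4 * eta * P (fun x => perp_norm x ^+ 2) q + (4 * n%:R / eta + 2) * mean_unused q.
Proof.
move=> eta0.
have -> : P sqproj q - sqproj q + 2 * (e / n%:R) * total q - sqproj_drift
    = step_mean q (fun j => 2 * Bu q j - Wu q j).
  have -> : P sqproj q = step_mean q (fun j => sqproj q + ((2 / n%:R) *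
      (\sum_i row_sum q i * (rowc j i - e) + \sum_k col_sum q k * (colc j k - e))
      - (2 / n%:R ^+ 2) * total q * (totc j - n%:R * e))
      + ((\sum_i (rowc j i - e) ^+ 2 + \sum_k (colc j k - e) ^+ 2) / n%:R
      - (totc j - n%:R * e) ^+ 2 / n%:R ^+ 2) + (2 * Bu q j - Wu q j)).
    by apply: eq_step_mean => j; rewrite sqproj_next !addrA.
  by rewrite step_meanD (step_meanD q _ (fun j => (_ + _) / _ - _)) step_meanD step_mean_cst step_mean_lin step_mean_quad; ring.
have bnd j : `|2 * Bu q j - Wu q j| <= 4 * eta * perp_norm (queue_nxt q j) ^+ 2
    + (4 * n%:R / eta + 2) * totu q j.
  apply: (le_trans (ler_normB _ _)); rewrite normrM (ger0_norm (ler0n R 2)).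
  have h1 := Bu_bound q j; have h2 := Wu_bound q j.
  have h3 := young_unused (perp_norm (queue_nxt q j)) eta0 (totu_ge0 q j) (totu_le q j).
  by rewrite (mulrDl (4 * n%:R / eta)); exact: lin_unused h1 h2 h3.
have -> : 4 * eta * P (fun x => perp_norm x ^+ 2) q + (4 * n%:R / eta + 2) * mean_unused q
   = step_mean q (fun j => 4 * eta * perp_norm (queue_nxt q j) ^+ 2 + (4 * n%:R / eta + 2) * totu q j).
  by rewrite step_meanD !step_meanZ.
rewrite ler_norml -[- step_mean _ _]mulN1r -step_meanZ; apply/andP; split; apply: step_mean_le => j.
  by have := bnd j; rewrite ler_norml mulN1r => /andP[].
exact: le_trans (ler_norm _) (bnd j).
Qed.

End Queue_kernel.

(** * The stationary functional of the queue length kernel *)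

Section Queue_stationary.
Context {R : realType} {n' amax : nat}.
Local Notation n := n'.+1.
Local Notation state := 'M[nat]_n.
Variable m : 'I_n * 'I_n -> 'I_amax.+1 -> R.
Variable mu : schedule_law R n.
Hypothesis m_ge0 : forall u k, 0 <= m u k.
Hypothesis m_sum1 : forall u, \sum_k m u k = 1.
Hypothesis m_zero : forall u, 0 < m u ord0.
Hypothesis mu_prob : forall q, prob (mu q).
Variables (e c : R).
Hypothesis e01 : 0 < e < 1.
Hypothesis c_gt0 : 0 < c.
Hypothesis m_mean : forall u, \sum_k m u k * k%:R = (1 - e) / n%:R.
Hypothesis mu_gap : forall q i k j l,
  total q / n%:R + c * `|second_diff q i k j l| <= mean_weight (mu q) q.

Local Notation P := (avg (queue_wt m mu) queue_nxt).
Local Notation Pt t f := (iter t (avg (queue_wt m mu) queue_nxt) f).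
Local Notation x0 := (@empty_queue n').
Definition jump : R := n%:R * amax.+1%:R.

Let n_gt0 : 0 < n%:R :> R. Proof. by rewrite ltr0n. Qed.
Let jump_gt0 : 0 < jump. Proof. by rewrite mulr_gt0 // ltr0n. Qed.
Let en_gt0 : 0 < e / n%:R. Proof. by case/andP: e01 => ? _; rewrite divr_gt0. Qed.

Let wt0 := queue_wt_ge0 m_ge0 mu_prob.
Let wt1 := queue_wt_sum1 m_sum1 mu_prob.

(** The exponent depends on [e]: this function serves to establish convergence
    for a fixed [e]; bounds uniform in [e] come from [perp_norm]. *)
Definition lyap (q : state) : R := expR (drift_rate (e / n%:R) jump * frob (realmx q)).
Local Notation V := lyap.
Local Notation th := (drift_rate (e / n%:R) jump).

Let th_gt0 : 0 < th. Proof. exact: drift_rate_gt0. Qed.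

Lemma lyap_ge1 q : 1 <= V q.
Proof.
by apply: le_trans (expR_ge1Dx _); rewrite lerDl mulr_ge0 ?frob_ge0 // ltW.
Qed.

Let ga01 := drift_factor01 en_gt0 jump_gt0.
Let K_ge0 := drift_const_ge0 (jump ^+ 2) en_gt0 jump_gt0.

Lemma lyap_drift q : P V q <= drift_factor (e / n%:R) jump * V q
  + drift_const (e / n%:R) (jump ^+ 2) jump.
Proof.
apply: exp_drift_rate => //; first exact: sqr_ge0.
- by move=> x; exact: frob_ge0.
- by move=> x j; exact: frob_jump.
- by move=> x; exact: (frob_drift m_ge0 m_sum1 mu_prob e01 c_gt0 m_mean mu_gap).
Qed.

Lemma total_le_frob (q : state) : total q <= n%:R ^+ 2 * frob (realmx q) :> R.
Proof.
apply: (@le_trans _ _ (\sum_(i < n) \sum_(k < n) frob (realmx q))).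
  apply: ler_sum => i _; apply: ler_sum => k _.
  by rewrite -realmxE; apply: le_trans (ler_norm _) (entry_le_frob _ _ _).
by rewrite !sumr_const !card_ord -mulrnA mulnn -natrX mulr_natl.
Qed.

Lemma lyap_totn r : exists N : nat, forall q, V q <= r -> (totn q <= N)%N.
Proof.
pose b := `|n%:R ^+ 2 * (r / th)|; exists (Num.bound b) => q Vr.
rewrite -(ler_nat R) -totalE; apply: (le_trans (total_le_frob q)).
apply: le_trans (ltW (archi_boundP (normr_ge0 _))).
apply: le_trans (ler_norm _); rewrite ler_pM2l ?exprn_gt0 // ler_pdivlMr // mulrC.
apply: le_trans Vr; apply: le_trans (expR_ge1Dx _); by rewrite lerDr.
Qed.

Lemma lyap_reach r : exists (N : nat) (al : R),
  0 < al /\ forall x, V x <= r -> al <= Pt N.+1 (ind [set x0]) x.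
Proof.
have [N hN] := lyap_totn r; exists N, (reach_prob m ^+ N.+1).
split; first by rewrite exprn_gt0 // reach_prob_gt0.
move=> x /hN xN; apply: (reach_empty m_ge0 m_sum1 mu_prob c_gt0 mu_gap m_zero).
exact: leq_trans xN (leqnSn N).
Qed.

Definition stationary (f : state -> R) : R := stat (queue_wt m mu) queue_nxt x0 f.
Local Notation L := stationary.
Local Notation dom := (dominated lyap).

Lemma stationary_cvg f x : dom f -> Pt t f x @[t --> \oo] --> L f.
Proof. exact: (avgn_cvg wt0 wt1 lyap_ge1 ga01 K_ge0 lyap_drift lyap_reach). Qed.

Lemma stationaryD f g : dom f -> dom g -> L (fun x => f x + g x) = L f + L g.
Proof. exact: (statD wt0 wt1 lyap_ge1 ga01 K_ge0 lyap_drift lyap_reach). Qed.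

Lemma stationaryZ k f : dom f -> L (fun x => k * f x) = k * L f.
Proof. exact: (statZ wt0 wt1 lyap_ge1 ga01 K_ge0 lyap_drift lyap_reach). Qed.

Lemma stationaryB f g : dom f -> dom g -> L (fun x => f x - g x) = L f - L g.
Proof. exact: (statB wt0 wt1 lyap_ge1 ga01 K_ge0 lyap_drift lyap_reach). Qed.

Lemma stationary_cst k : L (fun=> k) = k.
Proof. exact: stat_cst. Qed.

Lemma stationary_le f g : dom f -> dom g -> (forall x, f x <= g x) -> L f <= L g.
Proof. exact: (stat_le wt0 wt1 lyap_ge1 ga01 K_ge0 lyap_drift lyap_reach). Qed.

Lemma stationary_ge0 f : dom f -> (forall x, 0 <= f x) -> 0 <= L f.
Proof. exact: (stat_ge0 wt0 wt1 lyap_ge1 ga01 K_ge0 lyap_drift lyap_reach). Qed.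

Lemma stationary_le_of f C : dom f -> (forall t, Pt t f x0 <= C) -> L f <= C.
Proof. exact: (stat_le_of wt0 wt1 lyap_ge1 ga01 K_ge0 lyap_drift lyap_reach). Qed.

Lemma stationary_norm_le f g : dom g -> (forall x, `|f x| <= g x) -> `|L f| <= L g.
Proof. exact: (stat_norm_le wt0 wt1 lyap_ge1 ga01 K_ge0 lyap_drift lyap_reach). Qed.

Lemma stationary_avg f : dom f -> L (P f) = L f.
Proof. exact: (stat_avg wt0 wt1 lyap_ge1 ga01 K_ge0 lyap_drift lyap_reach). Qed.

Lemma dom_avg f : dom f -> dom (P f).
Proof. exact: (dominated_avg wt0 wt1 x0 lyap_ge1 ga01 K_ge0 lyap_drift). Qed.

Lemma stationary_avgn k f : dom f -> L (Pt k f) = L f.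
Proof.
elim: k f => [//|k IH] f df; rewrite iterSr IH; first exact: stationary_avg.
exact: dom_avg.
Qed.

Lemma dom_frob r : dom (fun q => frob (realmx q) ^+ r).
Proof.
exists ((r.+1%:R / th) ^+ r) => q; rewrite ger0_norm ?exprn_ge0 ?frob_ge0 //.
by apply: pow_le_expR; [exact: th_gt0|exact: frob_ge0].
Qed.

Lemma dom_perp r : dom (fun q => perp_norm q ^+ r).
Proof.
apply: (dominated_le _ (dom_frob r)) => q.
rewrite ger0_norm ?exprn_ge0 ?perp_norm_ge0 // lerXn2r ?nnegrE ?perp_norm_ge0 ?frob_ge0 //.
exact: perp_norm_le_frob.
Qed.

Lemma dom_total r : dom (fun q => total q ^+ r).
Proof.
apply: (dominated_le _ (dominatedZ ((n%:R ^+ 2) ^+ r) (dom_frob r))) => q.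
rewrite ger0_norm ?exprn_ge0 ?total_ge0 // -exprMn.
by rewrite lerXn2r ?nnegrE ?total_ge0 ?mulr_ge0 ?exprn_ge0 ?frob_ge0 // total_le_frob.
Qed.

Lemma dom_bounded f M : (forall x, `|f x| <= M) -> dom f.
Proof. by move=> fM; exact: (bounded_dominated lyap_ge1 fM). Qed.

Lemma dom_ind A : dom (ind A).
Proof. by apply: (@dom_bounded _ 1) => x; rewrite ger0_norm ?ind_ge0 ?ind_le1. Qed.

Lemma dom_sqproj : dom (@sqproj R n').
Proof.
apply: (dominated_le _ (dominatedZ 2 (dom_total 2))) => q.
have T0 : 0 <= total q :> R by exact: total_ge0.
have nV : 0 <= (n%:R : R)^-1 <= 1 by rewrite invr_ge0 ler0n /= invf_le1 // ler1n.
have /andP[v0 v1] := nV.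
have sq (I : finType) (f : I -> R) : (forall i, 0 <= f i) -> \sum_i f i = total q ->
    0 <= (\sum_i f i ^+ 2) / n%:R <= total q ^+ 2.
  move=> f0 fT; have s0 : 0 <= \sum_i f i ^+ 2 by apply: sumr_ge0 => i _; exact: sqr_ge0.
  rewrite divr_ge0 //=; apply: (@le_trans _ _ (\sum_i f i ^+ 2)); first exact: ler_piMr.
  rewrite expr2 -{1}fT mulr_suml; apply: ler_sum => i _; rewrite expr2 ler_wpM2l //.
  by rewrite -fT (bigD1 i) //= lerDl sumr_ge0.
apply: lin_norm.
- by apply: sq => // i; apply: sumr_ge0.
- by apply: sq; [move=> k; apply: sumr_ge0|rewrite /col_sum exchange_big].
- rewrite -exprVn mulr_ge0 ?exprn_ge0 //= ler_piMr ?exprn_ge0 //.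
  by rewrite expr_le1.
Qed.

Lemma dom_unused : dom (mean_unused m mu).
Proof.
apply: (@dom_bounded _ n%:R) => q.
by rewrite ger0_norm ?(mean_unused_ge0 m_ge0 m_sum1 mu_prob) // (mean_unused_le m_ge0 m_sum1 mu_prob).
Qed.

Lemma dom_total1 : dom (@total R n).
Proof. exact: dom_total 1. Qed.

(** In the stationary regime the mean total queue is constant, so that the
    unused service balances the spare capacity [n * e]. *)
Lemma stationary_unused : L (mean_unused m mu) = n%:R * e.
Proof.
have := stationary_avg dom_total1.
rewrite (_ : P (@total R n) = (fun q => (total q - n%:R * e) + mean_unused m mu q)); last first.
  by apply/funext => q; exact: (total_step m_sum1 mu_prob m_mean).
rewrite stationaryD ?stationaryB ?stationary_cst; first by move=> h; lra.
- exact: dom_total1.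
- exact: dominated_cst lyap_ge1 _.
- exact: dominatedB dom_total1 (dominated_cst lyap_ge1 _).
- exact: dom_unused.
Qed.

(** Stationarity of the squared projected norm turns the one-step identity
    into a formula for the mean total queue. *)
Lemma stationary_total eta : 0 < eta ->
  `|2 * (e / n%:R) * L total - sqproj_drift m e| <=
  4 * eta * L (fun x => perp_norm x ^+ 2) + (4 * n%:R / eta + 2) * (n%:R * e).
Proof.
move=> eta0.
have d1 := dom_avg dom_sqproj; have d2 := dom_sqproj; have d3 := dom_total1.
have d4 := dom_avg (dom_perp 2); have d5 := dom_unused.
have d6 := dominatedB d1 d2; have d7 := dominatedZ (2 * (e / n%:R)) d3.
have d8 := dominatedD d6 d7; have d9 := dominated_cst lyap_ge1 (sqproj_drift m e).
have -> : 2 * (e / n%:R) * L total - sqproj_drift m e = L (fun q =>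
    (P (@sqproj R n') q - sqproj q + 2 * (e / n%:R) * total q) - sqproj_drift m e).
  rewrite stationaryB // stationaryD // stationaryB // stationary_avg // subrr add0r.
  by rewrite stationaryZ // stationary_cst.
rewrite -(stationary_avg (dom_perp 2)) -stationary_unused -(stationaryZ _ d4) -(stationaryZ _ d5).
rewrite -stationaryD; try exact: dominatedZ.
apply: stationary_norm_le; first by apply: dominatedD; exact: dominatedZ.
by move=> q; exact: (sqproj_step m_ge0 m_sum1 mu_prob m_mean q eta0).
Qed.

(** The error is at most [f q ^+ 2 / k]. *)
Lemma stationary_truncation f : dom f -> dom (fun q => f q ^+ 2) -> (forall q, 0 <= f q) ->
  L (fun q => Num.min (f q) k%:R) @[k --> \oo] --> L f.
Proof.
move=> df df2 f0.
have dm k : dom (fun q => Num.min (f q) k%:R).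
  by apply: (@dom_bounded _ k%:R) => q; rewrite ger0_norm ?le_min ?f0 //= ge_min lexx orbT.
rewrite -(cvg_shiftS (fun k => L (fun q => Num.min (f q) k%:R))).
apply: (@squeeze_cvgr _ _ _ _ (fun k => L f - L (fun q => f q ^+ 2) * harmonic k) (fun=> L f)).
- near=> k; apply/andP; split; last first.
    by apply: stationary_le => // q; rewrite ge_min lexx.
  rewrite lerBlDr -lerBlDl -stationaryB // mulrC -stationaryZ //.
  apply: stationary_le; [exact: dominatedB|exact: dominatedZ|move=> q].
  have k0 : 0 < (k.+1%:R : R) by rewrite ltr0n.
  rewrite /= mulrC ler_pdivlMr //; have [le|lt] := leP (f q) k.+1%:R.
    by rewrite subrr mul0r sqr_ge0.
  apply: (@le_trans _ _ (f q * k.+1%:R)); last by rewrite expr2 ler_wpM2l // ltW.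
  by rewrite ler_wpM2r ?ler0n // gerBl ler0n.
- rewrite -[X in _ --> X]subr0 -[X in _ --> _ - X](mulr0 (L (fun q => f q ^+ 2))).
  apply: cvgB; first exact: cvg_cst.
  by apply: cvgM; [exact: cvg_cst|exact: cvg_harmonic].
- exact: cvg_cst.
Unshelve. all: by end_near. Qed.

(** The Markov inequality for [lyap], whose sublevel sets are finite. *)
Lemma stationary_tight (d : R) : 0 < d ->
  exists k, L (ind [set x | (k <= pickle x)%N]) <= d.
Proof.
move=> d0; have LV0 : 0 <= L V.
  by apply: stationary_ge0 => [|x]; [exact: dominatedV lyap_ge1|exact: expR_ge0].
pose r := (L V + 1) / d; have r0 : 0 < r by rewrite divr_gt0 // ltr_wpDl.
have [N hN] := lyap_totn r.
pose k := (\max_(b : {ffun 'I_n * 'I_n -> 'I_N.+1}) pickle (arrival_mx b : state)).+1.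
exists k; apply: (@le_trans _ _ (L (fun x => r^-1 * V x))); last first.
  rewrite stationaryZ; last exact: dominatedV lyap_ge1.
  by rewrite mulrC ler_pdivrMr // /r mulrCA mulfV ?gt_eqF // mulr1 lerDl.
apply: stationary_le; first exact: dom_ind.
  by apply: dominatedZ; exact: dominatedV lyap_ge1.
move=> x; rewrite /ind; case: asboolP => /= [kx|_]; last by rewrite mulr_ge0 ?invr_ge0 ?expR_ge0 // ltW.
rewrite mulrC ler_pdivlMr // mul1r leNgt; apply/negP => Vr.
have xN := hN _ (ltW Vr).
have xi i j : (x i j <= N)%N.
  by apply: leq_trans xN; rewrite /totn (bigD1 i) //= (bigD1 j) //= -addnA leq_addr.
pose b : {ffun 'I_n * 'I_n -> 'I_N.+1} := [ffun u => inord (x u.1 u.2)].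
have xE : x = arrival_mx b.
  by apply/matrixP => i j; rewrite mxE ffunE inordK // ltnS.
have lt : (pickle (arrival_mx b : state) < k)%N.
  by rewrite ltnS (leq_bigmax (F := fun b => pickle (arrival_mx b : state))).
by have := leq_trans lt kx; rewrite -xE ltnn.
Qed.

(** By the Markov inequality [lyap] stays below [r] with probability at least
    one half, and from there the empty queue is reached, then [y]. *)
Lemma stationary_gt0 y : (exists k, 0 < Pt k (ind [set y]) x0) -> 0 < L (ind [set y]).
Proof.
move=> [k hk].
have dV := dominatedV lyap_ge1.
have LV1 : 1 <= L V.
  rewrite -(stationary_cst 1); apply: stationary_le => //; first exact: dominated_cst lyap_ge1 _.
  exact: lyap_ge1.
pose r := 2 * L V; have r0 : 0 < r by rewrite mulr_gt0 // (lt_le_trans ltr01).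
have [N [al [al0 hal]]] := lyap_reach r.
have h0 : 0 < L (ind [set x0]).
  rewrite -(stationary_avgn N.+1 (dom_ind _)).
  apply: (@lt_le_trans _ _ (L (fun x => al * (1 - r^-1 * V x)))).
    have d1 : dom (fun x => r^-1 * V x) by exact: dominatedZ.
    have d2 : dom (fun=> 1) by exact: dominated_cst lyap_ge1 _.
    rewrite stationaryZ; last exact: dominatedB.
    rewrite stationaryB // stationary_cst stationaryZ // /r invfM mulrVK ?unitfE ?gt_eqF //.
      by rewrite mulr_gt0 //; lra.
    exact: lt_le_trans LV1.
  apply: stationary_le.
  - apply: dominatedZ; apply: dominatedB; first exact: dominated_cst lyap_ge1 _.
    exact: dominatedZ.
  - apply: (@dom_bounded _ 1) => x; apply: (le_trans (avgn_norm _ wt0 _ _ _)).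
    rewrite -[leRHS](avgn_cst queue_nxt wt1 N.+1 1 x); apply: avgn_le => // z.
    by rewrite ger0_norm ?ind_ge0 ?ind_le1.
  - move=> x; have [Vr|Vr] := leP (V x) r.
      apply: le_trans (hal x Vr); rewrite ler_piMr ?(ltW al0) // gerBl.
      by rewrite mulr_ge0 ?invr_ge0 ?expR_ge0 // ltW.
    apply: (@le_trans _ _ 0); last by apply: avgn_ge0 => // z; exact: ind_ge0.
    by rewrite pmulr_rle0 // subr_le0 mulrC ler_pdivlMr // mul1r ltW.
apply: (lt_le_trans (mulr_gt0 hk h0)).
rewrite -(stationaryZ _ (dom_ind _)) -(stationary_avgn k (dom_ind [set y])).
apply: stationary_le; first by apply: dominatedZ; exact: dom_ind.
  apply: (@dom_bounded _ 1) => x; apply: (le_trans (avgn_norm _ wt0 _ _ _)).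
  rewrite -[leRHS](avgn_cst queue_nxt wt1 k 1 x); apply: avgn_le => // z.
  by rewrite ger0_norm ?ind_ge0 ?ind_le1.
move=> x; rewrite {2}/ind; case: asboolP => [->|_]; first by rewrite mulr1.
by rewrite mulr0; apply: avgn_ge0 => // z; exact: ind_ge0.
Qed.

Definition perp_moment_const (r : nat) : R :=
  let c' := c / (4 * n%:R) in let th' := drift_rate c' jump in
  (r.+1%:R / th') ^+ r * (expR (th' * perp_norm x0)
     + drift_const c' (jump ^+ 2) jump / (1 - drift_factor c' jump)).

(** The bound depends on [n], [amax] and [c], but not on [e]. *)
Lemma stationary_perp r : e <= c / (4 * n%:R ^+ 2) ->
  L (fun x => perp_norm x ^+ r) <= perp_moment_const r.
Proof.
move=> ec; apply: stationary_le_of; first exact: dom_perp.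
move=> t; rewrite /perp_moment_const; set c' := c / _; set th' := drift_rate c' _.
have c'0 : 0 < c' by rewrite divr_gt0 // mulr_gt0.
have th'0 : 0 < th' by exact: drift_rate_gt0.
pose g (x : state) := expR (th' * perp_norm x).
have dr x : P g x <= drift_factor c' jump * g x + drift_const c' (jump ^+ 2) jump.
  apply: exp_drift_rate => //; first exact: sqr_ge0.
  - exact: perp_norm_ge0.
  - by move=> y j; exact: perp_norm_jump.
  - by move=> y; exact: (perp_norm_drift m_ge0 m_sum1 mu_prob e01 c_gt0 m_mean mu_gap).
have f01 := drift_factor01 c'0 jump_gt0; have K0 := drift_const_ge0 (jump ^+ 2) c'0 jump_gt0.
have /andP[f0 f1] := f01.
have k0 : 0 <= r.+1%:R / th' by rewrite divr_ge0 // ltW.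
apply: (@le_trans _ _ (Pt t (fun x => (r.+1%:R / th') ^+ r * g x) x0)).
  by apply: avgn_le => // x; apply: pow_le_expR => //; exact: perp_norm_ge0.
rewrite avgnZ ler_wpM2l ?exprn_ge0 //.
have KK : 0 <= drift_const c' (jump ^+ 2) jump / (1 - drift_factor c' jump).
  by rewrite divr_ge0 // subr_ge0 ltW.
case: t => [|t]; first by rewrite /= lerDl.
apply: (le_trans (avgn_drift wt0 wt1 f01 K0 (fun x => expR_ge0 _) dr t x0)).
by rewrite lerD2r ler_piMl ?expR_ge0 // ltW.
Qed.

End Queue_stationary.

(** * The switch as a realization of the kernel *)

Section Switch_kernel.
Context {R : realType} {n' amax : nat}.
Local Notation n := n'.+1.
Local Notation state := 'M[nat]_n.
Local Notation arrivals := {ffun 'I_n * 'I_n -> 'I_amax.+1}.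
Variable W : switch R n.
Variable mu : schedule_law R n.
Local Notation Pr := (sw_P W).
Hypothesis SA : switch_arrivals W amax.
Hypothesis SD : switch_dynamics W.
Hypothesis SS : scheduled_by W mu.
Hypothesis mu_prob : forall q, prob (mu q).

Definition marginal_law (u : 'I_n * 'I_n) (k : 'I_amax.+1) : R :=
  fine (Pr (arrival (W := W) u 0 @^-1` [set (k : nat)])).
Local Notation m := marginal_law.

Let q_rv t : discrete_rv (@sw_q _ _ W t). Proof. by case: SD. Qed.
Let s_rv t : discrete_rv (@sw_s _ _ W t). Proof. by case: SD. Qed.
Let a_rv t : discrete_rv (@sw_a _ _ W t). Proof. exact: (arr_meas SA). Qed.

Let arrival_rv u t : discrete_rv (arrival (W := W) u t).
Proof. exact: (discrete_rv_comp (fun a : state => a u.1 u.2) (a_rv t)). Qed.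

Let cell u t w : 'I_amax.+1 := inord (arrival (W := W) u t w).

Let cellE u t w : (cell u t w : nat) = arrival (W := W) u t w.
Proof. by rewrite inordK // ltnS; exact: (arr_bounded SA). Qed.

Let cell_rv u t : discrete_rv (cell u t).
Proof. exact: (discrete_rv_comp (fun k : nat => inord k : 'I_amax.+1) (arrival_rv u t)). Qed.

Let cell_preimage u t k : cell u t @^-1` [set k] = arrival (W := W) u t @^-1` [set (k : nat)].
Proof.
apply/seteqP; split => w /=; first by move=> <-; rewrite cellE.
by move=> h; apply/val_inj; rewrite /= cellE.
Qed.

Lemma marginal_lawE u t (k : 'I_amax.+1) :
  Pr (arrival (W := W) u t @^-1` [set (k : nat)]) = (m u k)%:E.
Proof.
by rewrite (arr_ident SA) /m fineK //; apply: fin_num_measure; exact: arrival_rv.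
Qed.

Lemma marginal_law_ge0 u k : 0 <= m u k.
Proof. exact: fine_ge0. Qed.

Lemma arrival_expectation u t (g : nat -> R) : (forall k, 0 <= g k) ->
  ('E_Pr[fun w => g (arrival (W := W) u t w)] = (\sum_k m u k * g k)%:E)%E.
Proof.
move=> g0; have -> : (fun w => g (arrival (W := W) u t w)) = (fun w => g (cell u t w)).
  by apply/funext => w; rewrite cellE.
rewrite (expectation_finite Pr (g := fun k : 'I_amax.+1 => g k) (cell_rv u t)) //.
rewrite -sumEFin; apply: eq_bigr => k _.
by rewrite cell_preimage marginal_lawE -EFinM mulrC.
Qed.

Lemma marginal_law_sum1 u : \sum_k m u k = 1.
Proof.
have := @arrival_expectation u 0%N (fun=> 1) (fun=> ler01).
rewrite (_ : (fun w => 1) = cst 1) // expectation_cst => -[h]; rewrite [RHS]h.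
by apply: eq_bigr => k _; rewrite mulr1.
Qed.

Lemma arrival_mx_law t (b : arrivals) :
  Pr (@sw_a _ _ W t @^-1` [set (arrival_mx b : state)]) = (arrival_prob m b)%:E.
Proof.
have -> : @sw_a _ _ W t @^-1` [set (arrival_mx b : state)]
    = \big[setI/setT]_(u <- index_enum ('I_n * 'I_n)%type) (arrival (W := W) u t @^-1` [set (b u : nat)]).
  rewrite -bigcap_seq; apply/seteqP; split => w /=.
    by move=> e [i j] _ /=; rewrite /arrival e mxE.
  move=> h; apply/matrixP => i j; rewrite mxE.
  by have := h (i, j) (mem_index_enum _); rewrite /arrival.
rewrite (arr_indep_pairs SA (index_enum_uniq _)); last first.
  by move=> u _; apply: sub_sigma_algebra; exists t, [set (b u : nat)].
rewrite /arrival_prob (big_morph EFin (id1 := 1%E) (op1 := *%E)) //.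
by apply: eq_bigr => u _; exact: marginal_lawE.
Qed.

Lemma marginal_law_zero u : 0 < m u ord0.
Proof.
have := arr_zero SA 0%N.
have -> : (\matrix_(i, j) 0%N : state) = arrival_mx ([ffun=> ord0] : arrivals).
  by apply/matrixP => i j; rewrite !mxE ffunE.
rewrite arrival_mx_law lte_fin /arrival_prob (bigD1 u) //= ffunE => h.
have := marginal_law_ge0 u ord0; rewrite le_eqVlt => /orP[/eqP e|//].
by move: h; rewrite -e mul0r ltxx.
Qed.

Lemma arrival_mx_of b : (0 < Pr (@sw_a _ _ W 0 @^-1` [set b]))%E ->
  exists b' : arrivals, b = arrival_mx b'.
Proof.
move=> b0; exists [ffun u => inord (b u.1 u.2)].
apply/matrixP => i j; rewrite mxE ffunE inordK //= ltnS leqNgt; apply/negP => h.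
move: b0; rewrite (_ : _ @^-1` _ = set0) ?measure0 ?ltxx //.
apply/seteqP; split => // w /= e.
by have := arr_bounded SA 0 w i j; rewrite e leqNgt h.
Qed.

Let Z t w : arrivals * 'S_n := ([ffun u => cell u t w], @sw_s _ _ W t w).

Let Z_preimage t b sg : Z t @^-1` [set (b, sg)] =
  (@sw_a _ _ W t @^-1` [set (arrival_mx b : state)]) `&` (@sw_s _ _ W t @^-1` [set sg]).
Proof.
apply/seteqP; split => w /=.
  move=> [<- <-]; split => //; apply/matrixP => i j.
  by rewrite mxE ffunE cellE.
move=> [e <-]; rewrite /Z; congr (_, _); apply/ffunP => u; rewrite ffunE.
by apply/val_inj; rewrite /= cellE /arrival e mxE; case: (u).
Qed.

Let Z_rv t : discrete_rv (Z t).
Proof.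
move=> B; have -> : Z t @^-1` B = \bigcup_(j in B) (Z t @^-1` [set j]).
  apply/seteqP; split => w /=; first by move=> Bw; exists (Z t w).
  by move=> [j Bj /= ->].
apply: fin_bigcup_measurable; first exact: finite_finset.
move=> [b sg] _; rewrite Z_preimage.
by apply: measurableI; [exact: a_rv|exact: s_rv].
Qed.

Let q_next t w : @sw_q _ _ W t.+1 w = queue_nxt (@sw_q _ _ W t w) (Z t w).
Proof.
case: SD => _ _ ->; rewrite /queue_nxt; congr next_queue.
by apply/matrixP => i j; rewrite mxE ffunE cellE.
Qed.

Let history_sub t A : history (W := W) t A -> history_tilde (W := W) t A.
Proof.
apply: sub_sigma_algebra2 => B [k [[kt [C ->]]|[kt [C ->]]]].
  by exists k; split => //; left; exists C.
by exists k; split; [exact: ltnW|right; exists C].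
Qed.

Let history_tildeI t A B : history_tilde (W := W) t A -> history_tilde (W := W) t B ->
  history_tilde (W := W) t (A `&` B).
Proof.
move=> hA hB; exact: (@measurableI _ (g_sigma_algebraType [set A | exists k : nat, (k <= t)%N /\
        ((exists B, A = @sw_q _ _ W k @^-1` B) \/ (exists B, A = @sw_s _ _ W k @^-1` B))]) A B hA hB).
Qed.

(** Given the past, the arrivals and the schedule follow the law of the
    kernel. *)
Lemma joint_law t A x (j : arrivals * 'S_n) : history (W := W) t A ->
  Pr (A `&` (@sw_q _ _ W t @^-1` [set x]) `&` (Z t @^-1` [set j])) =
  (Pr (A `&` (@sw_q _ _ W t @^-1` [set x])) * (queue_wt m mu x j)%:E)%E.
Proof.
case: j => b sg hA; rewrite Z_preimage (setIC (_ @^-1` _) (@sw_s _ _ W t @^-1` _)) setIA.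
rewrite (arr_indep_history SA).
  by rewrite SS // arrival_mx_law -muleA -EFinM /queue_wt /= mulrC.
apply: history_tildeI; first apply: history_tildeI; first exact: history_sub.
  by apply: sub_sigma_algebra; exists t; split => //; left; exists [set x].
by apply: sub_sigma_algebra; exists t; split => //; right; exists [set sg].
Qed.

Let historyT t : history (W := W) t setT.
Proof. exact: (@measurableT _ (g_sigma_algebraType _)). Qed.

Local Notation P := (avg (queue_wt m mu) queue_nxt).
Local Notation Pt t f := (iter t (avg (queue_wt m mu) queue_nxt) f).

Let wt0 := queue_wt_ge0 marginal_law_ge0 mu_prob.
Let wt1 := queue_wt_sum1 marginal_law_sum1 mu_prob.

Lemma expectation_step t (f : state -> R) : (forall x, 0 <= f x) ->
  ('E_Pr[fun w => f (sw_q t.+1 w)] = 'E_Pr[fun w => P f (sw_q t w)])%E.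
Proof.
move=> f0; rewrite unlock (integral_finite_partition Pr (Z_rv t)).
- transitivity (\sum_j \int[Pr]_w (queue_wt m mu (sw_q t w) j * f (queue_nxt (sw_q t w) j))%:E)%E.
    apply: eq_bigr => j _.
    transitivity (\int[Pr]_(w in Z t @^-1` [set j]) (f (queue_nxt (sw_q t w) j))%:E)%E.
      by apply: eq_integral => w /set_mem /= jE; rewrite q_next jE.
    apply: (eq_integral_discrete (X := @sw_q _ _ W t)
      (f := fun x => f (queue_nxt x j)) (g := fun x => queue_wt m mu x j * f (queue_nxt x j))) => //.
    + exact: Z_rv.
    + by move=> x; rewrite mulr_ge0.
    + move=> x; have := @joint_law t setT x j (@historyT t); rewrite !setTI setIC => ->.
      by rewrite muleCA [RHS]muleC EFinM; congr (_ * _)%E; exact: muleC.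
  rewrite -ge0_integral_sum //.
  + by apply: eq_integral => w _; rewrite sumEFin.
  + move=> j; exact: (measurable_fun_discrete
      (fun x => (queue_wt m mu x j * f (queue_nxt x j))%:E) (q_rv t)).
  + by move=> j w _; rewrite lee_fin mulr_ge0.
- by move=> w; rewrite lee_fin.
- exact: (measurable_fun_discrete (fun x => (f x)%:E) (q_rv t.+1)).
Qed.

Lemma expectation_steps t (f : state -> R) : (forall x, 0 <= f x) ->
  ('E_Pr[fun w => f (sw_q t w)] = 'E_Pr[fun w => Pt t f (sw_q 0 w)])%E.
Proof.
elim: t f => [//|t IH] f f0; rewrite expectation_step // IH //.
  by congr ('E_Pr[_])%E; apply/funext => w; rewrite iterSr.
exact: (@avgn_ge0 _ _ _ _ queue_nxt wt0 wt1 1).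
Qed.

Definition reachable_set : set state := [set x | reachable W mu x].
Local Notation S := reachable_set.

Lemma reachable_closed x j : S x -> 0 < queue_wt m mu x j -> S (queue_nxt x j).
Proof.
case: j => b sg Sx; rewrite /queue_wt /= => w0.
have pa0 : 0 < arrival_prob m b.
  rewrite lt_def arrival_prob_ge0 ?andbT; last exact: marginal_law_ge0.
  by apply: contraTneq w0 => ->; rewrite mul0r ltxx.
apply: reachableS => //; last by rewrite arrival_mx_law lte_fin.
by move: w0; rewrite pmulr_rgt0.
Qed.

Lemma reachable_from_empty y : S y -> exists k, 0 < Pt k (ind [set y]) (@empty_queue n').
Proof.
elim=> [|x b sg Sx [k hk] mu0 b0].
  by exists 0%N; rewrite /= /ind asboolT.
have [b' bE] := arrival_mx_of b0; subst b; exists (k + 1)%N.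
apply: lt_le_trans (avgn_ind_split _ wt0 wt1 _ _ _ x _); rewrite mulr_gt0 //.
have b'0 : 0 < arrival_prob m b' by move: b0; rewrite arrival_mx_law lte_fin.
apply: (@lt_le_trans _ _ (queue_wt m mu x (b', sg))); first by rewrite /queue_wt mulr_gt0.
rewrite /= /avg (bigD1 (b', sg)) //= /queue_nxt /= {1}/ind asboolT // mulr1 lerDl.
by apply: sumr_ge0 => j _; rewrite mulr_ge0 // ind_ge0.
Qed.

Hypothesis q0_S : Pr (sw_q 0%N @^-1` S) = 1%E.

Lemma reachable_prob1 t : Pr (sw_q t @^-1` S) = 1%E.
Proof.
have ES k : Pr (sw_q k @^-1` S) = 'E_Pr[fun w => ind S (sw_q k w)]%E.
  rewrite -expectation_indic; last exact: q_rv.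
  congr ('E_Pr[_])%E; apply/funext => w; rewrite /ind indicE.
elim: t => [//|t IH]; apply/eqP; rewrite eq_le probability_le1 /=; last exact: q_rv.
rewrite -IH !ES expectation_step; last by move=> x; exact: ind_ge0.
apply: expectation_le.
- exact: (measurable_fun_discrete (ind S) (q_rv t)).
- exact: (measurable_fun_discrete (P (ind S)) (q_rv t)).
- by move=> w; exact: ind_ge0.
- by move=> w; apply: (@avgn_ge0 _ _ _ _ queue_nxt wt0 wt1 1) => x; exact: ind_ge0.
apply: aeW => w; rewrite {1}/ind; case: asboolP => /= [Sx|_]; last first.
  by apply: (@avgn_ge0 _ _ _ _ queue_nxt wt0 wt1 1) => x; exact: ind_ge0.
rewrite -[leLHS](avg_cst queue_nxt wt1 1 (sw_q t w)); apply: avg_le_at => // j wj.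
by rewrite /ind asboolT //; exact: reachable_closed Sx wj.
Qed.

Let path_history t (x : nat -> state) :
  history (W := W) t (\bigcap_(k in `I_t.+1) (sw_q k @^-1` [set x k])).
Proof.
pose G := [set A | exists k : nat,
        ((k <= t)%N /\ exists B, A = @sw_q _ _ W k @^-1` B) \/
        ((k < t)%N /\ exists B, A = @sw_s _ _ W k @^-1` B)].
apply: (@bigcap_measurable _ (g_sigma_algebraType G)); first by exists 0%N.
move=> k /= kt; apply: sub_sigma_algebra; exists k; left; split; first by rewrite -ltnS.
by exists [set x k].
Qed.

Lemma kernel_markov_chain : markov_chain S (kernel_mx (queue_wt m mu) queue_nxt) Pr (@sw_q _ _ W).
Proof.
split.
- exact: reachable_prob1.
- by move=> x y _ _; exact: kernel_mx_ge0.
- by move=> x Sx; apply: kernel_mx_sum => //; exact: reachable_closed.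
move=> t x xS; set A := \bigcap_(k in `I_t.+1) _.
have hA : history (W := W) t A by exact: path_history.
have mA : measurable A.
  by apply: bigcap_measurable; [exists 0%N|move=> k _; exact: q_rv].
have -> : \bigcap_(k in `I_t.+2) (sw_q k @^-1` [set x k]) = A `&` (sw_q t.+1 @^-1` [set x t.+1]).
  apply/seteqP; split => w /=.
    by move=> h; split; [move=> k /= kt; apply: h => /=; rewrite ltnS ltnW|apply: h => /=].
  move=> [h1 h2] k /=; rewrite ltnS leq_eqVlt => /orP[/eqP ->//|kt]; exact: h1.
have Aq : A `&` (sw_q t @^-1` [set x t]) = A.
  by apply/setIidPl => w h; exact: (h t (ltnSn t)).
rewrite (measure_finite_partition Pr (Z_rv t)); last first.
  by apply: measurableI => //; exact: q_rv.
rewrite /kernel_mx /avg -sumEFin ge0_sume_distrr; last first.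
  by move=> j _; rewrite lee_fin mulr_ge0 // ind_ge0.
apply: eq_bigr => j _; rewrite /ind; case: asboolP => /= xj.
  rewrite mulr1 -[in RHS]Aq -(joint_law _ _ hA) Aq; congr (Pr _).
  apply/seteqP; split => w; first by move=> [[h1 h2] h3].
  move=> [h zj]; split => //; split => //.
  by rewrite /= q_next zj (h t (ltnSn t)).
rewrite mulr0 mule0 (_ : _ `&` _ = set0) ?measure0 //.
apply/seteqP; split => // w /= [[h1 h2] zj]; apply: xj.
by rewrite -h2 q_next zj (h1 t (ltnSn t)).
Qed.

End Switch_kernel.

(** * State space collapse and heavy traffic *)

Section One_switch.
Context {R : realType} {n' amax : nat}.
Local Notation n := n'.+1.
Local Notation state := 'M[nat]_n.
Variable W : switch R n.
Variable mu : schedule_law R n.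
Variables (e c : R).
Local Notation Pr := (sw_P W).
Hypothesis SA : switch_arrivals W amax.
Hypothesis SD : switch_dynamics W.
Hypothesis SS : scheduled_by W mu.
Hypothesis q0_S : Pr (sw_q 0%N @^-1` [set x | reachable W mu x]) = 1%E.
Hypothesis arr_mean : forall t i j, ('E_Pr[arrivalR i j t] = ((1 - e) / n%:R)%:E)%E.
Hypothesis e01 : 0 < e < 1.
Hypothesis c_gt0 : 0 < c.
Hypothesis mu_prob : forall q, prob (mu q).
Hypothesis mu_gap : forall q i k j l,
  total q / n%:R + c * `|second_diff q i k j l| <= mean_weight (mu q) q.

Local Notation m := (marginal_law (amax := amax) W).
Local Notation P := (avg (queue_wt m mu) queue_nxt).
Local Notation Pt t f := (iter t (avg (queue_wt m mu) queue_nxt) f).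
Local Notation L := (stationary m mu).
Local Notation x0 := (@empty_queue n').

Let m_ge0 := @marginal_law_ge0 R n' amax W.
Let m_sum1 := marginal_law_sum1 SA.
Let m_zero := marginal_law_zero SA.
Let wt0 := queue_wt_ge0 m_ge0 mu_prob.
Let wt1 := queue_wt_sum1 m_sum1 mu_prob.

Lemma marginal_law_mean u : \sum_k m u k * k%:R = (1 - e) / n%:R.
Proof.
have := arrival_expectation SA u 0 (g := fun k => k%:R) (fun k => ler0n R k).
have -> : (fun w => (arrival (W := W) u 0 w)%:R) = arrivalR u.1 u.2 0 :> (_ -> R) by [].
by rewrite arr_mean => -[].
Qed.
Let m_mean := marginal_law_mean.

Lemma marginal_law_variance i j :
  ('V_Pr[arrivalR i j 0%N] = (var m e (i, j))%:E)%E.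
Proof.
rewrite /variance covariance.unlock arr_mean /=.
rewrite -(arrival_expectation SA (i, j) 0 (g := fun k => (k%:R - (1 - e) / n%:R) ^+ 2)).
  by congr ('E_Pr[_])%E; apply/funext => w; rewrite /= expr2.
by move=> k; exact: sqr_ge0.
Qed.

Local Notation dom := (dominated (@lyap R n' amax e)).

(** The expectation at time [t] is that of the [t]-step average at time [0];
    for a function of variable sign, add its bound first. *)
Lemma switch_converges f : bounded_fn f ->
  ('E_Pr[fun w => f (sw_q t w)] @[t --> \oo] --> (L f)%:E)%E.
Proof.
have pos g : bounded_fn g -> (forall x, 0 <= g x) ->
    ('E_Pr[fun w => g (sw_q t w)] @[t --> \oo] --> (L g)%:E)%E.
  move=> [M gM] g0.
  rewrite (_ : (fun t => _) = (fun t => 'E_Pr[fun w => Pt t g (sw_q 0 w)]%E)); last first.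
    by apply/funext => t; exact: (expectation_steps SA SD SS mu_prob).
  apply: (@expectation_bounded_cvg _ _ _ Pr _ (@sw_q _ _ W 0%N) (fun t => Pt t g) (L g) M).
  - by case: SD.
  - move=> t x; apply: (le_trans (avgn_norm _ wt0 _ _ _)).
    by rewrite -[leRHS](avgn_cst queue_nxt wt1 t M x); apply: avgn_le.
  - move=> x; apply: (stationary_cvg m_ge0 m_sum1 m_zero mu_prob e01 c_gt0 m_mean mu_gap).
    exact: dom_bounded gM.
move=> bf; have [M fM] := bf.
have bg : bounded_fn (fun x => f x + M).
  exists (M + M) => x; rewrite (le_trans (ler_normD _ _)) // lerD // ger0_norm //.
  exact: le_trans (normr_ge0 _) (fM x).
have g0 x : 0 <= f x + M by rewrite -lerBlDr sub0r; have := fM x; rewrite ler_norml => /andP[].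
have df : dom f by exact: dom_bounded fM.
have -> : L f = L (fun x => f x + M) - M.
  rewrite (stationaryD m_ge0 m_sum1 m_zero mu_prob e01 c_gt0 m_mean mu_gap) //; last first.
    by apply: (@dom_bounded _ _ _ _ e01 _ `|M|).
  by rewrite (stationary_cst m_sum1 mu_prob) addrK.
rewrite (_ : (fun t => _) = (fun t => 'E_Pr[fun w => (f (sw_q t w) + M)%R] - M%:E)%E); last first.
  apply/funext => t; rewrite (expectation_shift _ _ _ fM) ?addeK //.
  by case: SD.
rewrite EFinB; apply: cvgeB => //; first exact: pos.
exact: cvg_cst.
Qed.

Lemma steady_expectation Y f : steady_state W Y -> bounded_fn f ->
  ('E_(rq_P Y)[fun w => f (rq_q w)] = (L f)%:E)%E.
Proof.
move=> sY bf; have c1 := sY f bf; have c2 := switch_converges bf.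
exact: (cvg_unique _ c1 c2).
Qed.

(** The stationary functional is the expectation of a random queue by
    tightness, and the law of the queue converges to it. *)
Lemma steady_exists : exists Y, steady_state W Y.
Proof.
have [Y hY] : exists Y : random_queue R n, forall f, bounded_fn f ->
    ('E_(rq_P Y)[fun w => f (rq_q w)] = (L f)%:E)%E.
  apply: limit_law_exists.
  - move=> f [M fM]; apply: (stationary_ge0 m_ge0 m_sum1 m_zero mu_prob e01 c_gt0 m_mean mu_gap).
    exact: dom_bounded fM.
  - move=> f g k [M fM] [N gN].
    rewrite (stationaryD m_ge0 m_sum1 m_zero mu_prob e01 c_gt0 m_mean mu_gap).
    + rewrite (stationaryZ m_ge0 m_sum1 m_zero mu_prob e01 c_gt0 m_mean mu_gap) //.
      exact: dom_bounded gN.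
    + exact: dom_bounded fM.
    + by apply: dominatedZ; exact: dom_bounded gN.
  - by move=> k; exact: (stationary_cst m_sum1 mu_prob).
  - by move=> d d0; exact: (stationary_tight m_ge0 m_sum1 m_zero mu_prob e01 c_gt0 m_mean mu_gap).
by exists Y => f bf; rewrite hY //; exact: switch_converges.
Qed.

(** The means of the truncations of [f] converge both to the mean of [f] and,
    by [stationary_truncation], to the stationary value of [f]. *)
Lemma steady_expectation_ge0 Y (f : state -> R) : steady_state W Y -> dom f -> dom (fun q => f q ^+ 2) ->
  (forall q, 0 <= f q) -> ('E_(rq_P Y)[fun w => f (rq_q w)] = (L f)%:E)%E.
Proof.
move=> sY df df2 f0.
apply: (@expectation_truncation _ _ _ (rq_P Y) _ (@rq_q _ _ Y) f
  (fun k => L (fun q => Num.min (f q) k%:R))) => //.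
- exact: rq_meas.
- move=> k; apply: steady_expectation => //; exists k%:R => q.
  by rewrite ger0_norm ?le_min ?f0 //= ge_min lexx orbT.
- exact: (stationary_truncation m_ge0 m_sum1 m_zero mu_prob e01 c_gt0 m_mean mu_gap).
Qed.

Lemma steady_total Y : steady_state W Y -> mean_total Y = (L total)%:E.
Proof.
move=> sY; apply: (steady_expectation_ge0 sY).
- exact: dom_total1.
- exact: dom_total.
- by move=> q; exact: total_ge0.
Qed.

Lemma steady_perp Y r : steady_state W Y ->
  perp_moment r Y = (L (fun q => perp_norm q ^+ r))%:E.
Proof.
move=> sY; apply: (steady_expectation_ge0 (f := fun q => perp_norm q ^+ r) sY).
- exact: dom_perp.
- by under eq_fun do rewrite -exprM; exact: dom_perp.
- by move=> q; rewrite exprn_ge0 // perp_norm_ge0.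
Qed.

Lemma queue_chain : exists p : state -> state -> R,
  [/\ markov_chain [set x | reachable W mu x] p Pr (@sw_q _ _ W),
      irreducible_chain [set x | reachable W mu x] p,
      aperiodic_chain [set x | reachable W mu x] p &
      positive_recurrent [set x | reachable W mu x] p].
Proof.
exists (kernel_mx (queue_wt m mu) queue_nxt).
have closed := @reachable_closed R n' amax W mu SA.
have to0 (x : state) : reachable W mu x -> exists k, 0 < Pt k (ind [set x0]) x.
  move=> _; exists (totn x).
  apply: lt_le_trans (reach_empty m_ge0 m_sum1 mu_prob c_gt0 mu_gap m_zero (leqnn _)).
  by rewrite exprn_gt0 // reach_prob_gt0.
have from0 := reachable_from_empty SA mu_prob.
split.
- exact: (kernel_markov_chain SA SD SS mu_prob q0_S).
- exact: (kernel_irreducible wt0 wt1 closed to0 from0).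
- apply: (kernel_aperiodic wt0 wt1 closed _ to0 from0).
  have t0 : (totn x0 <= 1)%N by rewrite /totn big1 // => i _; rewrite big1 // => j _; rewrite mxE.
  apply: lt_le_trans (reach_empty m_ge0 m_sum1 mu_prob c_gt0 mu_gap m_zero t0).
  by rewrite exprn_gt0 // reach_prob_gt0.
have d01 (f : state -> R) : (forall x, 0 <= f x <= 1) -> dom f.
  move=> f01; apply: (@dom_bounded _ _ _ _ e01 _ 1) => x.
  by have /andP[f0 f1] := f01 x; rewrite ger0_norm.
apply: (kernel_positive_recurrent wt0 wt1 closed (L := L)).
- move=> f g f01 g01 fg.
  by apply: (stationary_le m_ge0 m_sum1 m_zero mu_prob e01 c_gt0 m_mean mu_gap) => //; exact: d01.
- move=> f g k f01 g01.
  rewrite (stationaryD m_ge0 m_sum1 m_zero mu_prob e01 c_gt0 m_mean mu_gap).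
  + rewrite (stationaryZ m_ge0 m_sum1 m_zero mu_prob e01 c_gt0 m_mean mu_gap) //; exact: d01.
  + exact: d01.
  + by apply: dominatedZ; exact: d01.
- move=> f f01.
  by apply: (stationary_avg m_ge0 m_sum1 m_zero mu_prob e01 c_gt0 m_mean mu_gap); exact: d01.
- exact: (stationary_cst m_sum1 mu_prob).
- move=> y Sy.
  apply: (stationary_gt0 m_ge0 m_sum1 m_zero mu_prob e01 c_gt0 m_mean mu_gap).
  exact: from0.
Qed.

End One_switch.

Section Family.
Context {R : realType} {n' amax : nat}.
Local Notation n := n'.+1.
Variable F : R -> switch R n.
Variable sigma : 'M[R]_n.
Variable mu : schedule_law R n.
Hypothesis mu_like : maxweight_like mu.
Hypothesis F_family : uniform_family F amax sigma mu.

Lemma family_SSC_queue : SSC_queue F mu.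
Proof.
have [mu_prob [c c_gt0 mu_gap]] := mu_like.
have [UA UD US UI UM UV] := F_family.
split.
- move=> e e01; split; last first.
    move=> t B; apply: sub_sigma_algebra; exists t; split => //; left; exists B; exact: erefl.
  exact: (queue_chain (UA e e01) (UD e e01) (US e e01) (UI e e01) (UM e e01) e01 c_gt0 mu_prob mu_gap).
- move=> e e01; split=> // A fA.
  exact: sub_finite_set fA.
- move=> e e01.
  exact: (steady_exists (UA e e01) (UD e e01) (US e e01) (UM e e01) e01 c_gt0 mu_prob mu_gap).
have n0 : 0 < n%:R :> R by rewrite ltr0n.
exists (c / (4 * n%:R ^+ 2)); split; first by rewrite divr_gt0 // mulr_gt0 // exprn_gt0.
exists (@perp_moment_const R n' amax c) => e e01 ec Y sY r _.
rewrite (steady_perp (UA e e01) (UD e e01) (US e e01) (UM e e01) e01 c_gt0 mu_prob mu_gap) //.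
rewrite lee_fin.
apply: (stationary_perp _ (marginal_law_sum1 (UA e e01)) (marginal_law_zero (UA e e01))
  mu_prob e01 c_gt0 (marginal_law_mean (UA e e01) (UM e e01)) mu_gap) => //.
exact: marginal_law_ge0.
Qed.

(** In [stationary_total] the choice [eta = Num.sqrt e] makes both error terms
    of order [Num.sqrt e], because the second moment of the distance to the cone
    is bounded uniformly in [e]. *)
Lemma family_heavy_traffic : heavy_traffic_limit F sigma.
Proof.
have [mu_prob [c c_gt0 mu_gap]] := mu_like.
have [UA UD US UI UM UV] := F_family.
move=> Y sY.
have n0 : 0 < n%:R :> R by rewrite ltr0n.
pose m e := marginal_law (amax := amax) (F e).
pose T e := stationary (m e) mu total.
pose C2 := @perp_moment_const R n' amax c 2.
pose e0 := c / (4 * n%:R ^+ 2).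
have e0_gt0 : 0 < e0 by rewrite divr_gt0 // mulr_gt0 // exprn_gt0.
pose A e := n%:R / 2 * sqproj_drift (m e) e.
pose h (e : R) := n%:R / 2 * ((4 * C2 + 4 * n%:R ^+ 2) * Num.sqrt e + 2 * n%:R * e).
have bound e : 0 < e < 1 -> e <= e0 -> A e - h e <= e * T e <= A e + h e.
  move=> e01 ee0; have /andP[ep _] := e01.
  pose s := Num.sqrt e; have s0 : 0 < s by rewrite sqrtr_gt0.
  have sE : s * s = e by rewrite -expr2 sqr_sqrtr // ltW.
  have mge0 := @marginal_law_ge0 R n' amax (F e).
  have m1 := marginal_law_sum1 (UA e e01); have mz := marginal_law_zero (UA e e01).
  have mm := marginal_law_mean (UA e e01) (UM e e01).
  have h1 := stationary_total mge0 m1 mz mu_prob e01 c_gt0 mm mu_gap s0.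
  have h2 := stationary_perp mge0 m1 mz mu_prob e01 c_gt0 mm mu_gap 2 ee0.
  have h3 : `|2 * (e / n%:R) * T e - sqproj_drift (m e) e| <=
      (4 * C2 + 4 * n%:R ^+ 2) * s + 2 * n%:R * e.
    apply: (le_trans h1).
    have -> : (4 * n%:R / s + 2) * (n%:R * e) = 4 * n%:R ^+ 2 * s + 2 * n%:R * e.
      by rewrite -sE; field; rewrite gt_eqF.
    rewrite [leLHS]addrA lerD2r (mulrDl (4 * C2)) lerD2r (mulrAC 4 s).
    by rewrite ler_pM2r // ler_pM2l.
  move: h3; rewrite ler_distl => /andP[h3 h4].
  have n2 : 0 < n%:R / 2 :> R by rewrite divr_gt0.
  have eT : e * T e = n%:R / 2 * (2 * (e / n%:R) * T e) by field; rewrite gt_eqF.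
  by rewrite eT /A /h -(mulrBr (n%:R / 2)) -(mulrDr (n%:R / 2)) !(ler_pM2l n2) h3 h4.
have near_e : \forall e \near 0^'+, 0 < e < 1 /\ e <= e0.
  near=> e; split; last by near: e; exact: nbhs_right_le.
  by apply/andP; split; near: e; [exact: nbhs_right_gt|exact: nbhs_right_lt].
have h_cvg : h e @[e --> 0^'+] --> (0 : R).
  have s_cvg : Num.sqrt e @[e --> 0^'+] --> (0 : R).
    by rewrite -[X in _ --> X]sqrtr0; apply: cvg_at_right_filter; exact: sqrt_continuous.
  have e_cvg : e @[e --> 0^'+] --> (0 : R) by apply: cvg_at_right_filter; exact: cvg_id.
  have z : n%:R / 2 * ((4 * C2 + 4 * n%:R ^+ 2) * 0 + 2 * n%:R * 0) = 0 :> R.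
    by rewrite !mulr0 addr0 mulr0.
  rewrite -[X in _ --> X]z.
  apply: cvgM; first exact: cvg_cst.
  by apply: cvgD; (apply: cvgM; first exact: cvg_cst).
have v_cvg i j : var (m e) e (i, j) @[e --> 0^'+] --> sigma i j ^+ 2.
  have := UV i j; move=> /fine_cvg; apply: cvg_trans; apply: near_eq_cvg.
  near=> e; have [e01 _] : 0 < e < 1 /\ e <= e0 by near: e.
  by rewrite /= (marginal_law_variance (UA e e01) (UM e e01)).
have vs_cvg : (\sum_u var (m e) e u) @[e --> 0^'+] --> \sum_(u : 'I_n * 'I_n) sigma u.1 u.2 ^+ 2.
  elim: (index_enum _) => [|u r IH].
    rewrite big_nil; under eq_fun do rewrite big_nil; exact: cvg_cst.
  rewrite big_cons; under eq_fun do rewrite big_cons.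
  by apply: cvgD => //; case: u => i j; exact: v_cvg.
set l := (1 - _) * _.
have A_cvg : A e @[e --> 0^'+] --> l.
  have e_cvg : e ^+ 2 @[e --> 0^'+] --> (0 : R).
    rewrite -[X in _ --> X](mul0r (0 : R)); under eq_fun do rewrite expr2.
    by apply: cvgM; apply: cvg_at_right_filter; exact: cvg_id.
  have -> : l = n%:R / 2 * ((2 / n%:R - 1 / n%:R ^+ 2) * (\sum_(u : 'I_n * 'I_n) sigma u.1 u.2 ^+ 2) + 0).
    by rewrite /l frob_sqr_pair addr0 natrM; move: (\sum_u _) => s; field; rewrite gt_eqF.
  apply: cvgM; first exact: cvg_cst.
  apply: cvgD => //; apply: cvgM => //; exact: cvg_cst.
apply: (cvg_trans (near_eq_cvg (f := fun e => (e * T e)%:E) _)).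
  near=> e; have [e01 _] : 0 < e < 1 /\ e <= e0 by near: e.
  rewrite /= (steady_total (UA e e01) (UD e e01) (US e e01) (UM e e01) e01 c_gt0 mu_prob mu_gap (sY e e01)).
  by rewrite -EFinM.
apply: cvg_EFin; first by near=> e.
apply: (@squeeze_cvgr _ _ _ _ (fun e => A e - h e) (fun e => A e + h e)).
- near=> e; have [e01 ee0] : 0 < e < 1 /\ e <= e0 by near: e.
  exact: bound.
- by rewrite -[X in _ --> X]subr0; apply: cvgB.
- by rewrite -[X in _ --> X]addr0; apply: cvgD.
Unshelve. all: by end_near. Qed.

End Family.

Theorem proposition8 (R : realType) (n d : nat) (hn : (1 <= n)%N)
    (F : R -> switch R n) (amax : nat) (sigma : 'M[R]_n)
    (rule : 'M[nat]_n -> seq 'S_n -> 'S_n -> R) (hrule : selection_rule rule) :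
  ((2 <= d)%N -> uniform_family F amax sigma (power_of_d rule d) ->
     [/\ SSC F, SSC_queue F (power_of_d rule d) &
         heavy_traffic_limit F sigma])
  /\
  ((2 <= n)%N -> (1 <= d)%N ->
     uniform_family F amax sigma (random_flip rule d) ->
     [/\ SSC F, SSC_queue F (random_flip rule d) &
         heavy_traffic_limit F sigma]).
Proof.
case: n hn F sigma rule hrule => [//|n'] _ F sigma rule hrule.
split=> [d2 H|n2 d1 H].
  have ml := power_of_d_maxweight_like hrule d2.
  have S := family_SSC_queue ml H.
  by split; [exact: SSC_queueW S|exact: S|exact: family_heavy_traffic ml H].
have ml := random_flip_maxweight_like hrule n2 d1.
have S := family_SSC_queue ml H.
by split; [exact: SSC_queueW S|exact: S|exact: family_heavy_traffic ml H].
Qed.
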